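(* For each fixed $h>0$, let $(\overline g_h,\overline q_h)\in H\times Q$ be the optimal control of the discrete problem $(P_h)$ and, for $\alpha>0$, let $(\overline g_{h\alpha},\overline q_{h\alpha})\in H\times Q$ be the optimal control of the discrete problem $(P_{h\alpha})$. Then $$\lim_{\alpha\to+\infty}\|(\overline g_{h\alpha},\overline q_{h\alpha})-(\overline g_h,\overline q_h)\|_{H\times Q}=0,$$ $$\lim_{\alpha\to+\infty}\|u_{h\alpha\overline g_{h\alpha}\overline q_{h\alpha}}-u_{h\overline g_h\overline q_h}\|_V=0,\qquad \lim_{\alpha\to+\infty}\|p_{h\alpha\overline g_{h\alpha}\overline q_{h\alpha}}-p_{h\overline g_h\overline q_h}\|_V=0.$$
   Context: Setting. $\Omega\subset\mathbb R^d$ is a bounded polygonal domain whose boundary $\Gamma$ is the union of two disjoint portions $\Gamma_1,\Gamma_2$ of positive $(d-1)$-dimensional Hausdorff measure. $H=L^2(\Omega)$, $Q=L^2(\Gamma_2)$, $\|(g,q)\|_{H\times Q}^2=\|g\|_H^2+\|q\|_Q^2$, $V=H^1(\Omega)$ with its usual norm $\|\cdot\|_V$, $b>0$ is a constant. Boundary values are traces. Given data: $z_d\in H$ and constants $M_1,M_2>0$. Bilinear forms: $a(u,v)=\int_\Omega\nabla u\cdot\nabla v\,dx$ and, for $\alpha>0$, $a_\alpha(u,v)=a(u,v)+\alpha\int_{\Gamma_1}uv\,d\Gamma$. Discretization. For each $h>0$, $\tau_h$ is a triangulation of $\Omega$ of a regular family (Lagrange triangles of type 1, affine-equivalent finite elements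 of class $C^0$), $h$ being the longest side of the triangles $T\in\tau_h$. $V_h=\{v_h\in C^0(\overline\Omega): v_h|_T\in P_1(T)\ \forall T\in\tau_h\}$ ($P_1$: polynomials of degree at most 1), $V_{0h}=\{v_h\in V_h: v_h=0\text{ on }\Gamma_1\}$, $K_h=b+V_{0h}$. Discrete problems. For $(g,q)\in H\times Q$: $u_{hgq}\in K_h$ solves $a(u_{hgq},v_h)=(g,v_h)_H-(q,v_h)_Q$ for all $v_h\in V_{0h}$; $p_{hgq}\in V_{0h}$ solves $a(p_{hgq},v_h)=(u_{hgq}-z_d,v_h)_H$ for all $v_h\in V_{0h}$; $u_{h\alpha gq}\in V_h$ solves $a_\alpha(u_{h\alpha gq},v_h)=(g,v_h)_H-(q,v_h)_Q+\alpha\int_{\Gamma_1}b\,v_h\,d\Gamma$ for all $v_h\in V_h$; $p_{h\alpha gq}\in V_h$ solves $a_\alpha(p_{h\alpha gq},v_h)=(u_{h\alpha gq}-z_d,v_h)_H$ for all $v_h\in V_h$ (all uniquely). Problem $(P_h)$: $(\overline g_h,\overline q_h)$ is the unique minimizer over $H\times Q$ of $J_h(g,q)=\frac12\|u_{hgq}-z_d\|_H^2+\frac{M_1}2\|g\|_H^2+\frac{M_2}2\|q\|_Q^2$. Problem $(P_{h\alpha})$: $(\overline g_{h\alpha},\overline q_{h\alpha})$ is the unique minimizer over $H\times Q$ of $J_{h\alpha}(g,q)=\frac12\|u_{h\alpha gq}-z_d\|_H^2+\frac{M_1}2\|g\|_H^2+\frac{M_2}2\|q\|_Q^2$. *)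

(* Defs.v *)
From HB Require Import structures.
From mathcomp Require Import all_boot all_order all_algebra.
From mathcomp Require Import all_classical all_reals all_analysis.

Set Implicit Arguments.
Unset Strict Implicit.
Unset Printing Implicit Defensive.
Import Order.TTheory GRing.Theory Num.Theory.
Import numFieldNormedType.Exports.

Local Open Scope classical_set_scope.
Local Open Scope ring_scope.

Definition rV_display : measure_display.
Proof. exact: default_measure_display. Qed.

(* R^n is 'rV[R]_n, with the sigma-algebra generated by the coordinates, which
   is the Borel one. *)
Section measurable_rV.
Context {R : realType} (n : nat).

Definition rV_coord (i : 'I_n) (x : 'rV[R]_n) : R := x ord0 i.

HB.instance Definition _ := @isMeasurable.Build rV_display 'rV[R]_n
  (g_sigma_preimage rV_coord) (@sigma_algebra0 _ _ _)
  (@sigma_algebraC _ _) (@sigma_algebra_bigcup _ _ _).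

End measurable_rV.

Section measurable_rV_theory.
Context {R : realType}.

Lemma measurable_rV_coord n (i : 'I_n) : measurable_fun setT (@rV_coord R n i).
Proof.
move=> _ Y mY; rewrite setTI; apply: sub_sigma_algebra => /=.
rewrite -bigcup_seq/=; exists i => /=; first by rewrite mem_index_enum.
by exists Y => //; rewrite setTI.
Qed.

Lemma measurable_fun_rV d (T : measurableType d) n (f : T -> 'rV[R]_n) :
  (forall i, measurable_fun setT (rV_coord i \o f)) -> measurable_fun setT f.
Proof.
move=> mf _ A mA; rewrite setTI.
suff : g_sigma_preimage (fun i => rV_coord i \o f) `<=` measurable.
  rewrite g_sigma_preimage_comp; apply; exists A => //.
  by rewrite setTI.
apply: smallest_sub; first exact: sigma_algebra_measurable.
case: n => [|n] in f mf A mA *; first by rewrite big_ord0.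
rewrite -bigcup_mkord_ord; apply: bigcup_sub => i Ii.
by move=> B [C mC <-]; exact: mf.
Qed.

Definition consr n (p : R * 'rV[R]_n) : 'rV[R]_n.+1 := row_mx p.1%:M p.2.

Definition unconsr n (x : 'rV[R]_n.+1) : R * 'rV[R]_n :=
  (x ord0 ord0, \row_i x ord0 (lift ord0 i)).

Lemma consr0 n p : @consr n p ord0 ord0 = p.1.
Proof.
rewrite /consr mxE; case: splitP => [j _|k /=]; first by rewrite !mxE !ord1.
by rewrite add1n.
Qed.

Lemma consr_lift n p i : @consr n p ord0 (lift ord0 i) = p.2 ord0 i.
Proof.
rewrite /consr mxE; case: splitP => [j /=|k /=].
  by rewrite ord1 /= /bump leq0n.
by rewrite /bump leq0n add1n add1n => -[ik]; congr (p.2 _ _); apply: val_inj.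
Qed.

Lemma consrK n : cancel (@consr n) (@unconsr n).
Proof.
move=> [a y]; rewrite /unconsr; congr pair; first by rewrite consr0.
by apply/rowP => i; rewrite mxE consr_lift.
Qed.

Lemma measurable_consr n : measurable_fun setT (@consr n).
Proof.
apply: measurable_fun_rV => i; rewrite /rV_coord /comp.
have [->|[j ->]] : i = ord0 \/ exists j, i = lift ord0 j.
  by case: (unliftP ord0 i) => [j|] ->; [right; exists j|left].
- by under eq_fun do rewrite consr0; exact: measurable_fst.
- under eq_fun do rewrite consr_lift.
  by apply: (measurableT_comp (measurable_rV_coord j)); exact: measurable_snd.
Qed.

Lemma measurable_unconsr n : measurable_fun setT (@unconsr n).
Proof.
apply/measurable_fun_pairP; split; first exact: measurable_rV_coord.
apply: measurable_fun_rV => i.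
rewrite (_ : _ \o _ = rV_coord (lift ord0 i)); first exact: measurable_rV_coord.
by apply/funext => x; rewrite /rV_coord /= mxE.
Qed.

End measurable_rV_theory.

Section lebesgue_rV_step.
Context {R : realType} (n : nat).
Variable m : {sigma_finite_measure set 'rV[R]_n -> \bar R}.

Definition lebesgue_rV_step : set 'rV[R]_n.+1 -> \bar R :=
  pushforward (lebesgue_measure \x m)%E (@consr R n).

HB.instance Definition _ := Measure.copy lebesgue_rV_step
  (measure_function_pushforward__canonical__measure_function_Measure
    (lebesgue_measure \x m)%E (@measurable_consr R n)).

Lemma lebesgue_rV_step_sigma_finite : sigma_finite setT lebesgue_rV_step.
Proof.
have /sigma_finiteP[F [TF ndF Foo]] := sigma_finiteT (@lebesgue_measure R).
have /sigma_finiteP[G [TG ndG Goo]] := sigma_finiteT m.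
exists (fun k => @unconsr R n @^-1` (F k `*` G k)).
  rewrite -preimage_bigcup -(preimage_setT (@unconsr R n)); congr (_ @^-1` _).
  rewrite -setXTT TF TG predeqE => -[x y]; split.
    move=> [/= [i _ Fix] [k _ Gky]]; exists (maxn i k) => //; split.
    - by move: x Fix; exact/subsetPset/ndF/leq_maxl.
    - by move: y Gky; exact/subsetPset/ndG/leq_maxr.
  by move=> [i _ []/= ? ?]; split; exists i.
move=> k; have [mF Fk] := Foo k; have [mG Gk] := Goo k; split.
  by rewrite -[X in measurable X]setTI; apply: measurable_unconsr => //; exact: measurableX.
rewrite /lebesgue_rV_step /pushforward -comp_preimage.
rewrite (_ : _ \o _ = id); last by apply/funext => p; exact: consrK.
rewrite preimage_id product_measure1E// lte_mul_pinfty// ge0_fin_numE//.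
Qed.

HB.instance Definition _ := Measure_isSigmaFinite.Build _ _ _ lebesgue_rV_step
  lebesgue_rV_step_sigma_finite.

End lebesgue_rV_step.

Fixpoint lebesgue_rV {R : realType} (n : nat) :
    {sigma_finite_measure set 'rV[R]_n -> \bar R} :=
  if n is k.+1 then lebesgue_rV_step (lebesgue_rV k)
  else dirac (0 : 'rV[R]_0).

Lemma lebesgue_rV_box {R : realType} (n : nat) (A : 'I_n -> set R) :
  (forall i, measurable (A i)) ->
  lebesgue_rV n [set x | forall i, A i (x ord0 i)] =
  (\prod_(i < n) lebesgue_measure (A i))%E.
Proof.
elim: n A => [|n IH] A mA.
  by rewrite big_ord0 /= diracE mem_set// => -[].
pose B := [set y : 'rV[R]_n | forall i, A (lift ord0 i) (y ord0 i)].
have mB : measurable B.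
  rewrite (_ : B = \bigcap_(i in [set: 'I_n])
      (rV_coord i @^-1` A (lift ord0 i))); last first.
    by apply/seteqP; split => y /= By i; [move=> _|]; exact: By.
  apply: fin_bigcap_measurable => [|i _]; first exact: finite_finset.
  by rewrite -[X in measurable X]setTI; exact: measurable_rV_coord.
rewrite big_ord_recl -(IH (fun i => A (lift ord0 i)))//.
rewrite -(product_measure1E lebesgue_measure (lebesgue_rV n) (mA ord0) mB).
congr ((_ \x _)%E _).
apply/seteqP; split => -[a y] /=.
  move=> Ay; split => [|i]; first by have := Ay ord0; rewrite consr0.
  by have := Ay (lift ord0 i); rewrite consr_lift.
move=> [/= Aa By] i; case: (unliftP ord0 i) => [j|] ->.
  by rewrite consr_lift; exact: By.
by rewrite consr0.
Qed.

Section hausdorff.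
Context {R : realType} (n : nat).
Implicit Types (x y : 'rV[R]_n) (A : set 'rV[R]_n).

(* The norm of the library on 'rV[R]_n is the sup norm. *)
Definition edist x y : R := Num.sqrt (\sum_i (x ord0 i - y ord0 i) ^+ 2).

Definition diam A : R := sup [set edist x y | x in A & y in A].

Lemma diam_ge0 A : 0 <= diam A.
Proof.
have [hA|/sup_out] := pselect (has_sup [set edist x y | x in A & y in A]);
  last by rewrite /diam => ->.
have [[r Ar] ubA] := hA; apply: le_trans (ub_le_sup ubA Ar).
by have [x _ [y _ <-]] := Ar; exact: sqrtr_ge0.
Qed.

End hausdorff.

Definition unit_ball_volume {R : realType} (k : nat) : R :=
  fine (lebesgue_rV k [set x : 'rV[R]_k | edist x 0 <= 1]).

Section hausdorff_measure.
Context {R : realType} (n k : nat).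
Local Open Scope ereal_scope.

(* Every subset of R^n is measurable in this type, so that mu_ext below ranges
   over all countable covers. *)
Let E := g_sigma_algebraType [set: set 'rV[R]_n].

(* In dimension k = 0, the weight of a nonempty set is 1 and that of the empty
   set is 0. The value +oo discards the sets of diameter larger than delta. *)
Definition hausdorff_weight (delta : R) (A : set E) : \bar R :=
  if A == set0 then 0 else
  if `[< forall x y, A x -> A y -> (edist x y <= delta)%R >]
  then (unit_ball_volume k * (diam A / 2) ^+ k)%:E else +oo.

Definition hausdorff_delta (delta : R) : set 'rV[R]_n -> \bar R :=
  ((hausdorff_weight delta)^*)%mu.

(* k-dimensional Hausdorff (outer) measure on R^n, normalized so that it is
   the k-dimensional area. *)
Definition hausdorff (A : set 'rV[R]_n) : \bar R :=
  ereal_sup [set hausdorff_delta delta A | delta in [set delta | (0 < delta)%R]].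

Lemma hausdorff_weight0 delta : hausdorff_weight delta set0 = 0.
Proof. by rewrite /hausdorff_weight eqxx. Qed.

Lemma hausdorff_weight_ge0 delta A : 0 <= hausdorff_weight delta A.
Proof.
rewrite /hausdorff_weight; case: ifPn => // A0; case: asboolP => // _.
rewrite lee_fin mulr_ge0//; first by rewrite fine_ge0// measure_ge0.
by rewrite exprn_ge0// divr_ge0// diam_ge0.
Qed.

Lemma hausdorff_delta_ge0 delta A : 0 <= hausdorff_delta delta A.
Proof. exact: (mu_ext_ge0 (hausdorff_weight_ge0 delta)). Qed.

Lemma le_hausdorff_delta delta A :
  (0 < delta)%R -> hausdorff_delta delta A <= hausdorff A.
Proof. by move=> d0; apply: ereal_sup_ubound; exists delta. Qed.

Lemma hausdorff0 : hausdorff set0 = 0.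
Proof.
apply/eqP; rewrite eq_le; apply/andP; split.
  apply: ge_ereal_sup => _ [delta _ <-].
  by rewrite /hausdorff_delta mu_ext0//;
    [exact: hausdorff_weight0|exact: hausdorff_weight_ge0].
exact: le_trans (hausdorff_delta_ge0 1 _) (le_hausdorff_delta _ ltr01).
Qed.

Lemma hausdorff_ge0 A : 0 <= hausdorff A.
Proof.
exact: le_trans (hausdorff_delta_ge0 1 _) (le_hausdorff_delta _ ltr01).
Qed.

Lemma le_hausdorff : {homo hausdorff : A B / A `<=` B >-> A <= B}.
Proof.
move=> A B AB; apply: ge_ereal_sup => _ [delta d0 <-].
by apply: le_trans (le_hausdorff_delta B d0); exact: le_mu_ext.
Qed.

Lemma hausdorff_sigma_subadditive : sigma_subadditive hausdorff.
Proof.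
move=> F; apply: ge_ereal_sup => _ [delta d0 <-].
apply: le_trans (mu_ext_sigma_subadditive (hausdorff_weight_ge0 delta) F) _.
apply: lee_nneseries => [i _ _|i _]; first exact: hausdorff_delta_ge0.
exact: le_hausdorff_delta.
Qed.

HB.instance Definition _ := isOuterMeasure.Build R _ hausdorff
  hausdorff0 hausdorff_ge0 le_hausdorff hausdorff_sigma_subadditive.

End hausdorff_measure.

(* Surface measure on the boundary of a domain of R^(n+1): the Hausdorff
   measure of dimension n, on the sigma-algebra of its Caratheodory-measurable
   sets. *)
Definition surface_outer {R : realType} (n : nat) :
  {outer_measure set 'rV[R]_n.+1 -> \bar R} := @hausdorff R n.+1 n.

Definition surface {R : realType} (n : nat) :
    {measure set (caratheodory_type (@surface_outer R n)) -> \bar R} :=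
  [the measure _ _ of
    (@surface_outer R n : set (caratheodory_type (@surface_outer R n)) -> _)].

Section square_integrable.
Context d (T : measurableType d) (R : realType).
Variables (mu : {measure set T -> \bar R}) (D : set T).

(* Elements of L^2(D) are represented by functions on the ambient space, of
   which only the values on D matter. *)
Definition L2 : set (T -> R) := [set f | (f \_ D : T -> R) \in Lfun mu 2%:E].

Definition L2norm (f : T -> R) : R := fine 'N[mu]_2%:E[EFin \o f \_ D].

Definition L2dot (f g : T -> R) : R := (\int[mu]_(x in D) (f x * g x))%R.

End square_integrable.

Section sobolev.
Context {R : realType} (n : nat).
Local Notation E := 'rV[R]_n.+1.
Variable Omega : set E.

Definition partial (i : 'I_n.+1) (f : E -> R) : E -> R :=
  fun x => 'D_('e_i) f x.

Definition C1 (f : E -> R) := continuous f /\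
  forall i, (forall x, derivable f x 'e_i) /\ continuous (partial i f).

(* Test functions of class C^1, rather than smooth, define the same weak
   derivatives of order one. *)
Definition test_function (phi : E -> R) := C1 phi /\
  exists K : set E, [/\ compact K, K `<=` Omega & forall x, ~ K x -> phi x = 0].

Definition is_weak_partial (i : 'I_n.+1) (u w : E -> R) :=
  forall phi, test_function phi ->
    L2dot (lebesgue_rV n.+1) Omega u (partial i phi) =
    - L2dot (lebesgue_rV n.+1) Omega w phi.

Definition H1 : set (E -> R) := [set u | L2 (lebesgue_rV n.+1) Omega u /\
  forall i, exists2 w, L2 (lebesgue_rV n.+1) Omega w & is_weak_partial i u w].

(* A representative of the i-th weak derivative of an element of H1. *)
Definition weak_partial (i : 'I_n.+1) (u : E -> R) : E -> R :=
  get [set w | L2 (lebesgue_rV n.+1) Omega w /\ is_weak_partial i u w].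

Definition H1norm (u : E -> R) : R :=
  Num.sqrt (L2norm (lebesgue_rV n.+1) Omega u ^+ 2 +
    \sum_i L2norm (lebesgue_rV n.+1) Omega (weak_partial i u) ^+ 2).

Definition form_a (u v : E -> R) : R :=
  (\int[lebesgue_rV n.+1]_(x in Omega)
     (\sum_i weak_partial i u x * weak_partial i v x))%R.

Definition form_a_alpha (Gamma1 : set E) (alpha : R) (u v : E -> R) : R :=
  form_a u v + alpha * L2dot (surface n) Gamma1 u v.

End sobolev.

Section triangulation.
Context {R : realType} (n : nat).
Local Notation E := 'rV[R]_n.+1.

(* A simplex of R^(n+1) is the matrix whose n+2 rows are its vertices. *)
Local Notation simplex := 'M[R]_(n.+2, n.+1).

Definition nondegenerate (T : simplex) : bool :=
  row_free (row_mx T (const_mx 1 : 'cV_n.+2)).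

Definition face (T : simplex) (I : {set 'I_n.+2}) : set E :=
  [set x | exists w : 'rV[R]_n.+2,
    [/\ forall i, 0 <= w ord0 i, forall i, i \notin I -> w ord0 i = 0,
        \sum_i w ord0 i = 1 & x = w *m T]].

Definition hull (T : simplex) : set E := face T [set: 'I_n.+2].

Definition common_vertices (S T : simplex) : {set 'I_n.+2} :=
  [set i | [exists j, row j S == row i T]]%SET.

Definition polygonal (Omega : set E) := exists s : seq simplex,
  all nondegenerate s /\ Omega = (\bigcup_(T in [set` s]) hull T)°.

Definition bounded_polygonal_domain (Omega : set E) :=
  [/\ Omega !=set0, open Omega, connected Omega, bounded_set Omega
    & polygonal Omega].

Definition triangulation (Omega : set E) (tau : seq simplex) :=
  [/\ all nondegenerate tau,
      closure Omega = \bigcup_(T in [set` tau]) hull T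
    & forall S T, S \in tau -> T \in tau ->
        hull S `&` hull T = face T (common_vertices S T)].

Definition longest_side (T : simplex) : R :=
  \big[Num.max/0]_(i < n.+2) \big[Num.max/0]_(j < n.+2)
    edist (row i T) (row j T).

Definition mesh_size (tau : seq simplex) : R :=
  \big[Num.max/0]_(T <- tau) longest_side T.

Definition inscribed_diameter (T : simplex) : R :=
  sup [set 2 * r | r in [set r | exists c, [set x | edist x c <= r] `<=` hull T]].

(* The parameter h ranges over a set of mesh sizes accumulating at 0: no
   triangulation of a bounded domain has a mesh size larger than its diameter. *)
Definition regular_family (Omega : set E) (mesh : set R)
    (tau : R -> seq simplex) :=
  [/\ forall h, mesh h ->
        [/\ 0 < h, triangulation Omega (tau h) & mesh_size (tau h) = h],
      forall e, 0 < e -> exists2 h, mesh h & h < e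
    & exists2 sigma, 0 < sigma & forall h T, mesh h -> T \in tau h ->
        longest_side T <= sigma * inscribed_diameter T].

End triangulation.

Section discrete_problems.
Context {R : realType} (n : nat).
Local Notation E := 'rV[R]_n.+1.
Variables (Omega Gamma1 Gamma2 : set E) (tau : seq 'M[R]_(n.+2, n.+1)).
Local Notation leb := (lebesgue_rV n.+1).
Local Notation sigma := (surface n).

(* Vh, V0h and Kh constrain the functions on the closure of Omega only. *)
Definition Vh : set (E -> R) := [set v |
  {within closure Omega, continuous v} /\
  forall T, T \in tau -> exists (a : E) (c : R),
    forall x, hull T x -> v x = c + \sum_i a ord0 i * x ord0 i].

(* The trace on Gamma1 of a function continuous up to the boundary is its
   restriction, and it vanishes as an element of L^2(Gamma1). *)
Definition V0h : set (E -> R) := [set v |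
  Vh v /\ {ae sigma, forall x, Gamma1 x -> v x = 0}].

Definition Kh (b : R) : set (E -> R) := [set v | V0h (v \- cst b)].

Definition load (g q v : E -> R) : R :=
  L2dot leb Omega g v - L2dot sigma Gamma2 q v.

Definition state_h (b : R) (g q u : E -> R) :=
  Kh b u /\ forall v, V0h v -> form_a Omega u v = load g q v.

Definition adjoint_h (zd u p : E -> R) :=
  V0h p /\ forall v, V0h v ->
    form_a Omega p v = L2dot leb Omega (u \- zd) v.

Definition state_ha (b alpha : R) (g q u : E -> R) :=
  Vh u /\ forall v, Vh v -> form_a_alpha Omega Gamma1 alpha u v =
    load g q v + alpha * L2dot sigma Gamma1 (cst b) v.

Definition adjoint_ha (zd : E -> R) (alpha : R) (u p : E -> R) :=
  Vh p /\ forall v, Vh v -> form_a_alpha Omega Gamma1 alpha p v =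
    L2dot leb Omega (u \- zd) v.

Definition H : set (E -> R) := L2 leb Omega.

Definition Q : set (E -> R) := L2 sigma Gamma2.

Definition normHQ (g q : E -> R) : R :=
  Num.sqrt (L2norm leb Omega g ^+ 2 + L2norm sigma Gamma2 q ^+ 2).

(* u g q is the state associated with the control (g, q). *)
Definition cost (zd : E -> R) (M1 M2 : R) (u : (E -> R) -> (E -> R) -> E -> R)
    (g q : E -> R) : R :=
  2^-1 * L2norm leb Omega (u g q \- zd) ^+ 2 +
  M1 / 2 * L2norm leb Omega g ^+ 2 + M2 / 2 * L2norm sigma Gamma2 q ^+ 2.

Definition optimal_control (J : (E -> R) -> (E -> R) -> R) (g q : E -> R) :=
  [/\ H g, Q q & forall g' q', H g' -> Q q' -> J g q <= J g' q'].

End discrete_problems.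

(* Main.v *)
(* Let w = u_alpha - u be the difference between the penalized and the
   constrained states. It satisfies a(w, v) + alpha s(w, v) = r(v) for all v in
   V_h, where s is the scalar product of L^2(Gamma_1) and the residual r
   vanishes on the kernel V_0h of s. Since V_h has finite dimension, every v in
   V_h is within K sqrt(s(v, v)) of V_0h, so that |r(w)| <= C sqrt(s(w, w)) and
   w = O(alpha^(-1/2)); the same holds for the adjoint states. The cost
   functionals J_h and J_h,alpha thus differ by O(alpha^(-1/2)) on bounded sets
   of controls, and their strong convexity makes the optimal controls converge
   at the rate O(alpha^(-1/4)), without any optimality condition.

   The forms are well defined on V_h, and jointly definite, for the following
   reasons. A function of V_h is Lipschitz along the segments contained in the
   closure of Omega, so that its difference quotients are bounded and converge
   almost everywhere: it belongs to H^1 and its weak gradient is the piecewise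
   constant one, the only one by the lemma of du Bois-Reymond; it vanishes for
   constants only. The boundary of Omega lies in finitely many faces of simplices,
   hence has finite surface measure, and it is Borel, hence measurable for
   the metric outer measure of Hausdorff. *)

Require Import Defs.
From HB Require Import structures.
From mathcomp Require Import all_boot all_order all_algebra.
From mathcomp Require Import all_classical all_reals all_analysis measurable_realfun.
From mathcomp Require Import ring lra.

Set Implicit Arguments.
Unset Strict Implicit.
Unset Printing Implicit Defensive.
Import Order.TTheory GRing.Theory Num.Theory.
Import numFieldNormedType.Exports.

Local Open Scope classical_set_scope.
Local Open Scope ring_scope.

(** * Positive semidefinite forms *)

(** Functions are not identified when they agree almost everywhere, and their values off the closure
    of [Omega] are arbitrary. All forms are therefore only semidefinite, and only on the subset
    where the integrals converge; the states depend affinely on the controls only up to null vectors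
    of [dH]. Finite dimension is likewise expressed without a basis, by finitely many nodal values
    whose common zeros are null for every form.

    Optimality of the penalized control enters twice, each time as a comparison of costs: against
    the control 0, which bounds the penalized controls uniformly in alpha >= 1, and against the
    limit control, so that the limit cost at the two controls differs by at most the sum of |J -
    J_alpha| at these controls. Strong convexity turns this O(alpha^(-1/2)) into a bound on the
    squared distance, whence the exponent -1/4. The control gap then acts as a perturbation of the
    load, and the state gap as a perturbation of the right-hand side of the adjoint problem: the
    single estimate [penalized_dist] handles both. *)

Section forms.
Context {R : rcfType} {V : lmodType R}.
Implicit Types (P : set V) (f g : V -> V -> R) (u v w : V).

Definition linear_subspace P := P 0 /\ forall k u v, P u -> P v -> P (k *: u + v).

(** Relative to [P] because the integrals behind the forms are additive only where they converge. *)
Definition psd_form P f :=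
  [/\ forall u v, P u -> P v -> f u v = f v u,
      forall k u v w, P u -> P v -> P w -> f (k *: u + v) w = k * f u w + f v w
    & forall u, P u -> 0 <= f u u].

Definition seminorm f u := Num.sqrt (f u u).

Lemma subspaceZ P k u : linear_subspace P -> P u -> P (k *: u).
Proof. by move=> [P0 Pl] Pu; rewrite -[_ *: _]addr0; exact: Pl. Qed.

Lemma subspaceD P u v : linear_subspace P -> P u -> P v -> P (u + v).
Proof. by move=> [P0 Pl] Pu Pv; rewrite -[u]scale1r; exact: Pl. Qed.

Lemma subspaceB P u v : linear_subspace P -> P u -> P v -> P (u - v).
Proof. by move=> [P0 Pl] Pu Pv; rewrite addrC -scaleN1r; exact: Pl. Qed.

Lemma subspace_sum P (I : Type) (s : seq I) (F : I -> V) :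
  linear_subspace P -> (forall i, P (F i)) -> P (\sum_(i <- s) F i).
Proof.
move=> SP PF; elim/big_rec : _ => [|i x _ Px]; first by case: SP.
exact: subspaceD.
Qed.

Lemma midB u v w : 2^-1 *: ((u - w) + (v - w)) = 2^-1 *: (u + v) - w.
Proof.
rewrite addrACA -opprD scalerBr -mulr2n -(scaler_nat 2 w) scalerA.
by rewrite mulVf ?pnatr_eq0// scale1r.
Qed.

Section one_form.
Variables (P : set V) (f : V -> V -> R).
Hypotheses (SP : linear_subspace P) (Ff : psd_form P f).

Lemma formC u v : P u -> P v -> f u v = f v u.
Proof. by case: Ff => + _ _; exact. Qed.

Lemma form_lin k u v w : P u -> P v -> P w ->
  f (k *: u + v) w = k * f u w + f v w.
Proof. by case: Ff => _ + _; exact. Qed.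

Lemma form_ge0 u : P u -> 0 <= f u u.
Proof. by case: Ff => _ _ ; exact. Qed.

Lemma form0l w : P w -> f 0 w = 0.
Proof.
move=> Pw; have P0 := SP.1.
have := form_lin 0 P0 P0 Pw; rewrite scale0r addr0 mul0r add0r.
by have := form_lin 1 P0 P0 Pw; rewrite scaler0 addr0 mul1r; lra.
Qed.

Lemma formDl u v w : P u -> P v -> P w -> f (u + v) w = f u w + f v w.
Proof. by move=> Pu Pv Pw; rewrite -{1}[u]scale1r form_lin// mul1r. Qed.

Lemma formBl u v w : P u -> P v -> P w -> f (u - v) w = f u w - f v w.
Proof.
by move=> Pu Pv Pw; rewrite addrC -scaleN1r form_lin// mulN1r addrC.
Qed.

Lemma formZl k u w : P u -> P w -> f (k *: u) w = k * f u w.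
Proof.
move=> Pu Pw; rewrite -[_ *: _]addr0 form_lin//; last exact: SP.1.
by rewrite form0l// addr0.
Qed.

Lemma formDr u v w : P u -> P v -> P w -> f w (u + v) = f w u + f w v.
Proof.
by move=> Pu Pv Pw; rewrite formC ?formDl ?(formC Pw)//; exact: subspaceD.
Qed.

Lemma formBr u v w : P u -> P v -> P w -> f w (u - v) = f w u - f w v.
Proof.
by move=> Pu Pv Pw; rewrite formC ?formBl ?(formC Pw)//; exact: subspaceB.
Qed.

Lemma formZr k u w : P u -> P w -> f w (k *: u) = k * f w u.
Proof.
by move=> Pu Pw; rewrite formC ?formZl ?(formC Pw)//; exact: subspaceZ.
Qed.

Lemma form_suml (I : Type) (s : seq I) (F : I -> V) w :
  (forall i, P (F i)) -> P w -> f (\sum_(i <- s) F i) w = \sum_(i <- s) f (F i) w.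
Proof.
move=> PF Pw; elim: s => [|i s IH]; first by rewrite !big_nil form0l.
by rewrite !big_cons formDl ?IH//; exact: subspace_sum.
Qed.

(** The polynomial in [k] of the claim [H] is the value of the form at [k *: u + v]. For a null [u]
    it degenerates to an affine function, which is bounded below only if its slope is 0. *)
Lemma form_CS u v : P u -> P v -> (f u v) ^+ 2 <= f u u * f v v.
Proof.
move=> Pu Pv.
have H k : 0 <= k ^+ 2 * f u u + k * f u v *+ 2 + f v v.
  have Pku := subspaceZ k SP Pu.
  have := form_ge0 (subspaceD SP Pku Pv).
  rewrite formDl// ?formDr// ?(formC Pv Pku) ?formZl// ?formZr//; last exact: subspaceD.
  by move=> h; apply: le_trans h _; rewrite le_eqVlt; apply/orP; left; apply/eqP; ring.
have u0 := form_ge0 Pu; have v0 := form_ge0 Pv.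
have [uu|uu] := eqVneq (f u u) 0.
  have [->|uv] := eqVneq (f u v) 0; first by rewrite expr0n/= mulr_ge0.
  (* This [k] would make the affine function equal to -1. *)
  have := H (- (f v v + 1) / f u v / 2); rewrite uu mulr0 add0r.
  rewrite (_ : _ / 2 * f u v *+ 2 = - (f v v + 1)); last by field.
  lra.
have up : 0 < f u u by rewrite lt_neqAle eq_sym uu.
(* The minimizer of the polynomial. *)
have := H (- f u v / f u u).
rewrite (_ : _ + _ = (f u u * f v v - f u v ^+ 2) / f u u); last by field.
by rewrite pmulr_lge0 ?invr_gt0// subr_ge0.
Qed.

Lemma seminorm_ge0 u : 0 <= seminorm f u. Proof. exact: sqrtr_ge0. Qed.

Lemma sqr_seminorm u : P u -> seminorm f u ^+ 2 = f u u.
Proof. by move=> Pu; rewrite sqr_sqrtr// form_ge0. Qed.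

Lemma ler_form u v : P u -> P v -> `|f u v| <= seminorm f u * seminorm f v.
Proof.
move=> Pu Pv; rewrite -ler_sqr ?nnegrE ?mulr_ge0 ?seminorm_ge0//.
by rewrite real_normK ?num_real// exprMn !sqr_seminorm// form_CS.
Qed.

Lemma ler_seminormD u v : P u -> P v ->
  seminorm f (u + v) <= seminorm f u + seminorm f v.
Proof.
move=> Pu Pv; rewrite -ler_sqr ?nnegrE ?addr_ge0 ?seminorm_ge0//.
rewrite sqr_seminorm; last exact: subspaceD.
rewrite formDl ?formDr//; last exact: subspaceD.
rewrite -!sqr_seminorm// (formC Pv Pu).
have := ler_norm (f u v); have := ler_form Pu Pv; lra.
Qed.

Lemma seminormZ k u : P u -> seminorm f (k *: u) = `|k| * seminorm f u.
Proof.
move=> Pu; rewrite /seminorm formZl ?formZr//; last exact: subspaceZ.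
by rewrite mulrA -expr2 sqrtrM ?sqr_ge0// sqrtr_sqr.
Qed.

Lemma seminormB u v : P u -> P v -> seminorm f (u - v) = seminorm f (v - u).
Proof.
move=> Pu Pv; rewrite -[u - v]opprB -[- (v - u)]scaleN1r seminormZ ?normrN1 ?mul1r//.
exact: subspaceB.
Qed.

Lemma ler_seminormB u v : P u -> P v ->
  seminorm f (u - v) <= seminorm f u + seminorm f v.
Proof.
move=> Pu Pv; rewrite -[- v]scaleN1r (le_trans (ler_seminormD _ _))//.
  exact: subspaceZ.
by rewrite seminormZ// normrN1 mul1r.
Qed.

Lemma ler_seminorm_sum (I : Type) (s : seq I) (F : I -> V) :
  (forall i, P (F i)) ->
  seminorm f (\sum_(i <- s) F i) <= \sum_(i <- s) seminorm f (F i).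
Proof.
move=> PF; elim: s => [|i s IH].
  by rewrite !big_nil /seminorm form0l ?sqrtr0//; exact: SP.1.
rewrite !big_cons (le_trans (ler_seminormD _ _))//; first exact: subspace_sum.
by rewrite lerD2l.
Qed.

(** By Cauchy-Schwarz, null vectors can be added or dropped inside the form; this replaces a passage
    to the quotient. *)
Lemma formD_ker u v : P u -> P v -> f v v = 0 -> f u v = 0.
Proof.
move=> Pu Pv vv; have := form_CS Pu Pv; rewrite vv mulr0 => h.
by apply/eqP; rewrite -sqrf_eq0 eq_le h sqr_ge0.
Qed.

(** The parallelogram identity; its last term is the source of strong convexity. *)
Lemma form_mid u v : P u -> P v ->
  f (2^-1 *: (u + v)) (2^-1 *: (u + v)) =
  2^-1 * f u u + 2^-1 * f v v - 4^-1 * f (u - v) (u - v).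
Proof.
move=> Pu Pv; have PD := subspaceD SP Pu Pv; have PB := subspaceB SP Pu Pv.
have PZ := subspaceZ 2^-1 SP PD.
rewrite formZl// formZr// (formDl Pu Pv PD) (formDr Pu Pv Pu) (formDr Pu Pv Pv).
rewrite (formBl Pu Pv PB) (formBr Pu Pv Pu) (formBr Pu Pv Pv) (formC Pv Pu).
by field.
Qed.

Lemma ker_subspace : linear_subspace [set v | P v /\ f v v = 0].
Proof.
split; first by split; [exact: SP.1|rewrite form0l//; exact: SP.1].
move=> k u v [Pu u0] [Pv v0]; have Pw := SP.2 k _ _ Pu Pv; split => //.
have ker x : P x -> f x x = 0 -> f x (k *: u + v) = 0.
  by move=> Px x0; rewrite formC// formD_ker.
by rewrite form_lin// !ker// mulr0 addr0.
Qed.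

End one_form.

(* The functionals l, which detect the kernel of f, make P finite-dimensional
   modulo that kernel; e is an orthonormal basis modulo that kernel, completed
   by null vectors. *)
Lemma gram_schmidt (k : nat) (l : 'I_k -> V -> R) P f :
  linear_subspace P -> psd_form P f ->
  (forall i c u v, P u -> P v -> l i (c *: u + v) = c * l i u + l i v) ->
  (forall v, P v -> (forall i, l i v = 0) -> f v v = 0) ->
  exists m, exists2 e : 'I_m -> V, (forall i, P (e i) /\ f (e i) (e i) <= 1) &
    forall v, P v -> let d := v - \sum_i f v (e i) *: e i in f d d = 0.
Proof.
elim: k => [|k IH] in P l * => SP Ff l_lin l_ker.
  exists 0%N, (fun=> 0); first by case.
  by move=> v Pv /=; rewrite big_ord0 subr0; apply: l_ker => // -[].
(* The induction runs on the kernel of the first functional, where the other [k] functionals detect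
   the null vectors. *)
pose P' := [set v | P v /\ l ord0 v = 0].
have sP' v : P' v -> P v by case.
have SP' : linear_subspace P'.
  split.
    split; first exact: SP.1.
    have := l_lin ord0 1 0 0 SP.1 SP.1; rewrite scaler0 addr0 mul1r; lra.
  move=> c u v [Pu u0] [Pv v0]; split; first exact: SP.2.
  by rewrite l_lin// u0 v0 mulr0 addr0.
have Ff' : psd_form P' f.
  case: Ff => ? flin ?; split => [u v /sP' ? /sP' ?|c u v w /sP' ? /sP' ? /sP' ?|u /sP' ?]; auto.
have [m [e Pe eK]] : exists m, exists2 e : 'I_m -> V,
    (forall i, P' (e i) /\ f (e i) (e i) <= 1) &
    forall v, P' v -> let d := v - \sum_i f v (e i) *: e i in f d d = 0.
  apply: (IH _ (fun i => l (lift ord0 i))) => //.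
    by move=> i c u v /sP' ? /sP' ?; rewrite l_lin.
  move=> v [Pv v0] lv; apply: l_ker => // i.
  by case: (unliftP ord0 i) => [j|] ->.
(* Either [l ord0] vanishes on [P], so that [P'] is all of it, or [v1] provides one more
   direction. *)
have [[v1 [Pv1 lv1]]|nov] := pselect (exists v, P v /\ l ord0 v = 1); last first.
  have PP' v : P v -> P' v.
    move=> Pv; split => //; apply: contrapT => /eqP lv; apply: nov.
    exists ((l ord0 v)^-1 *: v); split; first exact: subspaceZ.
    have := l_lin ord0 (l ord0 v)^-1 v 0 Pv SP.1.
    rewrite addr0 mulVf// => ->; rewrite -[RHS]addr0; congr (_ + _).
    by have := l_lin ord0 1 0 0 SP.1 SP.1; rewrite scaler0 addr0 mul1r; lra.
  exists m, e; first by move=> i; have [/sP' ? ?] := Pe i.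
  by move=> v /PP'; exact: eK.
have Pei i : P (e i) by have [/sP'] := Pe i.
pose S v := \sum_i f v (e i) *: e i.
have PS v : P (S v) by apply: subspace_sum => // i; exact: subspaceZ.
pose d := v1 - S v1.
have Pd : P d by exact: subspaceB.
have fS v w : P w -> f (S v) w = \sum_i f v (e i) * f (e i) w.
  move=> Pw; rewrite (form_suml SP Ff)//; last by move=> i; exact: subspaceZ.
  by apply: eq_bigr => i _; rewrite (formZl SP Ff).
(* [d] is orthogonal to [P']: the null vector [v - S v] is orthogonal to [v1], and [f v1 (S v)]
   equals [f v (S v1)]. *)
have f'd v : P' v -> f v d = 0.
  move=> P'v; have Pv := sP' _ P'v.
  have := @formD_ker _ _ SP Ff v1 _ Pv1 (subspaceB SP Pv (PS v)) (eK _ P'v).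
  rewrite (formBr SP Ff)// (formC Ff Pv1 (PS v)) fS// => e1.
  rewrite (formBr SP Ff)// (formC Ff Pv (PS v1)) fS// (formC Ff Pv Pv1).
  rewrite -[RHS]e1; congr (_ - _); apply: eq_bigr => i _.
  by rewrite (formC Ff (Pei i))// (formC Ff (Pei i))// mulrC.
have fv1d : f v1 d = f d d.
  rewrite [in RHS]/d (formBl Ff)// fS// big1 ?subr0// => i _.
  by rewrite f'd ?mulr0//; case: (Pe i).
(* If [d] is null, the convention [0^-1 = 0] makes [e0] the zero vector. *)
pose e0 := (seminorm f d)^-1 *: d.
have Pe0 : P e0 by exact: subspaceZ.
exists m.+1, (fun i => if unlift ord0 i is Some j then e j else e0).
  move=> i; case: unliftP => [j|] _; first by have [/sP'] := Pe j.
  split=> //; rewrite (formZl SP Ff)// (formZr SP Ff)// mulrA -expr2 exprVn.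
  rewrite (sqr_seminorm Ff)//; have [->|dd] := eqVneq (f d d) 0.
    by rewrite mulr0.
  by rewrite mulVf.
move=> v Pv /=; rewrite big_ord_recl unlift_none.
under eq_bigr do rewrite liftK.
rewrite -/(S v).
pose v' := v - l ord0 v *: v1.
have P'v' : P' v'.
  split; first by apply: subspaceB => //; exact: subspaceZ.
  by rewrite /v' addrC -scaleNr l_lin// lv1 mulr1 addNr.
have ev : v = l ord0 v *: v1 + v' by rewrite addrC subrK.
have Sv : S v = l ord0 v *: S v1 + S v'.
  rewrite /S scaler_sumr -big_split/=; apply: eq_bigr => i _.
  by rewrite {1}ev (form_lin Ff)// ?scalerDl ?scalerA//; exact: sP'.
have fve0 : f v e0 = l ord0 v * ((seminorm f d)^-1 * f d d).
  rewrite (formZr SP Ff)// [X in f X d]ev (form_lin Ff)//; last exact: sP'.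
  by rewrite fv1d (f'd v')// addr0 mulrCA.
rewrite fve0 /e0 scalerA -mulrA [_ / _]mulrAC -expr2 exprVn (sqr_seminorm Ff)//.
set c := _ *: d; set z := v' - S v'.
have Pz : P z by apply: subspaceB => //; exact: sP'.
have zz : f z z = 0 by exact: eK.
(* The remainder of [v] is the null remainder [z] of [v'] plus a multiple of [d], whose coefficient
   is 0 unless [d] itself is null. *)
have -> : v - (c + S v) = (l ord0 v *: d - c) + z.
  have rearr (x1 x2 x3 x4 x5 : V) :
      x1 + x4 - (x3 + (x2 + x5)) = x1 - x2 - x3 + (x4 - x5).
    rewrite -[x1 - x2 - x3]addrA -opprD [RHS]addrACA -opprD; congr (_ - _).
    by rewrite addrA [x2 + x3]addrC.
  by rewrite /z Sv [X in X - _]ev /d scalerBr rearr.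
have Pc : P c by exact: subspaceZ.
have Plc : P (l ord0 v *: d - c) by apply: subspaceB => //; exact: subspaceZ.
rewrite (formDl Ff) ?(formDr SP Ff Plc Pz)//; last exact: subspaceD.
rewrite zz (formC Ff Pz Plc) (formD_ker SP Ff Plc Pz zz) !addr0.
rewrite /c -scalerBl (formZl SP Ff) ?(formZr SP Ff)//; last exact: subspaceZ.
have [->|dd] := eqVneq (f d d) 0; first by rewrite !mulr0.
by rewrite mulVf// mulr1 subrr mul0r.
Qed.

(** Comparability of seminorms in finite dimension, modulo a kernel. [v0] is what remains of [v]
    after its Gram-Schmidt expansion; each coefficient of the latter is at most [seminorm f v], so
    [K] is the sum of the [g]-seminorms of the basis. *)
Lemma seminorm_ker_dist (k : nat) (l : 'I_k -> V -> R) P f g :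
  linear_subspace P -> psd_form P f -> psd_form P g ->
  (forall i c u v, P u -> P v -> l i (c *: u + v) = c * l i u + l i v) ->
  (forall v, P v -> (forall i, l i v = 0) -> f v v = 0) ->
  exists2 K, 0 <= K & forall v, P v -> exists2 v0, P v0 & f v0 v0 = 0 /\
    seminorm g (v - v0) <= K * seminorm f v.
Proof.
move=> SP Ff Fg l_lin l_ker.
have [m [e Pe eK]] := gram_schmidt SP Ff l_lin l_ker.
exists (\sum_i seminorm g (e i)); first by apply: sumr_ge0 => i _; exact: seminorm_ge0.
move=> v Pv; have Pei i : P (e i) by have [] := Pe i.
have PS : P (\sum_i f v (e i) *: e i).
  by apply: subspace_sum => // i; exact: subspaceZ.
exists (v - \sum_i f v (e i) *: e i); first exact: subspaceB.
split; first exact: eK.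
rewrite opprB addrC subrK (le_trans (ler_seminorm_sum SP Fg _ _))//.
  by move=> i; exact: subspaceZ.
rewrite mulr_suml; apply: ler_sum => i _.
rewrite (seminormZ SP Fg)// mulrC ler_wpM2l ?seminorm_ge0//.
rewrite (le_trans (ler_form SP Ff _ _))//.
rewrite ler_piMr ?seminorm_ge0// -[leRHS]sqrtr1.
by rewrite ler_wsqrtr//; have [] := Pe i.
Qed.

End forms.

Lemma psd_formD {R : rcfType} {V : lmodType R} (P : set V) (f g : V -> V -> R) :
  psd_form P f -> psd_form P g -> psd_form P (fun u v => f u v + g u v).
Proof.
move=> [fC fl f0] [gC gl g0]; split => [u v Pu Pv|k u v w Pu Pv Pw|u Pu].
- by rewrite fC// gC.
- by rewrite fl// gl//; ring.
- by rewrite addr_ge0 ?f0 ?g0.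
Qed.

Lemma sub_psd_form {R : rcfType} {V : lmodType R} (P Q : set V) (f : V -> V -> R) :
  P `<=` Q -> psd_form Q f -> psd_form P f.
Proof.
move=> PQ [fC fl f0]; split=> [u v /PQ ? /PQ ?|k u v w /PQ ? /PQ ? /PQ ?|u /PQ ?];
  [exact: fC|exact: fl|exact: f0].
Qed.

(** * Penalization of a constrained optimal control problem *)

Section penalization.
Context {R : rcfType} {V : lmodType R}.
Variables (Hs Qs W : set V) (dH dQ s a : V -> V -> R).
Hypotheses (SH : linear_subspace Hs) (SQ : linear_subspace Qs) (SW : linear_subspace W).
Hypotheses (FH : psd_form Hs dH) (FQ : psd_form Qs dQ).
Hypotheses (Fs : psd_form W s) (Fa : psd_form W a).
Hypotheses (WH : W `<=` Hs) (WQ : W `<=` Qs).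
Variables (k : nat) (l : 'I_k -> V -> R).
Hypothesis l_lin : forall i c u v, W u -> W v ->
  l i (c *: u + v) = c * l i u + l i v.
Hypothesis l_ker : forall v, W v -> (forall i, l i v = 0) ->
  [/\ dH v v = 0, dQ v v = 0, a v v = 0 & s v v = 0].
Hypothesis as_ker : forall v, W v -> a v v = 0 -> s v v = 0 ->
  dH v v = 0 /\ dQ v v = 0.

(** The sum of all the forms in play, so that the one seminorm [M] measures states, adjoint states
    and test functions in every estimate. *)
Let dM u v := (dH u v + a u v) + (s u v + dQ u v).
Let M := seminorm dM.

Let FHW : psd_form W dH. Proof. exact: sub_psd_form FH. Qed.
Let FQW : psd_form W dQ. Proof. exact: sub_psd_form FQ. Qed.
Let FM : psd_form W dM.
Proof. by apply: psd_formD; apply: psd_formD. Qed.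
Let Fas : psd_form W (fun u v => a u v + s u v).
Proof. exact: psd_formD. Qed.

Let M_ge0 v : 0 <= M v. Proof. exact: seminorm_ge0. Qed.

Let le_M v : W v -> [/\ seminorm dH v <= M v, seminorm a v <= M v,
  seminorm dQ v <= M v & seminorm (fun u v => dH u v + a u v) v <= M v].
Proof.
move=> Wv; have := form_ge0 FHW Wv; have := form_ge0 FQW Wv.
have := form_ge0 Fs Wv; have := form_ge0 Fa Wv => ? ? ? ?.
by split; apply: ler_wsqrtr; rewrite /dM; lra.
Qed.

(** A discrete Friedrichs inequality. By [as_ker], a null vector of [a + s] is null for [dM] as
    well, so the remainder left by [seminorm_ker_dist] drops out. *)
Let coercive : exists2 C, 0 <= C & forall v, W v ->
  M v ^+ 2 <= C * (a v v + s v v).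
Proof.
have [|K K0 KP] := seminorm_ker_dist SW Fas FM l_lin.
  by move=> v Wv lv; have [_ _ -> ->] := l_ker Wv lv; rewrite addr0.
exists (K ^+ 2); first exact: sqr_ge0.
move=> v Wv; have [v0 Wv0 [asv0 Kv]] := KP _ Wv.
have Wd := subspaceB SW Wv Wv0.
rewrite -(sqr_seminorm Fas Wv) -exprMn ler_sqr ?nnegrE ?mulr_ge0//; last first.
  exact: seminorm_ge0.
rewrite -[v in M v](subrK v0) (le_trans (ler_seminormD SW FM _ _))//.
rewrite -[leRHS]addr0 lerD// /seminorm.
have := form_ge0 Fs Wv0; have := form_ge0 Fa Wv0 => a0 s0.
have av0 : a v0 v0 = 0 by lra.
have sv0 : s v0 v0 = 0 by lra.
have [Hv0 Qv0] := as_ker Wv0 av0 sv0.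
by rewrite /dM av0 sv0 Hv0 Qv0 !addr0 sqrtr0.
Qed.

(** The vector [v0] is an admissible test function of the constrained problem, as near to [v] as the
    penalized seminorm of [v] is small. *)
Let dist_ker : exists2 K, 0 <= K & forall v, W v -> exists2 v0, W v0 &
  s v0 v0 = 0 /\ M (v - v0) <= K * seminorm s v.
Proof.
apply: (seminorm_ker_dist SW Fs FM l_lin) => v Wv lv.
by have [] := l_ker Wv lv.
Qed.

Definition constrained_state (b : V) (ell : V -> R) (u : V) :=
  [/\ W u, s (u - b) (u - b) = 0 &
    forall v, W v -> s v v = 0 -> a u v = ell v].

Definition penalized_state (b : V) (al : R) (ell : V -> R) (u : V) :=
  W u /\ forall v, W v -> a u v + al * s u v = ell v + al * s b v.

(** [u - b] is null for [s], hence an admissible test function, and for it [coercive] bounds [M] by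
    the energy alone. *)
Let apriori : exists2 C, 0 <= C & forall b ell u L, W b -> 0 <= L ->
  (forall v, W v -> `|ell v| <= L * M v) ->
  constrained_state b ell u -> M u <= C * (L + M b).
Proof.
have [C C0 CP] := coercive.
exists (C + 1); first lra.
move=> b ell u L Wb L0 bell [Wu sub aub].
have Wd := subspaceB SW Wu Wb.
have [_ ab _ _] := le_M Wb; have [_ ad _ _] := le_M Wd.
have Hd := CP _ Wd; rewrite sub addr0 (formBl Fa)// aub// in Hd.
have h1 := le_trans (ler_norm _) (bell _ Wd).
have h2 : `|a b (u - b)| <= M b * M (u - b).
  by rewrite (le_trans (ler_form SW Fa _ _))// ler_pM ?seminorm_ge0.
have h3 : M (u - b) ^+ 2 <= C * (L + M b) * M (u - b).
  apply: le_trans Hd _; rewrite -mulrA ler_wpM2l//.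
  have := ler_norm (- a b (u - b)); rewrite normrN; lra.
have {h3} h4 : M (u - b) <= C * (L + M b).
  have [->|d0] := eqVneq (M (u - b)) 0; first by rewrite mulr_ge0// addr_ge0.
  by rewrite -(@ler_pM2r _ (M (u - b))) -?expr2// lt_neqAle eq_sym d0/=.
have := ler_seminormD SW FM Wd Wb; rewrite subrK -/M => h5.
by rewrite mulrDl mul1r; lra.
Qed.

(** The two problems may have different loads, at distance [e]. The same estimate thus serves equal
    controls ([e = 0]), the two optimal controls, and the adjoint problems, whose right-hand sides
    contain the states. *)
Let penalized_dist : exists2 C, 0 <= C & forall b al ell ell' u u' L e,
  W b -> 1 <= al -> 0 <= L -> 0 <= e ->
  (forall u v, W u -> W v -> ell (u + v) = ell u + ell v) ->
  (forall v, W v -> `|ell v| <= L * M v) ->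
  (forall v, W v -> `|ell' v - ell v| <= e * M v) ->
  constrained_state b ell u -> penalized_state b al ell' u' ->
  M (u' - u) <= C * ((L + M b) / Num.sqrt al + e).
Proof.
have [C C0 CP] := coercive.
have [K K0 KP] := dist_ker.
have [C1 C10 C1P] := apriori.
pose A := 2 * C * K ^+ 2 * (1 + C1) ^+ 2.
exists (Num.sqrt (A + 4 * C ^+ 2)); first exact: sqrtr_ge0.
move=> b al ell ell' u u' L e Wb al1 L0 e0 ellD bell bell' Su [Wu' Su'].
have Mu := C1P _ _ _ _ Wb L0 bell Su.
case: Su => Wu sub Su.
have al0 : 0 < al by lra.
have Wd := subspaceB SW Wu Wb.
set w := u' - u; have Ww : W w by exact: subspaceB.
have [w0 Ww0 [sw0 Kw]] := KP _ Ww.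
have Wz := subspaceB SW Ww Ww0.
(* [u - b] is a null vector of [s], so the penalty can be centred at [u] instead of [b]. *)
have sb v : W v -> s b v = s u v.
  move=> Wv; apply/eqP; rewrite eq_sym -subr_eq0 -(formBl Fs)// (formC Fs)//.
  by rewrite (formD_ker SW Fs).
set sg := seminorm s w in Kw; have sg0 : 0 <= sg by exact: seminorm_ge0.
have sgE : sg ^+ 2 = s w w by exact: (sqr_seminorm Fs).
(* Since [w0] tests the constrained problem, the residual of [u] acts on [w - w0] only, which [sg]
   controls. *)
have eqw : a w w + al * sg ^+ 2 = (ell' w - ell w) + (ell (w - w0) - a u (w - w0)).
  have := Su' _ Ww; rewrite sb//.
  have -> : ell w = ell (w - w0) + ell w0 by rewrite -ellD// subrK.
  rewrite -(Su w0)// (formBr SW Fa)// sgE {1 3}/w (formBl Fa)// (formBl Fs)//.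
  lra.
set B := K * (L + M u).
have hB : a w w + al * sg ^+ 2 <= e * M w + B * sg.
  rewrite eqw; have h1 := le_trans (ler_norm _) (bell' _ Ww).
  have h2 := le_trans (ler_norm _) (bell _ Wz).
  have [_ az _ _] := le_M Wz; have [_ au _ _] := le_M Wu.
  have h3 : `|a u (w - w0)| <= M u * M (w - w0).
    by rewrite (le_trans (ler_form SW Fa _ _))// ler_pM ?seminorm_ge0.
  have h4 := ler_norm (- a u (w - w0)); rewrite normrN in h4.
  have h5 : (L + M u) * M (w - w0) <= B * sg.
    by rewrite /B [K * _]mulrC -mulrA ler_wpM2l// addr_ge0.
  lra.
(* Young's inequality: half of the penalty absorbs [B * sg] at the price of [B ^+ 2 / al]. *)
have B2 : B * sg <= al * sg ^+ 2 / 2 + B ^+ 2 / al / 2.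
  rewrite -subr_ge0.
  have -> : al * sg ^+ 2 / 2 + B ^+ 2 / al / 2 - B * sg = (al * sg - B) ^+ 2 / al / 2.
    by field; rewrite gt_eqF.
  by rewrite !divr_ge0 ?sqr_ge0// ltW.
(* After doubling, the half of the penalty that is left dominates [s w w], because [1 <= al]. *)
have h6 : M w ^+ 2 <= C * (B ^+ 2 / al + 2 * (e * M w)).
  apply: le_trans (CP _ Ww) _; rewrite ler_wpM2l// -sgE.
  have := form_ge0 Fa Ww.
  have : 0 <= (al - 1) * sg ^+ 2 by rewrite mulr_ge0 ?sqr_ge0// subr_ge0.
  lra.
(* The term linear in [M w] is absorbed into half of the left-hand side. *)
have h7 : M w ^+ 2 <= 2 * C * (B ^+ 2 / al) + 4 * C ^+ 2 * e ^+ 2.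
  have := sqr_ge0 (M w - 2 * C * e); lra.
have B0 : 0 <= B by rewrite mulr_ge0// addr_ge0.
have LMb0 : 0 <= L + M b by rewrite addr_ge0.
have h8 : B <= K * (1 + C1) * (L + M b).
  rewrite /B -mulrA ler_wpM2l//; have := M_ge0 b; lra.
have h9 : B ^+ 2 <= K ^+ 2 * (1 + C1) ^+ 2 * (L + M b) ^+ 2.
  by rewrite -!exprMn ler_sqr ?nnegrE// mulr_ge0// mulr_ge0//; lra.
have sal : 0 < Num.sqrt al by rewrite sqrtr_gt0.
set t := (L + M b) / Num.sqrt al.
have t0 : 0 <= t by rewrite divr_ge0// ltW.
have t2 : t ^+ 2 = (L + M b) ^+ 2 / al by rewrite expr_div_n sqr_sqrtr// ltW.
have h10 : 2 * C * (B ^+ 2 / al) <= A * t ^+ 2.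
  have ial0 : 0 <= al^-1 by rewrite invr_ge0 ltW.
  have C20 : 0 <= 2 * C by rewrite mulr_ge0.
  by have := ler_wpM2l C20 (ler_wpM2r ial0 h9); rewrite t2 /A; lra.
have A0 : 0 <= A.
  by rewrite /A mulr_ge0 ?sqr_ge0// mulr_ge0 ?sqr_ge0// mulr_ge0.
have D0 : 0 <= 4 * C ^+ 2 by rewrite mulr_ge0 ?sqr_ge0.
rewrite -ler_sqr ?nnegrE ?mulr_ge0 ?sqrtr_ge0 ?addr_ge0//.
rewrite exprMn (sqr_sqrtr (addr_ge0 A0 D0)).
apply: le_trans h7 _.
have : 0 <= (A + 4 * C ^+ 2) * (t * e).
  by rewrite mulr_ge0 ?addr_ge0// mulr_ge0.
have : 0 <= A * e ^+ 2 by rewrite mulr_ge0 ?sqr_ge0.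
have : 0 <= 4 * C ^+ 2 * t ^+ 2 by rewrite mulr_ge0 ?sqr_ge0.
lra.
Qed.

Variables (b zd : V) (M1 M2 : R).
Hypotheses (Wb : W b) (Hzd : Hs zd) (M1_gt0 : 0 < M1) (M2_gt0 : 0 < M2).

Definition control_load (g q v : V) := dH g v - dQ q v.

Definition control_cost (S : V -> V -> V) (g q : V) :=
  2^-1 * dH (S g q - zd) (S g q - zd) + M1 / 2 * dH g g + M2 / 2 * dQ q q.

Definition control_optimal (S : V -> V -> V) (g q : V) :=
  [/\ Hs g, Qs q & forall g' q', Hs g' -> Qs q' ->
    control_cost S g q <= control_cost S g' q'].

(** The minimizer is compared with the midpoint of the two controls, where the parallelogram
    identity gains [M1 / 8] and [M2 / 8] times the squared gaps. Affinity of [S] at midpoints is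
    asked modulo null vectors of [dH], since [S] returns arbitrary representatives. *)
Let strong_convexity (S : V -> V -> V) g q g' q' :
  (forall g q, Hs g -> Qs q -> Hs (S g q)) ->
  (forall g q g' q', Hs g -> Qs q -> Hs g' -> Qs q' ->
    let d := S (2^-1 *: (g + g')) (2^-1 *: (q + q')) -
             2^-1 *: (S g q + S g' q') in dH d d = 0) ->
  control_optimal S g q -> Hs g' -> Qs q' ->
  M1 / 4 * dH (g - g') (g - g') + M2 / 4 * dQ (q - q') (q - q') <=
  control_cost S g' q' - control_cost S g q.
Proof.
move=> SS Smid [Hg Qq opt] Hg' Qq'.
have Hm := subspaceZ 2^-1 SH (subspaceD SH Hg Hg').
have Qm := subspaceZ 2^-1 SQ (subspaceD SQ Qq Qq').
have := opt _ _ Hm Qm; rewrite /control_cost.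
set A := S g q - zd; set B := S g' q' - zd.
have HA : Hs A by apply: subspaceB => //; exact: SS.
have HB : Hs B by apply: subspaceB => //; exact: SS.
have HAB := subspaceZ 2^-1 SH (subspaceD SH HA HB).
have := Smid _ _ _ _ Hg Qq Hg' Qq' => /=.
set m := S _ _; set d := _ - _ => dd.
have Hd : Hs d.
  apply: subspaceB; [by []|exact: SS|apply: subspaceZ => //].
  by apply: subspaceD => //; exact: SS.
(* The null vector [d] contributes neither its square nor its cross terms. *)
have -> : m - zd = 2^-1 *: (A + B) + d.
  by rewrite midB /d addrAC [_ + (m - _)]addrC subrK.
rewrite (formDl FH HAB Hd (subspaceD SH HAB Hd)) (formDr SH FH HAB Hd HAB).
rewrite (formDr SH FH HAB Hd Hd) (formC FH Hd HAB) (formD_ker SH FH HAB Hd dd) dd.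
rewrite (form_mid SH FH)// (form_mid SH FH)// (form_mid SQ FQ)//.
have := form_ge0 FH (subspaceB SH HA HB).
lra.
Qed.

Let load_le g q v : Hs g -> Qs q -> W v ->
  `|control_load g q v| <= (seminorm dH g + seminorm dQ q) * M v.
Proof.
move=> Hg Qq Wv; have [h1 _ h2 _] := le_M Wv.
rewrite /control_load (le_trans (ler_normB _ _))// mulrDl lerD//.
  rewrite (le_trans (ler_form SH FH Hg (WH Wv)))// ler_wpM2l// seminorm_ge0//.
rewrite (le_trans (ler_form SQ FQ Qq (WQ Wv)))// ler_wpM2l// seminorm_ge0//.
Qed.

(** The defect [d] solves the homogeneous constrained problem: it is null for [s], hence a test
    function, then null for [a], and [as_ker] applies. *)
Let state_mid (u : V -> V -> V) g q g' q' :
  (forall g q, Hs g -> Qs q -> constrained_state b (control_load g q) (u g q)) ->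
  Hs g -> Qs q -> Hs g' -> Qs q' ->
  let d := u (2^-1 *: (g + g')) (2^-1 *: (q + q')) - 2^-1 *: (u g q + u g' q') in
  dH d d = 0.
Proof.
move=> Hu Hg Qq Hg' Qq' d.
have Hm := subspaceZ 2^-1 SH (subspaceD SH Hg Hg').
have Qm := subspaceZ 2^-1 SQ (subspaceD SQ Qq Qq').
have [Wu su au] := Hu _ _ Hg Qq; have [Wu' su' au'] := Hu _ _ Hg' Qq'.
have [Wm sm am] := Hu _ _ Hm Qm.
have WD := subspaceD SW Wu Wu'; have WZ := subspaceZ 2^-1 SW WD.
have Wd : W d by exact: subspaceB.
have KS := ker_subspace SW Fs.
have sd : s d d = 0.
  have dE : d = (u (2^-1 *: (g + g')) (2^-1 *: (q + q')) - b) -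
      2^-1 *: ((u g q - b) + (u g' q' - b)).
    by rewrite midB opprB addrA subrK.
  rewrite dE; apply: (subspaceB KS _ _).2; first by split => //; exact: subspaceB.
  by apply: (subspaceZ _ KS); apply: (subspaceD KS); split => //; exact: subspaceB.
have ad : a d d = 0.
  rewrite {1}/d (formBl Fa)// (formZl SW Fa)// (formDl Fa)// am// au// au'//.
  rewrite /control_load (formZl SH FH) ?(formZl SQ FQ)//; last first.
  - exact: WH.
  - exact: subspaceD.
  - exact: WQ.
  - exact: subspaceD.
  by rewrite (formDl FH) ?(formDl FQ)//; [field|exact: WQ|exact: WH].
by have [] := as_ker Wd ad sd.
Qed.

Theorem penalized_control_cvg (u p : V -> V -> V) (ua pa : R -> V -> V -> V)
  (g q : V) (ga qa : R -> V) :
  (forall g q, Hs g -> Qs q -> constrained_state b (control_load g q) (u g q)) ->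
  (forall g q, Hs g -> Qs q -> constrained_state 0 (dH (u g q - zd)) (p g q)) ->
  (forall al g q, 0 < al -> Hs g -> Qs q ->
    penalized_state b al (control_load g q) (ua al g q)) ->
  (forall al g q, 0 < al -> Hs g -> Qs q ->
    penalized_state 0 al (dH (ua al g q - zd)) (pa al g q)) ->
  control_optimal u g q ->
  (forall al, 0 < al -> control_optimal (ua al) (ga al) (qa al)) ->
  exists C, forall al, 1 <= al ->
  [/\ Num.sqrt (seminorm dH (ga al - g) ^+ 2 + seminorm dQ (qa al - q) ^+ 2)
        <= C / Num.sqrt (Num.sqrt al),
      seminorm (fun u v => dH u v + a u v) (ua al (ga al) (qa al) - u g q)
        <= C / Num.sqrt (Num.sqrt al)
    & seminorm (fun u v => dH u v + a u v) (pa al (ga al) (qa al) - p g q)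
        <= C / Num.sqrt (Num.sqrt al)].
Proof.
move=> Hu Hp Hua Hpa opt opta.
have [C1 C10 C1P] := apriori.
have [C2 C20 C2P] := penalized_dist.
have [Hg Qq _] := opt.
have H0 := SH.1; have Q0 := SQ.1.
have sH x := seminorm_ge0 dH x; have sQ x := seminorm_ge0 dQ x.
have loadD g' q' v w : Hs g' -> Qs q' -> W v -> W w ->
    control_load g' q' (v + w) = control_load g' q' v + control_load g' q' w.
  move=> Hg' Qq' Wv Ww; rewrite /control_load.
  rewrite (formDr SH FH (WH Wv) (WH Ww))// (formDr SQ FQ (WQ Wv) (WQ Ww))//.
  by rewrite opprD addrACA.
have WHu g' q' : Hs g' -> Qs q' -> W (u g' q') by move=> ? ?; case: (Hu g' q').
have WHua al g' q' : 0 < al -> Hs g' -> Qs q' -> W (ua al g' q').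
  by move=> al0 ? ?; case: (Hua al g' q').
pose L g' q' := seminorm dH g' + seminorm dQ q'.
have L_ge0 g' q' : 0 <= L g' q' by rewrite addr_ge0.
have ML g' q' : Hs g' -> Qs q' -> M (u g' q') <= C1 * (L g' q' + M b).
  move=> Hg' Qq'; apply: (C1P _ _ _ _ Wb _ _ (Hu _ _ Hg' Qq')) => // v Wv.
  exact: load_le.
have dL al g' q' : 1 <= al -> Hs g' -> Qs q' ->
    M (ua al g' q' - u g' q') <= C2 * ((L g' q' + M b) / Num.sqrt al).
  move=> al1 Hg' Qq'; have al0 : 0 < al by lra.
  have := C2P _ _ _ _ _ _ _ 0 Wb al1 (L_ge0 g' q') (lexx 0) _ _ _
    (Hu _ _ Hg' Qq') (Hua _ _ _ al0 Hg' Qq').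
  rewrite addr0; apply=> [v w|v Wv|v Wv].
  - exact: loadD.
  - exact: load_le.
  - by rewrite subrr normr0 mul0r.
have L00 : L 0 0 = 0.
  by rewrite /L /seminorm (form0l SH FH)// (form0l SQ FQ)// sqrtr0 addr0.
have alS (al : R) : 1 <= al -> 1 <= Num.sqrt al.
  by move=> al1; rewrite -sqrtr1 ler_wsqrtr.
(* [Z] bounds the misfit of the penalized state for the control 0, uniformly in [1 <= al]. *)
pose Z := (C1 + C2) * M b + seminorm dH zd.
have Z0 : 0 <= Z by rewrite addr_ge0// mulr_ge0// addr_ge0.
have HZ (al : R) : 1 <= al -> seminorm dH (ua al 0 0 - zd) <= Z.
  move=> al1; have al0 : 0 < al by lra.
  have Wu0 := WHu _ _ H0 Q0; have Wua0 := WHua _ _ _ al0 H0 Q0.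
  rewrite (le_trans (ler_seminormB SH FH (WH Wua0) Hzd))// lerD2r.
  have [h _ _ _] := le_M Wua0; apply: le_trans h _.
  have := ler_seminormD SW FM (subspaceB SW Wua0 Wu0) Wu0; rewrite subrK -/M.
  have := ML _ _ H0 Q0; have := dL _ _ _ al1 H0 Q0; rewrite L00 add0r.
  have : M b / Num.sqrt al <= M b.
    rewrite ler_pdivrMr; last by have := alS _ al1; lra.
    by rewrite ler_peMr// alS.
  move=> /(ler_wpM2l C20); lra.
(* The penalized optimum costs no more than the control 0. *)
have bga al : 1 <= al ->
    M1 / 2 * dH (ga al) (ga al) + M2 / 2 * dQ (qa al) (qa al) <= 2^-1 * Z ^+ 2.
  move=> al1; have al0 : 0 < al by lra.
  have [Hga Qqa oa] := opta _ al0; have := oa _ _ H0 Q0.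
  rewrite /control_cost (form0l SH FH)// (form0l SQ FQ)// !mulr0 !addr0.
  have Ww0 : Hs (ua al 0 0 - zd) by apply: (subspaceB SH) => //; exact: WH (WHua _ _ _ al0 H0 Q0).
  have Wwa : Hs (ua al (ga al) (qa al) - zd).
    by apply: (subspaceB SH) => //; exact: WH (WHua _ _ _ al0 Hga Qqa).
  have : dH (ua al 0 0 - zd) (ua al 0 0 - zd) <= Z ^+ 2.
    by rewrite -(sqr_seminorm FH)// ler_sqr ?nnegrE// HZ.
  have := form_ge0 FH Wwa; lra.
(* The last summand puts the limit control into the same ball as the penalized ones. *)
pose L1 := (Num.sqrt (Z ^+ 2 / M1) + Num.sqrt (Z ^+ 2 / M2)) + L g q.
have L10 : 0 <= L1 by rewrite !addr_ge0// sqrtr_ge0.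
have La al : 1 <= al -> L (ga al) (qa al) <= L1.
  move=> al1; have al0 : 0 < al by lra.
  have [Hga Qqa _] := opta _ al0; have := bga _ al1.
  have gg := form_ge0 FH Hga; have qq := form_ge0 FQ Qqa => bg.
  rewrite -[leLHS]addr0 /L1 lerD// /L lerD// ler_wsqrtr// ler_pdivlMr//.
    have : 0 <= M2 * dQ (qa al) (qa al) by rewrite mulr_ge0 ?(ltW M2_gt0). lra.
  have : 0 <= M1 * dH (ga al) (ga al) by rewrite mulr_ge0 ?(ltW M1_gt0). lra.
have Lg : L g q <= L1 by rewrite -[leLHS]add0r lerD// addr_ge0 ?sqrtr_ge0.
pose E := C2 * (L1 + M b); pose Z2 := C1 * (L1 + M b) + seminorm dH zd.
have E0 : 0 <= E by rewrite mulr_ge0// addr_ge0.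
have Z20 : 0 <= Z2 by rewrite addr_ge0// mulr_ge0// addr_ge0.
(* At equal controls the terms in [M1] and [M2] cancel and the difference of the squared misfits
   factors. *)
have dJ al g' q' : 1 <= al -> Hs g' -> Qs q' -> L g' q' <= L1 ->
    `|control_cost (ua al) g' q' - control_cost u g' q'| <=
      E * (E + 2 * Z2) / Num.sqrt al.
  move=> al1 Hg' Qq' L'; have al0 : 0 < al by lra.
  have Wu := WHu _ _ Hg' Qq'; have Wua := WHua _ _ _ al0 Hg' Qq'.
  set A := ua al g' q' - zd; set B := u g' q' - zd.
  have HA : Hs A by apply: subspaceB => //; exact: WH.
  have HB : Hs B by apply: subspaceB => //; exact: WH.
  have sal := alS _ al1.
  have hAB : seminorm dH (A - B) <= E / Num.sqrt al.
    have -> : A - B = ua al g' q' - u g' q' by rewrite /A /B opprB addrA subrK.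
    have [h _ _ _] := le_M (subspaceB SW Wua Wu); apply: le_trans h _.
    apply: le_trans (dL _ _ _ al1 Hg' Qq') _; rewrite /E -mulrA ler_wpM2l//.
    by rewrite ler_wpM2r ?invr_ge0 ?sqrtr_ge0// lerD2r.
  have hB : seminorm dH B <= Z2.
    rewrite (le_trans (ler_seminormB SH FH (WH Wu) Hzd))// lerD2r.
    have [h _ _ _] := le_M Wu; apply: le_trans h _.
    by apply: le_trans (ML _ _ Hg' Qq') _; rewrite ler_wpM2l// lerD2r.
  have hA := ler_seminormD SH FH (subspaceB SH HA HB) HB.
  have hB' := ler_seminormD SH FH (subspaceB SH HB HA) HA.
  rewrite !subrK (seminormB SH FH HB HA) in hA hB'.
  have El : E / Num.sqrt al <= E.
    by rewrite ler_pdivrMr ?ler_peMr//; lra.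
  have -> : control_cost (ua al) g' q' - control_cost u g' q' =
      2^-1 * ((seminorm dH A - seminorm dH B) * (seminorm dH A + seminorm dH B)).
    rewrite /control_cost -/A -/B -(sqr_seminorm FH HA) -(sqr_seminorm FH HB); ring.
  have h1 : `|seminorm dH A - seminorm dH B| <= E / Num.sqrt al.
    by rewrite ler_norml; lra.
  have h2 : `|seminorm dH A + seminorm dH B| <= E + 2 * Z2.
    rewrite ger0_norm ?addr_ge0//; lra.
  rewrite normrM normrM ger0_norm ?invr_ge0// mulrAC.
  have h3 := ler_pM (normr_ge0 _) (normr_ge0 _) h1 h2.
  have : 0 <= E / Num.sqrt al * (E + 2 * Z2) by apply: le_trans h3; rewrite mulr_ge0.
  lra.
pose m := Num.min M1 M2; have m0 : 0 < m by rewrite lt_min M1_gt0.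
(* 8 is 2 * 4: one cost gap at each of the two controls, and the quarters of [strong_convexity]. *)
pose C6 := 8 / m * (E * (E + 2 * Z2)).
have C60 : 0 <= C6.
  by rewrite mulr_ge0 ?divr_ge0 ?(ltW m0)// mulr_ge0// addr_ge0// mulr_ge0.
have D2 al : 1 <= al ->
    seminorm dH (ga al - g) ^+ 2 + seminorm dQ (qa al - q) ^+ 2 <= C6 / Num.sqrt al.
  move=> al1; have al0 : 0 < al by lra.
  have [Hga Qqa oa] := opta _ al0.
  have SS g' q' : Hs g' -> Qs q' -> Hs (u g' q') by move=> ? ?; exact/WH/WHu.
  have Smid g1 q1 g2 q2 := @state_mid u g1 q1 g2 q2 Hu.
  (* The limit cost increases from [(g, q)] to the penalized optimum by at most twice the bound of
     [dJ], since by [oa] the penalized cost does not increase. *)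
  have := strong_convexity SS Smid opt Hga Qqa.
  have h1 := dJ _ _ _ al1 Hg Qq Lg; have h2 := dJ _ _ _ al1 Hga Qqa (La _ al1).
  rewrite distrC in h2; have := oa _ _ Hg Qq.
  have {h1} := le_trans (ler_norm _) h1; have {h2} := le_trans (ler_norm _) h2.
  rewrite (seminormB SH FH Hga Hg) (seminormB SQ FQ Qqa Qq).
  have Hd := subspaceB SH Hg Hga; have Qd := subspaceB SQ Qq Qqa.
  rewrite (sqr_seminorm FH Hd) (sqr_seminorm FQ Qd) => h2 h1 h3 h4.
  have -> : C6 / Num.sqrt al = 8 * (E * (E + 2 * Z2) / Num.sqrt al) / m.
    by rewrite /C6; ring.
  rewrite ler_pdivlMr// mulrDl.
  have : dH (g - ga al) (g - ga al) * m <= dH (g - ga al) (g - ga al) * M1.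
    by rewrite ler_wpM2l ?(form_ge0 FH)// ge_min lexx.
  have : dQ (q - qa al) (q - qa al) * m <= dQ (q - qa al) (q - qa al) * M2.
    by rewrite ler_wpM2l ?(form_ge0 FQ)// ge_min lexx orbT.
  lra.
pose S6 := Num.sqrt C6.
have S60 : 0 <= S6 by exact: sqrtr_ge0.
(* [al] to the power -1/4, the rate of all three estimates. *)
pose r al : R := (Num.sqrt (Num.sqrt al))^-1.
have r0 al : 0 <= r al by rewrite invr_ge0 sqrtr_ge0.
have rE (al : R) : 1 <= al -> r al ^+ 2 = (Num.sqrt al)^-1.
  by move=> al1; rewrite exprVn sqr_sqrtr// sqrtr_ge0.
have rr (al : R) : 1 <= al -> (Num.sqrt al)^-1 <= r al.
  move=> al1; rewrite -rE// expr2 ler_piMr// invf_le1; first by rewrite !alS.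
  by have := alS _ (alS _ al1); lra.
have DS al : 1 <= al ->
  Num.sqrt (seminorm dH (ga al - g) ^+ 2 + seminorm dQ (qa al - q) ^+ 2) <= S6 * r al.
  move=> al1; rewrite -(ger0_norm (r0 al)) -sqrtr_sqr -sqrtrM// ler_wsqrtr//.
  by rewrite rE// D2.
have DL al : 1 <= al -> L (ga al - g) (qa al - q) <= 2 * (S6 * r al).
  move=> al1; have h := DS _ al1; apply: le_trans (ler_wpM2l _ h) => //.
  rewrite /L mulr2n mulrDl !mul1r lerD//.
    by rewrite -[leLHS](ger0_norm (sH _)) -sqrtr_sqr ler_wsqrtr// lerDl sqr_ge0.
  by rewrite -[leLHS](ger0_norm (sQ _)) -sqrtr_sqr ler_wsqrtr// lerDr sqr_ge0.
pose C7 := C2 * ((L1 + M b) + 2 * S6).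
have C70 : 0 <= C7 by apply: mulr_ge0 => //; apply: addr_ge0; [exact: addr_ge0|exact: mulr_ge0].
have DU al : 1 <= al -> M (ua al (ga al) (qa al) - u g q) <= C7 * r al.
  move=> al1; have al0 : 0 < al by lra.
  have [Hga Qqa oa] := opta _ al0.
  have h1 v : W v -> `|control_load (ga al) (qa al) v - control_load g q v| <=
      L (ga al - g) (qa al - q) * M v.
    move=> Wv; have -> : control_load (ga al) (qa al) v - control_load g q v =
        control_load (ga al - g) (qa al - q) v.
      rewrite /control_load (formBl FH)//; last exact: WH.
      rewrite (formBl FQ)//; last exact: WQ.
      by ring.
    by apply: load_le => //; exact: subspaceB.
  (* The control gap is the load perturbation [e]. *)
  have h := C2P _ _ _ _ _ _ _ (L (ga al - g) (qa al - q)) Wb al1 (L_ge0 g q)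
    (L_ge0 _ _) (fun v w => @loadD _ _ v w Hg Qq)
    (fun v => @load_le _ _ v Hg Qq) h1 (Hu _ _ Hg Qq) (Hua _ _ _ al0 Hga Qqa).
  apply: le_trans h _; rewrite /C7 -mulrA ler_wpM2l//.
  rewrite [leRHS]mulrDl lerD//; last by rewrite -mulrA DL.
  by rewrite ler_pM ?addr_ge0 ?invr_ge0 ?sqrtr_ge0 ?lerD2r ?rr.
have Hud : Hs (u g q - zd) by apply: (subspaceB SH) => //; exact/WH/WHu.
pose L2 := seminorm dH (u g q - zd).
pose C8 := C2 * (L2 + C7).
have C80 : 0 <= C8 by apply: mulr_ge0 => //; apply: addr_ge0 => //; exact: sH.
have M0 : M 0 = 0 by rewrite /M /seminorm (form0l SW FM) ?sqrtr0//; exact: SW.1.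
have DP al : 1 <= al -> M (pa al (ga al) (qa al) - p g q) <= C8 * r al.
  move=> al1; have al0 : 0 < al by lra.
  have [Hga Qqa oa] := opta _ al0.
  have Wua := WHua _ _ _ al0 Hga Qqa; have Wu := WHu _ _ Hg Qq.
  have Hua' : Hs (ua al (ga al) (qa al) - zd) by apply: (subspaceB SH) => //; exact: WH.
  have Cr0 : 0 <= C7 * r al by rewrite mulr_ge0.
  have h1 v w : W v -> W w -> dH (u g q - zd) (v + w) =
      dH (u g q - zd) v + dH (u g q - zd) w.
    by move=> Wv Ww; rewrite (formDr SH FH (WH Wv) (WH Ww)).
  have h2 v : W v -> `|dH (u g q - zd) v| <= L2 * M v.
    move=> Wv; have [h _ _ _] := le_M Wv.
    by rewrite (le_trans (ler_form SH FH Hud (WH Wv)))// ler_wpM2l.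
  have h3 v : W v -> `|dH (ua al (ga al) (qa al) - zd) v - dH (u g q - zd) v| <=
      C7 * r al * M v.
    move=> Wv; rewrite -(formBl FH)//; last exact: WH.
    rewrite (_ : _ - _ = ua al (ga al) (qa al) - u g q); last first.
      by rewrite opprB addrA subrK.
    have WB := subspaceB SW Wua Wu.
    rewrite (le_trans (ler_form SH FH (WH WB) (WH Wv)))// ler_pM//.
      by have [h _ _ _] := le_M WB; apply: le_trans h _; exact: DU.
    by have [] := le_M Wv.
  (* The same estimate with boundary datum 0; the perturbation is now the state gap, of order [r al]
     by [DU]. *)
  have h := C2P _ _ _ _ _ _ L2 (C7 * r al) SW.1 al1 (sH _) Cr0 h1 h2 h3
    (Hp _ _ Hg Qq) (Hpa _ _ _ al0 Hga Qqa).
  apply: le_trans h _; rewrite M0 addr0 /C8 -mulrA ler_wpM2l//.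
  rewrite [leRHS]mulrDl lerD2r; apply: ler_wpM2l; [exact: sH|exact: rr].
exists (S6 + C7 + C8) => al al1; have al0 : 0 < al by lra.
have [Hga Qqa _] := opta _ al0.
have h6 : 0 <= S6 * r al by rewrite mulr_ge0.
have h7 : 0 <= C7 * r al by rewrite mulr_ge0.
have h8 : 0 <= C8 * r al by rewrite mulr_ge0.
rewrite -/(r al) !mulrDl; split.
- by apply: le_trans (DS _ al1) _; lra.
- have WB := subspaceB SW (WHua _ _ _ al0 Hga Qqa) (WHu _ _ Hg Qq).
  have [_ _ _ h] := le_M WB; apply: le_trans h _.
  by apply: le_trans (DU _ al1) _; lra.
- have Wp : W (p g q) by case: (Hp _ _ Hg Qq).
  have Wpa : W (pa al (ga al) (qa al)) by case: (Hpa _ _ _ al0 Hga Qqa).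
  have [_ _ _ h] := le_M (subspaceB SW Wpa Wp); apply: le_trans h _.
  by apply: le_trans (DP _ al1) _; lra.
Qed.

End penalization.

(** * Square-integrable functions *)

Section L2_theory.
Context d (T : measurableType d) (R : realType).
Variables (mu : {measure set T -> \bar R}) (D : set T).
Hypothesis mD : measurable D.
Implicit Types f g : T -> R.

Lemma restrict_lin k f g : (k *: f + g) \_ D = k *: (f \_ D) + g \_ D.
Proof.
apply/funext => x; change ((k *: f + g) \_ D x = k * (f \_ D) x + (g \_ D) x).
by rewrite !patchE; case: ifP => // _; rewrite mulr0 addr0.
Qed.

Lemma L2_subspace : linear_subspace (L2 mu D).
Proof.
have le12 : (1 <= 2%:E :> \bar R)%E by rewrite lee1n.
have := Lfun_submod_closed mu le12; rewrite /GRing.submod_closed => -[h0 hl].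
split; last by move=> k f g ? ?; rewrite /L2/= restrict_lin; exact: hl.
by rewrite /L2/=; have -> : (0 : T -> R) \_ D = 0 by apply/funext => x; rewrite patchE; case: ifP.
Qed.

Lemma L2_measurable f : L2 mu D f -> measurable_fun D f.
Proof.
move=> /sub_Lfun_mfun; rewrite inE => mf; apply/measurable_restrictT => //.
Qed.

Lemma L2_mul_integrable f g : L2 mu D f -> L2 mu D g ->
  mu.-integrable D (EFin \o (fun x => f x * g x)).
Proof.
move=> /Lfun2_mul_Lfun1 h /h /Lfun1_integrable.
rewrite (integrable_mkcond _ mD); congr (mu.-integrable _ _).
by apply/funext => x; rewrite /= !patchE; case: ifP; rewrite ?mulr0.
Qed.

Lemma L2dot_psd : psd_form (L2 mu D) (L2dot mu D).
Proof.
split.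
- by move=> f g _ _; apply: eq_Rintegral => x _; rewrite mulrC.
- move=> k f g h Lf Lg Lh; rewrite /L2dot.
  have fh := L2_mul_integrable Lf Lh; have gh := L2_mul_integrable Lg Lh.
  rewrite -RintegralZl// -RintegralD//; last first.
    have := integrableZl mD k fh; congr (mu.-integrable _ _).
  apply: eq_Rintegral => x _; change ((k * f x + g x) * h x = k * (f x * h x) + g x * h x).
  by ring.
- by move=> f _; apply: Rintegral_ge0 => x _; rewrite -expr2 sqr_ge0.
Qed.

Lemma sqr_L2norm f : L2 mu D f -> L2norm mu D f ^+ 2 = L2dot mu D f f.
Proof.
move=> Lf; rewrite /L2norm -powR_mulrn ?fine_ge0 ?Lnorm_ge0//.
rewrite -fine_poweR powR_Lnorm ?pnatr_eq0// /L2dot /Rintegral.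
rewrite [in RHS]integral_mkcond; congr fine; apply: eq_integral => x _ /=.
rewrite !patchE; case: ifP => _ /=; last by rewrite normr0 powR0 ?pnatr_eq0.
by rewrite powR_mulrn// real_normK ?num_real// expr2.
Qed.

Lemma L2normE f : L2 mu D f -> L2norm mu D f = seminorm (L2dot mu D) f.
Proof.
move=> Lf; rewrite /seminorm -sqr_L2norm// sqrtr_sqr ger0_norm//.
by rewrite fine_ge0// Lnorm_ge0.
Qed.

Lemma bounded_L2 f (M : R) : (mu D < +oo)%E -> measurable_fun D f ->
  (forall x, D x -> `|f x| <= M) -> L2 mu D f.
Proof.
move=> Doo mf fM; rewrite /L2/= inE; apply/andP; split.
  by rewrite inE/=; apply/(measurable_restrictT f mD).
rewrite inE/= /finite_norm unlock poweR_lty//.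
have mM : measurable_fun D (EFin \o ((fun x => f x ^+ 2) : T -> R)).
  by apply/measurable_EFinP; exact: measurable_funX.
rewrite (_ : integral _ _ _ = \int[mu]_(x in D) (f x ^+ 2)%:E)%E; last first.
  rewrite [RHS]integral_mkcond; apply: eq_integral => x _ /=.
  rewrite !patchE; case: ifP => _ /=; last by rewrite normr0 powR0 ?pnatr_eq0.
  by rewrite powR_mulrn// real_normK ?num_real.
have : (\int[mu]_(x in D) (f x ^+ 2)%:E <= \int[mu]_(x in D) (cst (M ^+ 2)%:E x))%E.
  apply: ge0_le_integral => //.
  - by move=> x _; rewrite lee_fin sqr_ge0.
  - move=> x Dx; rewrite lee_fin -real_normK ?num_real// ler_sqr ?nnegrE ?fM//.
    exact: le_trans (normr_ge0 _) (fM _ Dx).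
move=> /le_lt_trans; apply; rewrite integral_cst//.
by rewrite lte_mul_pinfty// lee_fin sqr_ge0.
Qed.

(** On [Gamma1], this identifies the boundary condition of [V0h] with the kernel of a form; on
    [Omega], it reads zero energy as zero weak derivatives. *)
Lemma L2dot_eq0P f : L2 mu D f ->
  L2dot mu D f f = 0 <-> {ae mu, forall x, D x -> f x = 0}.
Proof.
move=> Lf; have ff := L2_mul_integrable Lf Lf; have mf := L2_measurable Lf.
have mff : measurable_fun D (EFin \o ((fun x => f x * f x) : T -> R)).
  by apply/measurable_EFinP; exact: measurable_funM.
have [h1 h2] := ae_eq_integral_abs mu mD mff.
have E : (\int[mu]_(x in D) `|(f x * f x)%:E|)%E = (\int[mu]_(x in D) (f x * f x)%:E)%E.
  apply: eq_integral => x _; rewrite gee0_abs// lee_fin -expr2 sqr_ge0//.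
rewrite E in h1 h2; split => [ff0|f0].
- have : ae_eq mu D (fun x => (f x * f x)%:E) (cst 0%E).
    apply: h1; rewrite -[LHS]fineK; first by rewrite [fine _]ff0.
    exact: integrable_fin_num.
  apply: filterS => x h Dx; have [] := h Dx => /eqP.
  by rewrite mulf_eq0 orbb => /eqP.
- rewrite /L2dot /Rintegral h2//; apply: filterS f0 => x h Dx.
  by rewrite /= h// mulr0.
Qed.

(** Meant for weak derivatives, which are known only up to null sets. *)
Lemma eq_ae_L2dot f f' g g' :
  L2 mu D f -> L2 mu D f' -> L2 mu D g -> L2 mu D g' ->
  {ae mu, forall x, D x -> f x = f' x} -> {ae mu, forall x, D x -> g x = g' x} ->
  L2dot mu D f g = L2dot mu D f' g'.
Proof.
move=> /L2_measurable mf /L2_measurable mf' /L2_measurable mg /L2_measurable mg' ff' gg'.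
congr fine; apply: (ae_eq_integral (mu := mu)) => //.
- by apply/measurable_EFinP; exact: measurable_funM.
- by apply/measurable_EFinP; exact: measurable_funM.
- by apply: (filterS2 _ _ ff' gg') => x h h' Dx; rewrite h// h'.
Qed.

Lemma eq_L2dot f f' g g' : {in D, f =1 f'} -> {in D, g =1 g'} ->
  L2dot mu D f g = L2dot mu D f' g'.
Proof. by move=> ff' gg'; apply: eq_Rintegral => x xD; rewrite ff'// gg'. Qed.

End L2_theory.

(** * Borel sets of R^n *)

Section boxes.
Context {R : realType} (n : nat).
Implicit Types a b x y : 'rV[R]_n.

Definition box a b : set 'rV[R]_n :=
  [set x | forall i, a ord0 i < x ord0 i < b ord0 i].

Definition cbox a b : set 'rV[R]_n :=
  [set x | forall i, a ord0 i <= x ord0 i <= b ord0 i].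

Definition boxes : set (set 'rV[R]_n) := [set box a b | a in setT & b in setT].

Lemma sub_box_cbox a b : box a b `<=` cbox a b.
Proof. by move=> x abx i; have /andP[/ltW -> /ltW ->] := abx i. Qed.

Lemma measurable_box a b : measurable (box a b).
Proof.
rewrite (_ : box a b = \bigcap_(i in [set: 'I_n])
    (rV_coord i @^-1` `]a ord0 i, b ord0 i[)); last first.
  by apply/seteqP; split => x /= xab i; [move=> _|];
    have := xab i; rewrite /= in_itv/=; exact.
apply: fin_bigcap_measurable => [|i _]; first exact: finite_finset.
by rewrite -[X in measurable X]setTI; exact: measurable_rV_coord.
Qed.

Lemma boxI a b c d :
  box a b `&` box c d = box (\row_i Num.max (a ord0 i) (c ord0 i))
                            (\row_i Num.min (b ord0 i) (d ord0 i)).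
Proof.
apply/seteqP; split => x /=.
  by move=> [ab cd] i; rewrite !mxE gt_max lt_min; have /andP[-> ->] := ab i;
    have /andP[-> ->] := cd i.
move=> h; split => i; have := h i; rewrite !mxE gt_max lt_min.
  by move=> /andP[/andP[-> _] /andP[-> _]].
by move=> /andP[/andP[_ ->] /andP[_ ->]].
Qed.

Lemma boxes_setI_closed : setI_closed boxes.
Proof.
by move=> _ _ [a _ [b _ <-]] [c _ [d _ <-]]; rewrite boxI; eexists => //; eexists.
Qed.

Lemma bigcup_boxes : \bigcup_k box (const_mx (- k%:R)) (const_mx k%:R) = setT.
Proof.
apply/seteqP; split => // x _.
have [k kx] : exists k : nat, \sum_i `|x ord0 i| < k%:R.
  by exists (Num.trunc (\sum_i `|x ord0 i|)).+1; rewrite truncnS_gt.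
exists k => // i; rewrite !mxE -ltr_norml (le_lt_trans _ kx)//.
by rewrite (bigD1 i)//= lerDl sumr_ge0.
Qed.

(** Conversely, a slab between two values of one coordinate is the union of the boxes [B k], whose
    other sides grow. *)
Lemma measurable_boxesE : (@measurable rV_display 'rV[R]_n) = <<s boxes >>.
Proof.
apply/seteqP; split => [A mA|A]; last first.
  apply: smallest_sub; first exact: sigma_algebra_measurable.
  by move=> _ [a _ [b _ <-]]; exact: measurable_box.
suff mid : measurable_fun setT (id : g_sigma_algebraType boxes -> 'rV[R]_n).
  by have := mid measurableT A mA; rewrite setTI.
apply: measurable_fun_rV => i.
apply: (measurability _ (RGenOpens.measurableE R)).
move=> _ [_ [x [y ->] <-]]; rewrite setTI.
pose B k := box (\row_j if j == i then x else - k%:R)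
                (\row_j if j == i then y else k%:R).
rewrite (_ : _ @^-1` _ = \bigcup_k B k).
  by apply: bigcupT_measurable => k; apply: sub_sigma_algebra; eexists => //; eexists.
apply/seteqP; split => [z|z [k _] /(_ i)].
  rewrite /= in_itv/= => xy.
  have : setT z by []. rewrite -bigcup_boxes => -[k _ zk].
  exists k => // j; rewrite !mxE; case: ifPn => [/eqP ->//|_].
  by have := zk j; rewrite !mxE.
by rewrite !mxE eqxx/= in_itv.
Qed.

Lemma rV_measure_unique (m1 m2 : {measure set 'rV[R]_n -> \bar R}) :
  (forall a b, m1 (box a b) = m2 (box a b)) ->
  (forall a b, (m1 (box a b) < +oo)%E) ->
  forall A, measurable A -> m1 A = m2 A.
Proof.
move=> m12 m1oo; apply: (measure_unique boxes
  (fun k => box (const_mx (- k%:R)) (const_mx k%:R))) => //.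
- exact: measurable_boxesE.
- exact: boxes_setI_closed.
- by move=> k; eexists => //; eexists.
- exact: bigcup_boxes.
- by move=> _ [a _ [b _ <-]].
Qed.

Lemma lebesgue_box a b : lebesgue_rV n (box a b) =
  (\prod_(i < n) Num.max 0 (b ord0 i - a ord0 i))%:E.
Proof.
have -> : box a b = [set x | forall i, `]a ord0 i, b ord0 i[%classic (x ord0 i)].
  by apply/seteqP; split => x h i; have := h i; rewrite /= in_itv.
rewrite (@lebesgue_rV_box R n (fun i => `]a ord0 i, b ord0 i[%classic))//.
rewrite -prodEFin; apply: eq_bigr => i _.
rewrite lebesgue_measure_itv/= lte_fin.
case: ltP => h; first by rewrite EFinN -EFinD (elimT max_idPr) ?subr_ge0// ltW.
by rewrite (elimT max_idPl)// subr_le0.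
Qed.

Lemma lebesgue_box_lty a b : (lebesgue_rV n (box a b) < +oo)%E.
Proof. by rewrite lebesgue_box ltry. Qed.

Lemma lebesgue_box_gt0 a b : (forall i, a ord0 i < b ord0 i) ->
  (0 < lebesgue_rV n (box a b))%E.
Proof.
move=> ab; rewrite lebesgue_box lte_fin prodr_gt0// => i _.
by rewrite lt_max subr_gt0 ab orbT.
Qed.

Definition translate (v x : 'rV[R]_n) := x + v.

Lemma measurable_translate v : measurable_fun setT (translate v).
Proof.
apply: measurable_fun_rV => i.
rewrite (_ : _ \o _ = fun x => rV_coord i x + v ord0 i).
  by apply: measurable_funD => //; exact: measurable_rV_coord.
by apply/funext => x; rewrite /rV_coord /= mxE.
Qed.

(** A translation preserves the side lengths of boxes, and boxes determine a measure that is finite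
    on them. *)
Lemma lebesgue_translate v A : measurable A ->
  lebesgue_rV n (translate v @^-1` A) = lebesgue_rV n A.
Proof.
move=> mA; symmetry.
apply: (@rV_measure_unique (lebesgue_rV n)
  (measure_function_pushforward__canonical__measure_function_Measure
    (lebesgue_rV n) (@measurable_translate v))) => // [a b|a b]; last first.
  exact: lebesgue_box_lty.
rewrite /= /pushforward (_ : _ @^-1` _ = box (a - v) (b - v)); last first.
  apply/seteqP; split => x h i; have := h i;
    by rewrite !mxE ltrBlDr ltrBrDr.
rewrite !lebesgue_box; congr (_%:E); apply: eq_bigr => i _.
by rewrite !mxE opprB addrA subrK.
Qed.

End boxes.

Section open_rV.
Context {R : realType} (n : nat).
Implicit Types (a b x y : 'rV[R]_n.+1) (O : set 'rV[R]_n.+1).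

Lemma open_rVP O : open O <->
  forall x, O x -> exists2 e, 0 < e &
    forall y, (forall i, `|x ord0 i - y ord0 i| < e) -> O y.
Proof.
rewrite openE; split=> [oO x /oO/nbhs_ballP[e e0 eO]|h x /h[e e0 eO]].
  by exists e => // y xy; apply: eO; split => // i j; rewrite ord1; exact: xy.
apply/nbhs_ballP; exists e => // y [_ xy]; apply: eO => i.
exact: (xy ord0 i).
Qed.

(** Boxes with rational corners are countably many. Keeping the closed boxes inside [O] makes them
    usable as supports of test functions. *)
Lemma open_bigcup_boxes O : open O -> exists B : nat -> 'rV[R]_n.+1 * 'rV[R]_n.+1,
  (forall k, cbox (B k).1 (B k).2 `<=` O) /\ O = \bigcup_k box (B k).1 (B k).2.
Proof.
move=> /open_rVP oO.
pose P (q : 'rV[rat]_n.+1 * 'rV[rat]_n.+1) : 'rV[R]_n.+1 * 'rV[R]_n.+1 :=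
  (map_mx ratr q.1, map_mx ratr q.2).
(* junk value: a pair with an empty closed box *)
pose e0 : 'rV[R]_n.+1 * 'rV[R]_n.+1 := (const_mx 1, const_mx 0).
pose B k := if unpickle k is Some q then
  (if `[< cbox (P q).1 (P q).2 `<=` O >] then P q else e0) else e0.
have ce0 : cbox e0.1 e0.2 = set0.
  by rewrite -subset0 => x /(_ ord0); rewrite !mxE => /andP[h1 h2]; lra.
have cB k : cbox (B k).1 (B k).2 `<=` O.
  rewrite /B; case: unpickle => [q|]; last by rewrite ce0.
  by case: asboolP => // _; rewrite ce0.
exists B; split => //; apply/seteqP; split => [x Ox|x [k _ /sub_box_cbox]]; last exact: cB.
have [e e0' eO] := oO _ Ox.
have /choice[a aP] i : exists q : rat, x ord0 i - e < ratr q < x ord0 i.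
  have /rat_in_itvoo[q] : x ord0 i - e < x ord0 i by lra.
  by rewrite in_itv/= => ?; exists q.
have /choice[b bP] i : exists q : rat, x ord0 i < ratr q < x ord0 i + e.
  have /rat_in_itvoo[q] : x ord0 i < x ord0 i + e by lra.
  by rewrite in_itv/= => ?; exists q.
pose q : 'rV[rat]_n.+1 * 'rV[rat]_n.+1 := (\row_i a i, \row_i b i).
exists (pickle q) => //; rewrite /B pickleK asboolT.
  move=> i; rewrite !mxE; have /andP[_ ->] := aP i.
  by have /andP[-> _] := bP i.
move=> y yq; apply: eO => i; have := yq i; rewrite !mxE => /andP[h1 h2].
have /andP[h3 h4] := aP i; have /andP[h5 h6] := bP i.
by rewrite ltr_norml; apply/andP; split; lra.
Qed.

Lemma open_rV_measurable O : open O -> measurable O.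
Proof.
move=> /open_bigcup_boxes[B [_ ->]]; apply: bigcupT_measurable => k.
exact: measurable_box.
Qed.

Lemma closed_rV_measurable (A : set 'rV[R]_n.+1) : closed A -> measurable A.
Proof.
by move=> cA; rewrite -(setCK A); apply: measurableC; apply: open_rV_measurable; rewrite openC.
Qed.

Lemma lebesgue_open_gt0 O : open O -> O !=set0 -> (0 < lebesgue_rV n.+1 O)%E.
Proof.
move=> oO [x Ox]; have [B [_ OE]] := open_bigcup_boxes oO.
have [k _ xk] : (\bigcup_k box (B k).1 (B k).2) x by rewrite -OE.
apply: (@lt_le_trans _ _ (lebesgue_rV n.+1 (box (B k).1 (B k).2))).
  by apply: lebesgue_box_gt0 => i; have /andP[+ +] := xk i; exact: lt_trans.
apply: le_measure; rewrite ?inE; [exact: measurable_box|exact: open_rV_measurable|].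
by rewrite OE => y yk; exists k.
Qed.

Lemma bounded_box O : bounded_set O -> exists k : nat,
  O `<=` box (const_mx (- k%:R)) (const_mx k%:R).
Proof.
move=> [M [_ MO]]; exists (Num.trunc (`|M| + 1)).+1 => x Ox i.
rewrite !mxE -ltr_norml (le_lt_trans _ (truncnS_gt _))//.
apply: le_trans (MO (`|M| + 1) _ _ Ox); last by rewrite (le_lt_trans (ler_norm _))// ltrDl.
rewrite [leRHS]mx_normrE; exact: (le_bigmax _ (fun i => `|x i.1 i.2|) (ord0, i)).
Qed.

Lemma lebesgue_bounded_lty O : bounded_set O -> measurable O -> (lebesgue_rV n.+1 O < +oo)%E.
Proof.
move=> /bounded_box[k Ok] mO; apply: le_lt_trans (lebesgue_box_lty _ _).
by apply: le_measure; rewrite ?inE//; [exact: measurable_box|exact: Ok].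
Qed.

Lemma continuous_rV_measurable (C : set 'rV[R]_n.+1) (f : 'rV[R]_n.+1 -> R) :
  measurable C -> {within C, continuous f} -> measurable_fun C f.
Proof.
move=> mC cf; apply: (measurability _ (RGenOpens.measurableE R)).
move=> _ [_ [x [y ->] <-]].
have /continuousP oc := cf.
have /open_subspaceP[V oV VE] := oc _ (@interval_open _ (BRight x) (BLeft y) isT isT).
by rewrite setIC -VE; apply: measurableI => //; exact: open_rV_measurable.
Qed.

End open_rV.

(** * Hausdorff measure *)

Section caratheodory_criterion.
Context {R : realType} {T : Type} (mu : {outer_measure set T -> \bar R}).
Variable f : T -> R.
Hypothesis mu_sep : forall (A B : set T) (d : R), 0 < d ->
  (forall x y, A x -> B y -> d <= `|f x - f y|) ->
  (mu A + mu B <= mu (A `|` B))%E.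

(** Rings of equal parity are separated by [f], so their outer measures add up; [e] selects the
    parity. *)
Let ring_sum (X : set T) (c : R) (e m : nat) :
  let F j := X `&` [set x | c + (j.*2 + e).+2%:R^-1 < f x <= c + (j.*2 + e).+1%:R^-1] in
  (\sum_(j < m) mu (F j) <= mu X)%E.
Proof.
set F := fun j : nat => X `&` [set x | c + (j.*2 + e).+2%:R^-1 < f x <= c + (j.*2 + e).+1%:R^-1]; rewrite -/F/=.
have FX j : F j `<=` X by move=> x [].
apply: (@le_trans _ _ (mu (\big[setU/set0]_(j < m) F j))); last first.
  apply: le_outer_measure; rewrite -bigcup_mkord => x [j _]; exact: FX.
elim: m => [|m IH]; first by rewrite !big_ord0 outer_measure0.
rewrite big_ord_recr [in leRHS]big_ord_recr/=.
apply: le_trans (leeD2r _ IH) _.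
pose d : R := (m.*2 + e)%:R^-1 - (m.*2 + e).+1%:R^-1.
(* The case [m = 0] is apart: with [e = 0], the gap [d] would start from [0^-1 = 0]. *)
have [m0|m0] := posnP m.
  by rewrite m0 big_ord0 outer_measure0 add0e set0U.
have me : (0 < m.*2 + e)%N by rewrite addn_gt0 double_gt0 m0.
apply: (@mu_sep _ _ d).
  by rewrite subr_gt0 ltf_pV2 ?posrE ?ltr0n// ltr_nat.
move=> x y; rewrite -bigcup_mkord => -[j /= jm [_ /= /andP[h1 _]]] [_ /= /andP[_ h2]].
have h3 : (m.*2 + e)%:R^-1 <= (j.*2 + e).+2%:R^-1 :> R.
  rewrite lef_pV2 ?posrE ?ltr0n// ler_nat -addSn -addSn leq_add2r.
  by rewrite -doubleS leq_double.
apply: le_trans (ler_norm _); rewrite /d; move: h1 h2 h3.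
move: ((j.*2 + e).+2%:R^-1 : R) ((m.*2 + e).+1%:R^-1 : R) ((m.*2 + e)%:R^-1 : R).
by move=> a3 a2 a1 h1 h2 h3; lra.
Qed.

(** Caratheodory's argument: [f] separates [Y k] from [N] by [k.+1%:R^-1], so [mu_sep] applies to
    them, and what [Y k] misses of [P] lies in the rings of index at least [k], whose total outer
    measure tends to 0. *)
Lemma caratheodory_gt c : mu.-caratheodory [set x | c < f x].
Proof.
apply: le_caratheodory_measurable => X.
set P := X `&` _; set N := X `&` _.
have [->|Xoo] := eqVneq (mu X) +oo%E; first by rewrite leey.
have Xfin : (mu X < +oo)%E by rewrite ltey.
pose Y k := X `&` [set x | c + k.+1%:R^-1 < f x].
pose F j := X `&` [set x | c + j.+2%:R^-1 < f x <= c + j.+1%:R^-1].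
have F_ge0 j : (0 <= mu (F j))%E by exact: outer_measure_ge0.
have PY k : P `<=` Y k `|` \bigcup_(j in ~` `I_k) F j.
  move=> x [Xx /= cx]; have [h|h] := ltP (c + k.+1%:R^-1) (f x); first by left; split.
  right.
  have ex : exists m : nat, c + m.+1%:R^-1 < f x.
    have fc : 0 < f x - c by rewrite subr_gt0.
    exists (Num.trunc (f x - c)^-1).
    rewrite addrC -ltrBrDr -[ltRHS]invrK ltf_pV2 ?posrE ?invr_gt0//.
    exact: truncnS_gt.
  (* The least such [m] places [x] in the ring of index [m - 1]. *)
  have := ex_minnP ex; case: ex_minnP => m mx mmin _.
  have km : (k < m)%N.
    rewrite ltnNge; apply/negP => mk; move: h; rewrite leNgt => /negP; apply.
    apply: le_lt_trans mx; rewrite lerD2l lef_pV2 ?posrE ?ltr0n// ler_nat.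
    by rewrite ltnS.
  case: m => [//|m] in mx mmin km *.
  exists m; first by move=> /= mk; move: km; rewrite ltnS leqNgt mk.
  split => //=; rewrite mx/= leNgt; apply/negP => /mmin.
  by rewrite ltnn.
(* The even rings and the odd rings each sum to at most [mu X]. *)
have sumF : (\sum_(0 <= j <oo) mu (F j) < +oo)%E.
  apply: (@le_lt_trans _ _ (mu X + mu X)%E); last by rewrite lte_add_pinfty.
  apply: lime_le; first exact: is_cvg_nneseries.
  apply: nearW => m /=.
  have h : (\sum_(0 <= j < m) mu (F j) <= \sum_(0 <= j < m.*2) mu (F j))%E.
    rewrite [leRHS](big_cat_nat (n := m))//=; last by rewrite -addnn leq_addr.
    by rewrite leeDl// sume_ge0.
  apply: le_trans h _; rewrite big_mkord.
  have -> : (\sum_(i < m.*2) mu (F i) = \sum_(j < m) mu (F (j.*2 + 0)%N) + \sum_(j < m) mu (F (j.*2 + 1)%N))%E.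
    elim: m => [|m IH]; first by rewrite !big_ord0 adde0.
    rewrite doubleS 2!big_ord_recr/= IH [in RHS]big_ord_recr/=.
    rewrite [X in _ = (_ + X)%E]big_ord_recr/= addn0 addn1.
    by rewrite addeACA addeA.
  by apply: leeD; exact: ring_sum.
have tail := nneseries_tail_cvg sumF (fun k _ => F_ge0 k).
have YN k : (mu (Y k) + mu N <= mu X)%E.
  apply: le_trans (@mu_sep _ _ k.+1%:R^-1 _ _) _; first by rewrite invr_gt0.
    move=> x y [_ /= h1] [_ /= /negP]; rewrite -leNgt => h2.
    apply: le_trans (ler_norm _); move: h1; move: (k.+1%:R^-1 : R) => a1 h1; lra.
  by apply: le_outer_measure => x [[]|[]].
have bound k : (mu P + mu N <= mu X + \sum_(k <= j <oo) mu (F j))%E.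
  have := le_outer_measure mu _ _ (PY k).
  move=> /le_trans /(_ (outer_measureU2 _ _ _)) h.
  have {}h := le_trans h (leeD2l _ (outer_measure_sigma_subadditive_tail mu k F)).
  apply: le_trans (leeD2r _ h) _.
  by rewrite addeAC leeD2r.
have cv : (fun k => mu X + \sum_(k <= j <oo) mu (F j))%E @ \oo --> (mu X + 0)%E.
  by apply: cvgeD => //; [rewrite fin_num_adde_defl|exact: cvg_cst].
rewrite adde0 in cv; rewrite -(cvg_lim _ cv)//; apply: lime_ge.
  by apply/cvg_ex; eexists; exact: cv.
exact: nearW.
Qed.

End caratheodory_criterion.

Section hausdorff_borel.
Context {R : realType} (n : nat).
Implicit Types (x y : 'rV[R]_n) (A B : set 'rV[R]_n).

Lemma coord_le_edist x y i : `|x ord0 i - y ord0 i| <= Defs.edist x y.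
Proof.
rewrite -sqrtr_sqr ler_wsqrtr// (bigD1 i)//= lerDl sumr_ge0// => j _.
exact: sqr_ge0.
Qed.

Lemma edist_le_sum x y : Defs.edist x y <= \sum_i `|x ord0 i - y ord0 i|.
Proof.
have s0 : 0 <= \sum_i `|x ord0 i - y ord0 i| by exact: sumr_ge0.
rewrite -[leRHS](ger0_norm s0) -sqrtr_sqr ler_wsqrtr//.
suff [] : \sum_i (x ord0 i - y ord0 i) ^+ 2 <= (\sum_i `|x ord0 i - y ord0 i|) ^+ 2 /\
  0 <= \sum_i `|x ord0 i - y ord0 i| by [].
apply: (big_ind2 (fun a b : R => a <= b ^+ 2 /\ 0 <= b)) => [|a b c d [ab b0] [cd d0]|i _].
- by rewrite expr0n.
- have : 0 <= b * d by rewrite mulr_ge0.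
  by split; [lra|exact: addr_ge0].
- by rewrite real_normK ?num_real.
Qed.

Variable k : nat.
Local Notation wt := (@hausdorff_weight R n k).
Local Notation hd := (@hausdorff_delta R n k).

Lemma hausdorff_delta_homo d d' A : d <= d' -> (hd d' A <= hd d A)%E.
Proof.
move=> dd'; apply: le_ereal_inf_tmp => _ [F [mF AF] <-].
apply: (@le_trans _ _ (\sum_(k0 <oo) wt d' (F k0))%E).
  by apply: ereal_inf_lbound; exists F.
apply: lee_nneseries => [i _ _|i _]; first exact: hausdorff_weight_ge0.
rewrite /hausdorff_weight; case: ifPn => // _.
case: (asboolP (forall x y, F i x -> F i y -> Defs.edist x y <= d)) => h; last exact: leey.
by rewrite asboolT// => x y Fx Fy; exact: le_trans (h _ _ Fx Fy) dd'.
Qed.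

(** A set that meets both [A] and [B] contains two points more than [d] apart, so its weight is
    [+oo]; every other member of a cover counts for one side only. *)
Lemma hausdorff_delta_sep A B e d : 0 < e -> d < e ->
  (forall x y, A x -> B y -> e <= Defs.edist x y) ->
  (hd d A + hd d B <= hd d (A `|` B))%E.
Proof.
move=> e0 de AB; apply: le_ereal_inf_tmp => _ [F [mF ABF] <-].
(* Members of the cover that miss [C] are emptied, which gives them weight 0. *)
pose G C i := if `[< F i `&` C !=set0 >] then F i else set0.
have hG C : C `<=` A `|` B -> (hd d C <= \sum_(i <oo) wt d (G C i))%E.
  move=> CAB; apply: ereal_inf_lbound; exists (G C) => //; split.
    by move=> i; exact: sub_sigma_algebra.
  move=> x Cx; have [i _ Fx] := ABF _ (CAB _ Cx); exists i => //.
  by rewrite /G asboolT//; exists x.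
apply: le_trans (leeD (hG A (@subsetUl _ A B)) (hG B (@subsetUr _ A B))) _.
rewrite -nneseriesD//; try by move=> i _ _; exact: hausdorff_weight_ge0.
apply: lee_nneseries => [i _ _|i _].
  by rewrite adde_ge0 ?hausdorff_weight_ge0.
rewrite /G; case: asboolP => hA; case: asboolP => hB;
  rewrite ?hausdorff_weight0 ?adde0 ?add0e ?hausdorff_weight_ge0//.
have [[x [Fx Ax]] [y [Fy By]]] := (hA, hB).
rewrite {3}/hausdorff_weight; case: ifPn => [/eqP F0|_]; first by rewrite F0 in Fx.
rewrite asboolF ?leey// => /(_ _ _ Fx Fy); rewrite leNgt => /negP; apply.
by apply: lt_le_trans de _; exact: AB.
Qed.

Lemma hausdorff_sep A B e : 0 < e ->
  (forall x y, A x -> B y -> e <= Defs.edist x y) ->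
  (hausdorff k A + hausdorff k B <= hausdorff k (A `|` B))%E.
Proof.
move=> e0 AB; set X := hausdorff k (A `|` B).
have hX d : 0 < d -> (hd d A + hd d B <= X)%E.
  move=> d0; pose d' := Num.min d (e / 2).
  have d'0 : 0 < d' by rewrite lt_min d0 divr_gt0.
  have d'e : d' < e by rewrite gt_min ltr_pdivrMr// ltr_pMr// ltr1n orbT.
  apply: le_trans (le_hausdorff_delta k (A `|` B) d'0).
  apply: le_trans (hausdorff_delta_sep e0 d'e AB).
  by apply: leeD; apply: hausdorff_delta_homo; rewrite ge_min lexx.
(* Independent scales, so that the two suprema can be taken one after the other. *)
have hX2 d d' : 0 < d -> 0 < d' -> (hd d A + hd d' B <= X)%E.
  move=> d0 d'0; have m0 : 0 < Num.min d d' by rewrite lt_min d0.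
  apply: le_trans (hX _ m0); apply: leeD; apply: hausdorff_delta_homo;
    by rewrite ge_min lexx ?orbT.
have [->|Xoo] := eqVneq X +oo%E; first exact: leey.
have Xlt : (X < +oo)%E by rewrite ltey.
have fA d : 0 < d -> hd d A \is a fin_num.
  move=> d0; rewrite ge0_fin_numE ?hausdorff_delta_ge0//.
  apply: le_lt_trans Xlt; apply: le_trans (hX _ d0).
  by rewrite leeDl// hausdorff_delta_ge0.
have bA d : 0 < d -> (hausdorff k B <= X - hd d A)%E.
  move=> d0; apply: ge_ereal_sup => _ [d' d'0 <-].
  by rewrite leeBrDl ?fA//; exact: hX2.
have fB : hausdorff k B \is a fin_num.
  rewrite ge0_fin_numE ?hausdorff_ge0//; apply: le_lt_trans Xlt.
  apply: le_trans (bA 1 ltr01) _.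
  by rewrite leeBlDr ?fA// leeDl// hausdorff_delta_ge0.
rewrite -leeBrDr//; apply: ge_ereal_sup => _ [d d0 <-].
have fAd := fA d d0.
by rewrite leeBrDr// addeC -leeBrDr//; exact: bA.
Qed.

End hausdorff_borel.

Section surface_borel.
Context {R : realType} (n : nat).

(** Coordinates are 1-Lipschitz for [edist], so [hausdorff_sep] provides the hypothesis of
    [caratheodory_gt] for each of them, and the resulting half-spaces generate the Borel sets. *)
Lemma borel_surface_measurable (A : set 'rV[R]_n.+1) : measurable A ->
  (@surface_outer R n).-cara.-measurable A.
Proof.
move=> mA.
suff mid : measurable_fun setT
    (id : caratheodory_type (@surface_outer R n) -> 'rV[R]_n.+1).
  by have := mid measurableT A mA; rewrite setTI.
apply: measurable_fun_rV => i.
apply: (measurability _ (RGenOInfty.measurableE R)).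
move=> _ [_ [c ->] <-]; rewrite setTI.
rewrite (_ : _ @^-1` _ = [set x : 'rV[R]_n.+1 | c < x ord0 i]); last first.
  by apply/seteqP; split => x; rewrite /= in_itv/= andbT.
apply: (@caratheodory_gt R _ (@surface_outer R n) (fun x => x ord0 i)).
move=> B C d d0 BC; apply: (@hausdorff_sep R n.+1 n B C d d0) => x y Bx Cy.
exact: le_trans (BC _ _ Bx Cy) (coord_le_edist _ _ _).
Qed.

Lemma borel_surface_measurable_fun (C D : set 'rV[R]_n.+1) (f : 'rV[R]_n.+1 -> R) :
  measurable C -> measurable_fun C f -> D `<=` C ->
  @measurable_fun _ _ (caratheodory_type (@surface_outer R n)) R D f.
Proof.
move=> mC mf DC mD Y mY.
have := borel_surface_measurable (mf mC Y mY).
move=> /(measurableI _ _ mD); congr (measurable _).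
by rewrite setIA (setIidl DC).
Qed.

Definition parallelepiped (x0 : 'rV[R]_n.+1) (v : 'I_n -> 'rV[R]_n.+1) :=
  [set x | exists2 t : 'I_n -> R, forall k, 0 <= t k <= 1 &
    x = x0 + \sum_k t k *: v k].

(** Cutting each edge into [N] parts gives [N ^ n] cells of diameter at most [D / N]; the resulting
    bound on the total weight does not depend on [N], hence not on [delta]. *)
Lemma surface_parallelepiped_lty x0 v : (surface n (parallelepiped x0 v) < +oo)%E.
Proof.
pose D : R := \sum_i \sum_k `|v k ord0 i|.
have D0 : 0 <= D by apply: sumr_ge0 => i _; exact: sumr_ge0.
pose u := @unit_ball_volume R n.
have u0 : 0 <= u by rewrite /u fine_ge0// measure_ge0.
apply: (@le_lt_trans _ _ (u * (D / 2) ^+ n)%:E); last exact: ltry.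
apply: ge_ereal_sup => _ [delta /= delta0 <-].
pose N := (Num.trunc (D / delta)).+1.
have DN : D / N%:R <= delta.
  rewrite ler_pdivrMr ?ltr0n// mulrC -ler_pdivrMr//.
  by rewrite ltW// truncnS_gt.
pose cell (c : {ffun 'I_n -> 'I_N}) : set 'rV[R]_n.+1 :=
  [set x | exists2 t : 'I_n -> R,
    forall k, (c k)%:R / N%:R <= t k <= (c k).+1%:R / N%:R &
    x = x0 + \sum_k t k *: v k].
have cell_diam c x y : cell c x -> cell c y -> Defs.edist x y <= D / N%:R.
  move=> [t tc ->] [s sc ->]; apply: le_trans (edist_le_sum _ _) _.
  rewrite /D mulr_suml; apply: ler_sum => i _; rewrite mulr_suml.
  rewrite !mxE opprD addrACA subrr add0r !summxE -sumrB.
  apply: le_trans (ler_norm_sum _ _ _) _; apply: ler_sum => k _.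
  rewrite !mxE -mulrBl normrM mulrC ler_wpM2l// ler_norml.
  have /andP[h1 h2] := tc k; have /andP[h3 h4] := sc k.
  rewrite -natr1 mulrDl mul1r in h2 h4.
  by apply/andP; split; lra.
have cell_weight c : (@hausdorff_weight R n.+1 n delta (cell c) <=
    (u * (D / N%:R / 2) ^+ n)%:E)%E.
  rewrite /hausdorff_weight; case: ifPn => [_|cn0].
    by rewrite lee_fin mulr_ge0// exprn_ge0// !divr_ge0.
  rewrite asboolT; last by move=> x y cx cy; exact: le_trans (cell_diam _ _ _ cx cy) DN.
  rewrite lee_fin ler_wpM2l// lerXn2r ?nnegrE ?divr_ge0 ?diam_ge0//.
  rewrite ler_wpM2r ?invr_ge0// /diam.
  have /set0P[x cx] := cn0.
  apply: ge_sup; first by exists (Defs.edist x x); exists x => //; exists x.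
  by move=> _ [y cy [z cz <-]]; exact: cell_diam cy cz.
pose s := [seq cell c | c <- enum {ffun 'I_n -> 'I_N}].
have size_s : size s = (N ^ n)%N by rewrite size_map -cardE card_ffun !card_ord.
apply: (@le_trans _ _ (\sum_(k <oo) @hausdorff_weight R n.+1 n delta (nth set0 s k))%E).
  apply: ereal_inf_lbound; exists (nth set0 s) => //; split.
    by move=> i; exact: sub_sigma_algebra.
  move=> x [t t01 ->].
  (* The minimum sends the end value [t k = 1] to the last cell. *)
  pose c : {ffun 'I_n -> 'I_N} := [ffun k => inord (minn (Num.trunc (t k * N%:R)) N.-1)].
  exists (index c (enum {ffun 'I_n -> 'I_N})) => //.
  have ci : (index c (enum {ffun 'I_n -> 'I_N}) < size (enum {ffun 'I_n -> 'I_N}))%N.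
    by rewrite index_mem mem_enum.
  rewrite (nth_map c)// nth_index ?mem_enum//.
  exists t => // k; rewrite ffunE inordK; last by rewrite ltnS geq_minr.
  have N0 : 0 < N%:R :> R by rewrite ltr0n.
  have /andP[tk0 tk1] := t01 k.
  have tN0 : 0 <= t k * N%:R by rewrite mulr_ge0.
  rewrite ler_pdivrMr// ler_pdivlMr//; apply/andP; split.
    by apply: (@le_trans _ _ (Num.trunc (t k * N%:R))%:R);
      rewrite ?truncn_le// ler_nat geq_minl.
  have [h|h] := leqP (Num.trunc (t k * N%:R)) N.-1.
    by rewrite ltW// truncnS_gt.
  by rewrite -[leRHS]mul1r ler_wpM2r// ltW.
rewrite (nneseries_split 0 (size s)); last by move=> k _; exact: hausdorff_weight_ge0.
rewrite eseries0 ?adde0; last first.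
  by move=> i /= si _; rewrite nth_default// hausdorff_weight0.
apply: (@le_trans _ _ (\sum_(0 <= k < size s) (u * (D / N%:R / 2) ^+ n)%:E)%E).
  rewrite add0n big_nat [leRHS]big_nat; apply: lee_sum => k /= ks.
  pose c0 : {ffun 'I_n -> 'I_N} := [ffun=> ord0].
  by rewrite (nth_map c0) ?cell_weight//; move: ks; rewrite size_map.
rewrite sumEFin lee_fin sumr_const_nat subn0 size_s -[leLHS]mulr_natr natrX.
rewrite -[leLHS]mulrA -exprMn; have N0 : N%:R != 0 :> R by rewrite pnatr_eq0.
by rewrite [D / _ / 2 * _]mulrAC mulfVK.
Qed.

End surface_borel.

(** * Simplices *)

Section affine.
Context {R : realType} (n : nat).
Local Notation E := 'rV[R]_n.+1.
Implicit Types (a x y : E) (c : R).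

Definition aff a c x : R := c + \sum_i a ord0 i * x ord0 i.

Lemma aff_line a c x y t : aff a c (x + t *: y) = aff a c x + t * aff a 0 y.
Proof.
rewrite /aff add0r mulr_sumr -addrA -big_split; congr (_ + _).
by apply: eq_bigr => i _; rewrite !mxE/=; ring.
Qed.

Lemma aff_continuous a c : continuous (aff a c).
Proof.
move=> x; apply: (@cvgD _ _ _ (nbhs x) _ (cst c)
  (fun x : E => \sum_i a ord0 i * x ord0 i)); first exact: cvg_cst.
apply: (@cvg_big _ _ +%R _ _ _ _ (nbhs x)) => [|i _]; first by move=> z; exact: add_continuous.
apply: (@cvgM _ _ (nbhs x)); first exact: cvg_cst.
exact: coord_continuous.
Qed.

Lemma open_aff_gt0 a c : open [set x | 0 < aff a c x].
Proof.
have /continuousP/(_ [set r | 0 < r]) := @aff_continuous a c; apply.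
exact: open_gt.
Qed.

Lemma closed_aff_ge0 a c : closed [set x | 0 <= aff a c x].
Proof.
have /continuous_closedP/(_ [set r | 0 <= r]) := @aff_continuous a c; apply.
exact: closed_ge.
Qed.

Lemma lip_aff a c x y L : (forall i, `|a ord0 i| <= L) ->
  `|aff a c x - aff a c y| <= L * \sum_i `|x ord0 i - y ord0 i|.
Proof.
move=> aL; rewrite /aff opprD addrACA subrr add0r -sumrB.
apply: le_trans (ler_norm_sum _ _ _) _; rewrite mulr_sumr; apply: ler_sum => i _.
by rewrite -mulrBr normrM ler_wpM2r.
Qed.

(* The translates of the hyperplane along a coordinate axis are disjoint. *)
Lemma aff_null a c x0 : aff a c x0 != 0 ->
  lebesgue_rV n.+1 [set x | aff a c x = 0] = 0%E.
Proof.
move=> ax0; have [a0|/existsNP[j /eqP aj]] := pselect (forall j, a ord0 j = 0).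
  rewrite (_ : [set x | _] = set0) ?measure0// -subset0 => x /= axx.
  move/eqP : ax0; apply; rewrite -axx /aff; congr (_ + _).
  by apply: eq_bigr => i _; rewrite a0 !mul0r.
set P := [set x | _].
have mP : measurable P.
  apply: closed_rV_measurable.
  have /continuous_closedP/(_ [set 0]) := @aff_continuous a c; apply.
  exact: closed_eq.
pose bx (k : nat) : set E := box (const_mx (- k%:R)) (const_mx k%:R).
have S0 k : lebesgue_rV n.+1 (P `&` bx k) = 0%E.
  have mS : measurable (P `&` bx k) by apply: measurableI => //; exact: measurable_box.
  (* Infinitely many translates of a bounded piece, all inside the next larger box. *)
  pose A m : set E := translate (m.+1%:R^-1 *: 'e_j) @^-1` (P `&` bx k).
  have mA m : measurable (A m).
    by rewrite -[X in measurable X]setTI; exact: measurable_translate.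
  have Abx m : A m `<=` bx k.+1.
    move=> x [_ /= h] i; have := h i; rewrite /translate !mxE eqxx/=.
    have z0 : 0 <= m.+1%:R^-1 * (i == j)%:R :> R by rewrite mulr_ge0.
    have z1 : m.+1%:R^-1 * (i == j)%:R <= 1 :> R.
      case: (i == j); last by rewrite mulr0.
      by rewrite mulr1 invf_le1// ler1n.
    have := @natr1 R k; move: (m.+1%:R^-1 * _) z0 z1 (k.+1%:R : R) => z z0 z1 k1 <-.
    by move=> /andP[h1 h2]; apply/andP; split; lra.
  have tA : trivIset setT A.
    apply/trivIsetP => m m' _ _ mm'; rewrite -subset0 => x [[+ _] [+ _]].
    rewrite /P/= /translate !aff_line => e1 e2.
    have : (m.+1%:R^-1 - m'.+1%:R^-1) * aff a 0 'e_j = 0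
      by apply/eqP; rewrite mulrBl subr_eq0; apply/eqP/(addrI (aff a c x)); rewrite e1 e2.
    move/eqP; rewrite mulf_eq0 => /orP[|].
      rewrite subr_eq0 => /eqP/invr_inj/eqP; rewrite eqr_nat eqSS => mE.
      by rewrite mE in mm'.
    rewrite /aff add0r (bigD1 j)//= mxE !eqxx/= mulr1 big1; last first.
      by move=> i ij; rewrite mxE eqxx (negbTE ij) mulr0.
    by rewrite addr0 => /eqP aj0; rewrite aj0 eqxx in aj.
  set r := lebesgue_rV n.+1 _; set C := lebesgue_rV n.+1 (bx k.+1).
  have rC m : (\sum_(i < m) r <= C)%E.
    have := measure_bigsetU (lebesgue_rV n.+1) mA tA m.
    rewrite (eq_bigr (fun=> r)); last by move=> i _; exact: lebesgue_translate.
    move=> <-.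
    apply: le_measure; rewrite ?inE.
    - exact: bigsetU_measurable.
    - exact: measurable_box.
    - by rewrite -bigcup_mkord => x [m' _]; exact: Abx.
  have Coo : (C < +oo)%E by exact: lebesgue_box_lty.
  have r0 : (0 <= r)%E by exact: measure_ge0.
  have rfin : r \is a fin_num.
    by rewrite ge0_fin_numE//; apply: le_lt_trans Coo; have := rC 1%N; rewrite big_ord1.
  have Cfin : C \is a fin_num by rewrite ge0_fin_numE// measure_ge0.
  move: rC r0; rewrite -(fineK rfin) -(fineK Cfin).
  move: (fine r) (fine C) => r' C' rC.
  rewrite lee_fin le_eqVlt => /predU1P[<-//|r0].
  (* More than [C' / r'] disjoint copies of measure [r'] do not fit into measure [C']. *)
  have := rC (Num.trunc (C' / r')).+1; rewrite sumEFin lee_fin sumr_const card_ord => h.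
  have := truncnS_gt (C' / r'); rewrite ltr_pdivrMr// mulr_natl => h'.
  by move: (lt_le_trans h' h); rewrite ltxx.
apply/(negligibleP _ mP).
have -> : P = \bigcup_k (P `&` bx k).
  by rewrite -setI_bigcupr bigcup_boxes setIT.
apply: negligible_bigcup => k.
by apply/(negligibleP _ (measurableI _ _ mP (measurable_box _ _))); exact: S0.
Qed.

End affine.

(* The piece A that contains the left end a is left for good at the last point
   p of A; the remaining pieces cover ]p, b], hence, being closed, [p, b]. *)
Lemma lip_cover {R : realType} (L : R) (f : R -> R) (s : seq (set R)) (a b : R) :
  0 <= L -> (forall A, A \in s -> closed A) -> a <= b ->
  (forall A x y, A \in s -> A x -> A y -> `|f x - f y| <= L * `|x - y|) ->
  (forall x, a <= x <= b -> exists2 A, A \in s & A x) ->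
  `|f b - f a| <= L * (b - a).
Proof.
move=> L0; have [m] := ubnP (size s); elim: m s a => // m IH s a sm cs ab fL cov.
have [|A As Aa] := cov a; first by rewrite lexx.
pose B := A `&` `[a, b].
have cB : closed B by apply: closedI; [exact: cs|exact: interval_closed].
have Ba : B a by split => //=; rewrite in_itv/= lexx.
have B0 : B !=set0 by exists a.
have ubB : has_ubound B by exists b => x [_] /=; rewrite in_itv/= => /andP[].
pose p := sup B.
have [Ap] : B p by rewrite (closure_id B).1//; exact: closure_sup.
rewrite /= in_itv/= => /andP[ap pb].
have h1 : `|f p - f a| <= L * (p - a).
  by have := fL A p a As Ap Aa; rewrite [`|p - a|]ger0_norm// subr_ge0.
have [pb'|pb'] := eqVneq p b; first by rewrite -pb'.
have {pb}pb : p < b by rewrite lt_neqAle pb'.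
pose s' := rem A s; pose U := \bigcup_(C in [set` s']) C.
have cs' C : C \in s' -> closed C by move=> /mem_rem/cs.
have cU : closed U by apply: closed_bigcup => [|C]; [exact: finite_seq|exact: cs'].
have covU x : p < x <= b -> U x.
  move=> /andP[px xb]; have [|C Cs Cx] := cov x.
    by rewrite xb andbT ltW// (le_lt_trans ap).
  exists C => //=; apply: rem_mem Cs; apply/negP => /eqP CA.
  have : B x by split; [rewrite -CA|rewrite /= in_itv/= xb andbT ltW// (le_lt_trans ap)].
  by move=> /(ub_le_sup ubB); rewrite leNgt => /negP; apply.
have Up : U p.
  rewrite (closure_id U).1// => V /nbhs_ballP[e e0 eV].
  exists (Num.min b (p + e / 2)); split.
    by apply: covU; rewrite lt_min pb ltrDl divr_gt0//= ge_min lexx.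
  apply: eV; rewrite /ball/= distrC ger0_norm ?subr_ge0 ?le_min ?(ltW pb)/=; last first.
    by rewrite lerDl divr_ge0// ltW.
  rewrite ltrBlDr gt_min; apply/orP; right.
  by rewrite addrC ltrD2r ltr_pdivrMr// ltr_pMr// ltr1n.
have h2 : `|f b - f p| <= L * (b - p).
  apply: (IH s') => //; last first.
  - move=> x /andP[px xb]; have [xp|xp] := eqVneq x p.
      by rewrite xp; have [C Cs Cp] := Up; exists C.
    have [|C Cs Cx] := covU x; first by rewrite lt_neqAle eq_sym xp px.
    by exists C.
  - by move=> C x y /mem_rem; exact: fL.
  - exact: ltW.
  - by rewrite size_rem//; move: sm; case: (s) As.
rewrite -(subrKA (f p)); have := ler_normD (f b - f p) (f p - f a).
lra.
Qed.

Section simplex.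
Context {R : realType} (n : nat).
Local Notation E := 'rV[R]_n.+1.
Local Notation simplex := 'M[R]_(n.+2, n.+1).
Implicit Types (T : simplex) (x y : E) (w : 'rV[R]_n.+2).

(* Barycentric coordinates: the matrix of the vertices, bordered by a column of
   ones, is invertible. *)
Lemma barycentric T : Defs.nondegenerate T ->
  exists (G : 'I_n.+2 -> E) (c : 'I_n.+2 -> R),
  [/\ forall x, x = (\row_i aff (G i) (c i) x) *m T,
      forall x, \sum_i aff (G i) (c i) x = 1 &
      forall w, \sum_i w ord0 i = 1 -> forall i, aff (G i) (c i) (w *m T) = w ord0 i].
Proof.
move=> /[dup] fT /row_freeP[B AB].
have BA : B *m row_mx T (const_mx 1 : 'cV_n.+2) = 1%:M.
  have /row_fullP[B' B'A] : row_full (row_mx T (const_mx 1 : 'cV_n.+2)).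
    by rewrite /row_full (eqP fT) addn1.
  by rewrite -[in RHS]B'A -[in RHS](mulmx1 B') -[in RHS]AB mulmxA B'A mul1mx.
pose G i : E := \row_j B (lshift 1 j) i.
pose c i := B (rshift n.+1 ord0) i.
exists G, c; pose lam i := aff (G i) (c i).
have lamE x : \row_i lam i x = row_mx x (const_mx 1) *m B.
  apply/rowP => i; rewrite !mxE /lam /aff big_split_ord/= big_ord1 row_mxEr mxE mul1r addrC.
  congr (_ + _); apply: eq_bigr => j _.
  by rewrite row_mxEl /G mxE mulrC.
have E1 x : (\row_i lam i x) *m row_mx T (const_mx 1 : 'cV_n.+2) = row_mx x (const_mx 1).
  by rewrite lamE -mulmxA BA mulmx1.
split=> [x|x|w w1 i].
- by have := E1 x; rewrite mul_mx_row => /eq_row_mx[-> _].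
- have := E1 x; rewrite mul_mx_row => /eq_row_mx[_ /matrixP/(_ ord0 ord0)].
  by rewrite !mxE => <-; apply: eq_bigr => i _; rewrite !mxE mulr1.
- have : \row_i lam i (w *m T) = w.
    rewrite lamE; have -> : row_mx (w *m T) (const_mx 1) = w *m row_mx T (const_mx 1 : 'cV_n.+2).
      rewrite mul_mx_row; congr row_mx; apply/matrixP => j k; rewrite [LHS]mxE [RHS]mxE -[LHS]w1.
      by apply: eq_bigr => l _; rewrite mxE mulr1 !ord1.
    by rewrite -mulmxA AB mulmx1.
  by move=> /rowP/(_ i); rewrite mxE.
Qed.

Section one_simplex.
Variables (T : simplex) (G : 'I_n.+2 -> E) (c : 'I_n.+2 -> R).
Let lam i := aff (G i) (c i).
Hypotheses (lamT : forall x, x = (\row_i lam i x) *m T)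
  (lam1 : forall x, \sum_i lam i x = 1)
  (lamK : forall w, \sum_i w ord0 i = 1 -> forall i, lam i (w *m T) = w ord0 i).

Lemma hull_baryP x : hull T x <-> forall i, 0 <= lam i x.
Proof.
split=> [[w [w0 _ w1 ->]] i|h]; first by rewrite lamK.
exists (\row_i lam i x); split; [|by move=> i; rewrite inE| |exact: lamT].
  by move=> i; rewrite mxE.
by rewrite -[RHS](lam1 x); apply: eq_bigr => i _; rewrite mxE.
Qed.

Lemma closed_hull_bary : closed (hull T).
Proof.
rewrite (_ : hull T = \bigcap_(i in [set: 'I_n.+2]) [set x | 0 <= lam i x]).
  by apply: closed_bigI => i _; exact: closed_aff_ge0.
by apply/seteqP; split => [x /hull_baryP h i _|x h]; [exact: h|
  apply/hull_baryP => i; exact: h].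
Qed.

Lemma interior_hull_bary x : (forall i, 0 < lam i x) -> (hull T)° x.
Proof.
move=> x0; have : nbhs x [set y | forall i, 0 < lam i y].
  apply: (@filter_forall _ _ (fun i y => 0 < lam i y) (nbhs x) (nbhs_filter x)) => i.
  apply: open_nbhs_nbhs; split; last exact: x0.
  exact: open_aff_gt0.
by apply: (@filterS _ (nbhs x)) => y y0; apply/hull_baryP => i; exact/ltW.
Qed.

Lemma boundary_hull_bary x : hull T x -> ~ (hull T)° x -> exists i, lam i x = 0.
Proof.
move=> /hull_baryP h nh; apply: contrapT => nx; apply: nh.
apply: interior_hull_bary => i; rewrite lt_neqAle h andbT; apply/negP => /eqP e.
by apply: nx; exists i.
Qed.

Lemma interior_hull_bary_neq0 : (hull T)° !=set0.
Proof.
exists ((const_mx n.+2%:R^-1) *m T); apply: interior_hull_bary => i.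
rewrite lamK ?mxE ?invr_gt0//.
under eq_bigr do rewrite mxE.
by rewrite sumr_const card_ord -[LHS]mulr_natr mulVf ?pnatr_eq0.
Qed.

(** The coordinate [lam i] is 1 at the vertex [i], so [aff_null] applies. *)
Lemma face_null i : lebesgue_rV n.+1 [set x | lam i x = 0] = 0%E.
Proof.
apply: (@aff_null _ _ _ _ ((\row_j (j == i)%:R) *m T)).
rewrite -/(lam i _) lamK; first by rewrite mxE eqxx oner_eq0.
rewrite (bigD1 i)//= mxE eqxx big1 ?addr0// => j ji.
by rewrite mxE (negbTE ji).
Qed.

(** The face opposite to the vertex [i] lies in the parallelepiped spanned at its first vertex,
    [lift i ord0], by the [n] edges to its other vertices. *)
Lemma face_surface i : (surface n [set x | hull T x /\ lam i x = 0%R] < +oo)%E.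
Proof.
pose v k : E := row (lift i (lift ord0 k)) T - row (lift i ord0) T.
apply: le_lt_trans (surface_parallelepiped_lty (row (lift i ord0) T) v).
apply: le_outer_measure => x [/hull_baryP x0 xi].
pose t k := lam (lift i (lift ord0 k)) x.
have s1 : lam (lift i ord0) x + \sum_k t k = 1.
  by rewrite -[RHS](lam1 x) (bigD1_ord i)//= xi add0r big_ord_recl.
exists t => [k|].
  rewrite x0/= -s1 (bigD1 k)//= addrCA lerDl addr_ge0// sumr_ge0// => j _.
  exact: x0.
rewrite [LHS]lamT mulmx_sum_row (bigD1_ord i)//= mxE xi scale0r add0r.
rewrite big_ord_recl mxE.
rewrite (eq_bigr (fun k => t k *: row (lift i (lift ord0 k)) T)); last first.
  by move=> k _; rewrite mxE.
under [in RHS]eq_bigr do rewrite /v scalerBr.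
rewrite sumrB -scaler_suml addrCA addrC; congr (_ + _).
by rewrite -[X in X - _]scale1r -scalerBl -s1 addrK.
Qed.

End one_simplex.
End simplex.

Lemma bigcup_seq_cons {T : Type} (I : eqType) (i : I) (s : seq I) (F : I -> set T) :
  \bigcup_(j in [set` i :: s]) F j = F i `|` \bigcup_(j in [set` s]) F j.
Proof.
apply/seteqP; split => x.
  by move=> [j /= + Fj]; rewrite inE => /predU1P[<-|js]; [left|right; exists j].
move=> [Fi|[j js Fj]]; first by exists i => //=; rewrite inE eqxx.
by exists j => //=; rewrite inE [j \in s]js orbT.
Qed.

Lemma outer_measure_bigcup_lty {R : realType} {T : Type} (I : eqType) (s : seq I)
  (mu : {outer_measure set T -> \bar R}) (F : I -> set T) :
  (forall i, i \in s -> mu (F i) < +oo)%E ->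
  (mu (\bigcup_(i in [set` s]) F i) < +oo)%E.
Proof.
elim: s => [|i s IH] Fs; first by rewrite set_nil bigcup_set0 outer_measure0.
rewrite bigcup_seq_cons; apply: le_lt_trans (outer_measureU2 _ _ _) _.
rewrite lte_add_pinfty// ?Fs ?inE ?eqxx// IH// => j js.
by rewrite Fs// inE js orbT.
Qed.

Lemma negligible_bigcup_seq d (T : measurableType d) {R : realType}
  (mu : {measure set T -> \bar R}) (I : eqType) (s : seq I) (F : I -> set T) :
  (forall i, i \in s -> mu.-negligible (F i)) ->
  mu.-negligible (\bigcup_(i in [set` s]) F i).
Proof.
elim: s => [|i s IH] Fs; first by rewrite set_nil bigcup_set0; exact: negligible_set0.
rewrite bigcup_seq_cons; apply: negligibleU; first by apply: Fs; rewrite inE eqxx.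
by apply: IH => j js; apply: Fs; rewrite inE js orbT.
Qed.

Section hull.
Context {R : realType} (n : nat).
Local Notation simplex := 'M[R]_(n.+2, n.+1).
Variables (T : simplex) (ndT : Defs.nondegenerate T).

Definition hull_boundary : set 'rV[R]_n.+1 := hull T `\` (hull T)°.

Lemma closed_hull : closed (hull T).
Proof.
by have [G [c [lamT lam1 lamK]]] := barycentric ndT; exact: closed_hull_bary lamT lam1 lamK.
Qed.

Lemma interior_hull_neq0 : (hull T)° !=set0.
Proof.
by have [G [c [lamT lam1 lamK]]] := barycentric ndT; exact: interior_hull_bary_neq0 lamT lam1 lamK.
Qed.

Lemma hull_boundary_negligible : (lebesgue_rV n.+1).-negligible hull_boundary.
Proof.
have [G [c [lamT lam1 lamK]]] := barycentric ndT.
have mP i : measurable [set x | aff (G i) (c i) x = 0].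
  apply: closed_rV_measurable.
  have /continuous_closedP/(_ [set 0]) := @aff_continuous _ _ (G i) (c i); apply.
  exact: closed_eq.
apply: negligibleS (_ : _ `<=` \bigcup_(i in [set` enum 'I_n.+2])
    [set x | aff (G i) (c i) x = 0]) _.
  move=> x [Tx /(boundary_hull_bary lamT lam1 lamK Tx)[i xi]]; exists i => //=.
  by rewrite mem_enum.
apply: negligible_bigcup_seq => i _; apply/negligibleP; first exact: mP.
exact: face_null lamK i.
Qed.

Lemma hull_boundary_surface : (surface n hull_boundary < +oo)%E.
Proof.
have [G [c [lamT lam1 lamK]]] := barycentric ndT.
apply: le_lt_trans (_ : (surface n (\bigcup_(i in [set` enum 'I_n.+2])
    [set x | hull T x /\ aff (G i) (c i) x = 0%R]) < +oo)%E).
  apply: (@le_outer_measure _ _ (surface_outer n)).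
  move=> x [Tx /(boundary_hull_bary lamT lam1 lamK Tx)[i xi]]; exists i => //=.
  by rewrite mem_enum.
by apply: (@outer_measure_bigcup_lty _ _ _ _ (surface_outer n)) => i _;
  exact: face_surface lamT lam1 lamK _.
Qed.

End hull.

(** * Geometry of the triangulated domain and of V_h *)

Section domain.
Context {R : realType} (n : nat).
Local Notation E := 'rV[R]_n.+1.
Variables (Omega : set E) (tau : seq 'M[R]_(n.+2, n.+1)).
Hypotheses (HOmega : bounded_polygonal_domain Omega) (Htau : triangulation Omega tau).

Let oO : open Omega. Proof. by case: HOmega. Qed.
Let ndtau T : T \in tau -> Defs.nondegenerate T.
Proof. by case: Htau => /allP + _ _; exact. Qed.
Let clO : closure Omega = \bigcup_(T in [set` tau]) hull T.
Proof. by case: Htau. Qed.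

(** Polygonality makes [Omega] the interior of a closed set, hence regular open; domains with slits
    are excluded. *)
Lemma interior_closure_domain : (closure Omega)° `<=` Omega.
Proof.
have [_ _ _ _ [s [/allP nds OE]]] := HOmega.
rewrite [X in _ `<=` X]OE; apply: interiorS.
have cs : closed (\bigcup_(T in [set` s]) hull T).
  apply: closed_bigcup; first exact: finite_seq.
  by move=> T /nds; exact: closed_hull.
rewrite [X in _ `<=` X]((closure_id _).1 cs); apply: closureS.
by rewrite OE; exact: interior_subset.
Qed.

(** A point interior to a simplex is interior to the closure of [Omega], hence belongs to
    [Omega]. *)
Lemma domain_boundary : closure Omega `\` Omega `<=`
  \bigcup_(T in [set` tau]) hull_boundary T.
Proof.
move=> x [cx nOx]; have := cx; rewrite clO => -[T Ttau Tx].
exists T => //; split => // iTx; apply/nOx/interior_closure_domain.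
apply: interiorS iTx; rewrite clO => y Ty; by exists T.
Qed.

Lemma domain_boundary_surface (G : set E) : G `<=` closure Omega `\` Omega ->
  (surface n G < +oo)%E.
Proof.
move=> GO; apply: le_lt_trans (_ : (surface n
    (\bigcup_(T in [set` tau]) hull_boundary T) < +oo)%E).
  by apply: (@le_outer_measure _ _ (surface_outer n)) => x /GO/domain_boundary.
apply: (@outer_measure_bigcup_lty _ _ _ _ (surface_outer n)) => T /ndtau.
exact: hull_boundary_surface.
Qed.

Lemma domain_interiors_ae : (lebesgue_rV n.+1).-negligible
  (Omega `\` \bigcup_(T in [set` tau]) (hull T)°).
Proof.
apply: negligibleS (_ : _ `<=` \bigcup_(T in [set` tau]) hull_boundary T) _.
  move=> x [Ox nx]; have : closure Omega x by exact: subset_closure.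
  rewrite clO => -[T Ttau Tx]; exists T => //; split => // iTx; apply: nx.
  by exists T.
by apply: negligible_bigcup_seq => T /ndtau; exact: hull_boundary_negligible.
Qed.

Lemma measurable_domain : measurable Omega.
Proof. exact: open_rV_measurable. Qed.

Lemma lebesgue_domain_lty : (lebesgue_rV n.+1 Omega < +oo)%E.
Proof.
by apply: lebesgue_bounded_lty; [case: HOmega|exact: measurable_domain].
Qed.

Lemma interior_hull_domain T : T \in tau -> ((hull T)° `&` Omega) !=set0.
Proof.
move=> Ttau; have [x iTx] := interior_hull_neq0 (ndtau Ttau).
have : closure Omega x by rewrite clO; exists T => //; exact: interior_subset.
move=> /(_ (hull T)°)[|y [Oy Ty]]; last by exists y.
by apply: open_nbhs_nbhs; split => //; exact: open_interior.
Qed.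

Lemma domain_boundary_closure (Gamma1 Gamma2 : set E) :
  closure Omega `\` Omega° = Gamma1 `|` Gamma2 ->
  Gamma1 `<=` closure Omega `\` Omega /\ Gamma2 `<=` closure Omega `\` Omega.
Proof.
by rewrite (interior_id _).1// => ->; split => x; [left|right].
Qed.

Local Notation V := (Vh Omega tau).

Lemma Vh_subspace : linear_subspace V.
Proof.
split.
  split; first exact: cst_continuous.
  by move=> T Ttau; exists 0, 0 => x _; rewrite big1 ?addr0// => i _; rewrite mxE mul0r.
move=> k u v [cu au] [cv av]; split.
  move=> x; exact: (cvgD (cvgM (cvg_cst k) (cu x)) (cv x)).
move=> T Ttau; have [a [c uE]] := au _ Ttau; have [a' [c' vE]] := av _ Ttau.
exists (k *: a + a'), (k * c + c') => x Tx.
transitivity (k * u x + v x) => //; rewrite uE// vE// mulrDr mulr_sumr addrACA.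
rewrite -big_split/=; congr (_ + _); apply: eq_bigr => i _.
by rewrite !mxE/=; ring.
Qed.

Lemma cst_Vh c : V (cst c).
Proof.
split; first exact: cst_continuous.
by move=> T Ttau; exists 0, c => x _; rewrite big1 ?addr0// => i _; rewrite mxE mul0r.
Qed.

(** On [T], [v] is the mean of its vertex values weighted by the barycentric coordinates, which are
    at most 1. *)
Lemma Vh_le_nodes v T x : V v -> T \in tau -> hull T x ->
  `|v x| <= \sum_i `|v (row i T)|.
Proof.
move=> [_ av] Ttau Tx; have [a [c vE]] := av _ Ttau.
have [G [c0 [lamT lam1 lamK]]] := barycentric (ndtau Ttau).
have Trow i : hull T (row i T).
  rewrite rowE; apply/(hull_baryP lamT lam1 lamK) => j; rewrite lamK ?mxE//.
  by rewrite (bigD1 i)//= mxE !eqxx big1 ?addr0// => k ki; rewrite mxE (negbTE ki) andbF.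
have /(hull_baryP lamT lam1 lamK) x0 := Tx.
have -> : v x = \sum_i aff (G i) (c0 i) x * v (row i T).
  rewrite vE//; under [RHS]eq_bigr do rewrite vE// mulrDr.
  rewrite big_split/= -mulr_suml lam1 mul1r; congr (_ + _).
  under [RHS]eq_bigr do rewrite mulr_sumr.
  rewrite exchange_big/=; apply: eq_bigr => j _.
  rewrite [in LHS](lamT x) mxE mulr_sumr; apply: eq_bigr => i _.
  by rewrite !mxE; ring.
apply: le_trans (ler_norm_sum _ _ _) _; apply: ler_sum => i _.
rewrite normrM ger0_norm// ler_piMl//.
by rewrite -(lam1 x) (bigD1 i)//= lerDl sumr_ge0.
Qed.

Definition nodes : seq E := [seq row i T | T <- tau, i <- enum 'I_n.+2].

(** The nodal values are the functionals that make V_h finite-dimensional in the sense of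
    [gram_schmidt]. *)
Lemma Vh_eq0 v : V v -> (forall i : 'I_(size nodes), v nodes`_i = 0) ->
  forall x, closure Omega x -> v x = 0.
Proof.
move=> Vv v0 x; rewrite clO => -[T Ttau Tx].
have := Vh_le_nodes Vv Ttau Tx; rewrite big1 ?normr_le0 => [/eqP//|i _].
have : row i T \in nodes by apply/allpairsP; exists (T, i); rewrite mem_enum.
by move=> /(nthP 0)[k ks <-]; rewrite (v0 (Ordinal ks)) normr0.
Qed.

Lemma Vh_bounded v : V v -> exists M, forall x, closure Omega x -> `|v x| <= M.
Proof.
move=> Vv; exists (\sum_(T <- tau) \sum_i `|v (row i T)|) => x.
rewrite clO => -[T Ttau Tx]; apply: le_trans (Vh_le_nodes Vv Ttau Tx) _.
rewrite (big_rem T)//= lerDl; apply: sumr_ge0 => S _; exact: sumr_ge0.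
Qed.

Lemma Vh_slopes v : V v -> exists (a : 'M[R]_(n.+2, n.+1) -> E) (c : 'M[R]_(n.+2, n.+1) -> R),
  forall T, T \in tau -> forall x, hull T x -> v x = aff (a T) (c T) x.
Proof.
move=> [_ av].
have /choice[p pP] T : exists p : E * R, T \in tau -> forall x, hull T x -> v x = aff p.1 p.2 x.
  have [Ttau|/negP nT] := boolP (T \in tau); last by exists (0, 0).
  by have [a [c vE]] := av _ Ttau; exists (a, c).
by exists (fst \o p), (snd \o p) => T Ttau x Tx; exact: pP.
Qed.

(** Along a segment in the closure, [v] is affine on the closed set of parameters cut out by each
    simplex, and [lip_cover] glues these pieces. *)
Lemma Vh_lip v a c (L : R) : V v ->
  (forall T, T \in tau -> forall x, hull T x -> v x = aff (a T) (c T) x) ->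
  0 <= L -> (forall T i, T \in tau -> `|a T ord0 i| <= L) ->
  forall x y : E, (forall t : R, 0 <= t <= 1 -> closure Omega (x + t *: y)) ->
  `|v (x + y) - v x| <= L * \sum_i `|y ord0 i|.
Proof.
move=> Vv vE L0 aL x y seg.
pose f (t : R) := v (x + t *: y).
pose s := [seq [set t : R | hull T (x + t *: y)] | T <- tau].
have S0 : 0 <= \sum_i `|y ord0 i| by exact: sumr_ge0.
have := @lip_cover R (L * \sum_i `|y ord0 i|) f s 0 1.
rewrite /f scale1r scale0r addr0 subr0 mulr1; apply => //.
- by rewrite mulr_ge0.
- move=> _ /mapP[T Ttau ->].
  have [G [c0 [lamT lam1 lamK]]] := barycentric (ndtau Ttau).
  rewrite (_ : [set t | _] = \bigcap_(i in [set: 'I_n.+2])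
      [set t | 0 <= aff (G i) (c0 i) x + t * aff (G i) 0 y]); last first.
    apply/seteqP; split => t.
      by move=> /(hull_baryP lamT lam1 lamK) h i _ /=; rewrite -aff_line.
    move=> h; apply/(hull_baryP lamT lam1 lamK) => i; rewrite aff_line; exact: h.
  apply: closed_bigI => i _.
  have /continuous_closedP/(_ [set r | 0 <= r]) :
      continuous (fun t : R => aff (G i) (c0 i) x + t * aff (G i) 0 y).
    move=> t; apply: cvgD; first exact: cvg_cst.
    by apply: cvgM; [exact: cvg_id|exact: cvg_cst].
  by apply; exact: closed_ge.
- move=> _ t t' /mapP[T Ttau ->] /= Tt Tt'.
  rewrite (vE _ Ttau _ Tt) (vE _ Ttau _ Tt') !aff_line opprD addrACA subrr add0r.
  rewrite -mulrBl normrM mulrC ler_wpM2r//.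
  have := @lip_aff R n (a T) 0 y 0 L (fun i => aL T i Ttau).
  rewrite {2}/aff add0r big1 ?subr0; last by move=> i _; rewrite mxE mulr0.
  have -> // : \sum_i `|y ord0 i - (0 : E) ord0 i| = \sum_i `|y ord0 i|.
  by apply: eq_bigr => i _; rewrite mxE subr0.
- move=> t /seg; rewrite clO => -[T Ttau Tx].
  by exists [set t | hull T (x + t *: y)] => //; apply/mapP; exists T.
Qed.

(** [Vh_lip] with constant 0 makes [v] locally constant, hence constant on the connected set
    [Omega]; each simplex meets [Omega] and carries the value to the closure. *)
Lemma Vh_const v a c : V v ->
  (forall T, T \in tau -> forall x, hull T x -> v x = aff (a T) (c T) x) ->
  (forall T i, T \in tau -> a T ord0 i = 0) ->
  forall x y, closure Omega x -> closure Omega y -> v x = v y.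
Proof.
move=> Vv vE a0.
have [[x0 Ox0] _ cO _ _] := HOmega.
have loc (x : E) : Omega x -> exists2 e, 0 < e &
    forall y : E, (forall i, `|x ord0 i - y ord0 i| < e) -> Omega y /\ v y = v x.
  move=> /((open_rVP Omega).1 oO)[e e0 eO]; exists e => // y xy; split; first exact: eO.
  apply/eqP; rewrite -subr_eq0 -normr_le0 -[y in v y](subrK x) [y - x + x]addrC.
  rewrite -(mul0r (\sum_i `|(y - x) ord0 i|)).
  apply: (@Vh_lip v a c 0 Vv vE (lexx _)) => [T i Ttau|t /andP[t0 t1]].
    by rewrite a0// normr0.
  apply: subset_closure; apply: eO => i; rewrite !mxE opprD addrA subrr sub0r normrN.
  rewrite normrM ger0_norm//; apply: le_lt_trans (xy i).
  by rewrite distrC ler_piMl.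
have cst0 : Omega `<=` [set x | v x = v x0].
  suff <- : [set x | Omega x /\ v x = v x0] = Omega by move=> x [].
  apply: cO; first by exists x0.
    exists [set x | Omega x /\ v x = v x0]; last first.
      by apply/seteqP; split => x /=; [move=> [? ?]|move=> [? []]].
    apply/open_rVP => x [Ox vx]; have [e e0 eP] := loc _ Ox; exists e => // y /eP[Oy vy].
    by split => //; rewrite vy.
  exists (~` [set x | Omega x /\ v x <> v x0]).
    apply: open_closedC.
    apply/open_rVP => x [Ox vx]; have [e e0 eP] := loc _ Ox; exists e => // y /eP[Oy vy].
    by split => //; rewrite vy.
  apply/seteqP; split => x /=; first by move=> [Ox vx]; split => // -[_]; exact.
  by move=> [Ox nx]; split => //; apply: contrapT => vx; exact: nx.
suff cl x : closure Omega x -> v x = v x0 by move=> x y /cl -> /cl ->.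
rewrite clO => -[T Ttau Tx].
have [z [iTz Oz]] := interior_hull_domain Ttau.
rewrite -(cst0 _ Oz) (vE _ Ttau _ Tx) (vE _ Ttau _ (interior_subset iTz)) /aff.
by congr (_ + _); apply: eq_bigr => i _; rewrite a0// !mul0r.
Qed.

End domain.

(** * Test functions *)

(** Gives access to one-variable calculus, the mean value theorem in particular, for directional
    derivatives. *)
Lemma is_derive_lineP {R : numFieldType} {V W : normedModType R} (f : V -> W)
    (x v : V) (t : R) (l : W) :
  is_derive t (1 : R) (fun t : R => f (t *: v + x)) l <-> is_derive (t *: v + x) v f l.
Proof.
suff E : (fun h : R => h^-1 *: (((fun t : R => f (t *: v + x)) \o shift t) (h *: (1 : R)) -
    f (t *: v + x))) =
    (fun h : R => h^-1 *: ((f \o shift (t *: v + x)) (h *: v) - f (t *: v + x))).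
  by split=> -[d1 d2]; split; move: d1 d2; rewrite /derivable /derive E.
apply/funext => h /=; congr (_ *: (f _ - _)).
by rewrite scalerDl addrA -scalerA scale1r.
Qed.

Section C1.
Context {R : realType} (n : nat).
Local Notation E := 'rV[R]_n.+1.
Implicit Types (f g : E -> R).

Lemma C1P f (df : 'I_n.+1 -> E -> R) : continuous f ->
  (forall i x, is_derive x ('e_i : E) f (df i x)) ->
  (forall i, continuous (df i)) -> C1 f.
Proof.
move=> cf fd cd; split=> // i; split=> [x|]; first by have [] := fd i x.
by rewrite (_ : partial i f = df i)//; apply/funext => x; have [_] := fd i x.
Qed.

Lemma C1_is_derive f i x : C1 f -> is_derive x ('e_i : E) f (partial i f x).
Proof. by move=> [_ /(_ i)[/(_ x) h _]]; split. Qed.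

Lemma C1_cst (c : R) : C1 (cst c : E -> R).
Proof.
by apply: (@C1P _ (fun _ => cst 0)) => [|i]; exact: cst_continuous.
Qed.

Lemma C1_add f g : C1 f -> C1 g -> C1 (fun x => f x + g x).
Proof.
move=> Cf Cg; have [cf f1] := Cf; have [cg g1] := Cg.
apply: (@C1P _ (fun i x => partial i f x + partial i g x)) => [x|i x|i x].
- exact: (cvgD (cf x) (cg x)).
- exact: (is_deriveD (C1_is_derive i x Cf) (C1_is_derive i x Cg)).
- by have [_ h] := f1 i; have [_ h'] := g1 i; exact: (cvgD (h x) (h' x)).
Qed.

Lemma C1_mul f g : C1 f -> C1 g -> C1 (fun x => f x * g x).
Proof.
move=> Cf Cg; have [cf f1] := Cf; have [cg g1] := Cg.
apply: (@C1P _ (fun i x => f x *: partial i g x + g x *: partial i f x)) => [x|i x|i x].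
- exact: (cvgM (cf x) (cg x)).
- exact: (is_deriveM (C1_is_derive i x Cf) (C1_is_derive i x Cg)).
- have [_ h] := f1 i; have [_ h'] := g1 i.
  exact: (cvgD (cvgM (cf x) (h' x)) (cvgM (cg x) (h x))).
Qed.

Lemma C1_inv f : (forall x, f x != 0) -> C1 f -> C1 (fun x => (f x)^-1).
Proof.
move=> f0 Cf; have [cf f1] := Cf.
apply: (@C1P _ (fun i x => - f x ^- 2 *: partial i f x)) => [x|i x|i x].
- exact: (cvgV (f0 x) (cf x)).
- by split; [apply: derivableV|rewrite deriveV//]; have [] := f1 i.
- have [_ h] := f1 i.
  apply: cvgM (h x); apply: cvgN; apply: cvgV; first by rewrite sqrf_eq0 f0.
  exact: (cvgM (cf x) (cf x)).
Qed.

Lemma C1_prod (I : Type) (s : seq I) (F : I -> E -> R) :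
  (forall i, C1 (F i)) -> C1 (fun x => \prod_(i <- s) F i x).
Proof.
move=> CF; elim: s => [|i s IH].
  by under eq_fun do rewrite big_nil; exact: C1_cst.
by under eq_fun do rewrite big_cons; exact: C1_mul.
Qed.

Lemma C1_coord (k dk : R -> R) j : (forall t : R, is_derive t 1 k (dk t)) ->
  continuous dk -> C1 (fun x : E => k (x ord0 j)).
Proof.
move=> kd cdk.
have ck : continuous k.
  move=> t; apply: differentiable_continuous; apply/derivable1_diffP.
  by have [] := kd t.
have cc := @coord_continuous R 1 n.+1 ord0 j.
apply: (@C1P _ (fun i x => if i == j then dk (x ord0 j) else 0)) => [x|i x|i x].
- exact: (continuous_comp (cc x) (ck _)).
- rewrite -[x]add0r -[0 + x]/(_ + _) -(scale0r ('e_i : E)).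
  apply/is_derive_lineP; case: eqVneq => [->|ij].
    rewrite (_ : (fun t => _) = fun t : R => k (t *: (1 : R) + x ord0 j)).
      apply/is_derive_lineP; rewrite !mxE !eqxx/= mulr1.
      by rewrite (_ : 0 *: 1 + _ = 0 + x ord0 j)// scale0r.
    by apply/funext => t; rewrite !mxE !eqxx/=.
  rewrite (_ : (fun t => _) = cst (k (x ord0 j))); first exact: is_derive_cst.
  by apply/funext => t; rewrite !mxE eqxx [_ == i]eq_sym (negbTE ij)/= mulr0 add0r.
- case: (i == j); last exact: (@cst_continuous E R 0 x).
  exact: (continuous_comp (cc x) (cdk _)).
Qed.

(** Used for the squared positive part, whose derivative at the kink is obtained like the others
    from a quadratic error bound. *)
Lemma is_derive_quadratic (f : R -> R) (x l C : R) :
  (forall y, `|f y - f x - l * (y - x)| <= C * (y - x) ^+ 2) -> is_derive x 1 f l.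
Proof.
move=> fq; have C0 : 0 <= C.
  have := fq (x + 1); rewrite (_ : x + 1 - x = 1); last by ring.
  by rewrite expr1n !mulr1; exact: le_trans (normr_ge0 _).
suff cv : (fun h : R => h^-1 *: ((f \o shift x) (h *: (1 : R)) - f x)) @ 0^' --> l.
  by split; [apply/cvg_ex; exists l|apply/cvg_lim].
apply/cvgrPdist_le => e e0; near=> h.
have h0 : h != 0 by near: h; exact: nbhs_dnbhs_neq.
have -> : l - h^-1 *: ((f \o shift x) (h *: (1 : R)) - f x) =
    - (h^-1 * (f (h + x) - f x - l * (h + x - x))).
  by rewrite /= [h *: _]mulr1 addrK; rewrite /GRing.scale/=; field.
rewrite normrN normrM normfV ler_pdivrMl ?normr_gt0//.
apply: le_trans (fq _) _; rewrite addrK -real_normK ?num_real// expr2 mulrCA.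
rewrite ler_wpM2l//.
have : `|h| <= e / (C + 1) by near: h; apply: dnbhs0_le; rewrite divr_gt0// ltr_wpDl.
move=> /(ler_wpM2l C0)/le_trans; apply.
by rewrite mulrCA ler_piMr ?(ltW e0)// ler_pdivrMr ?ltr_wpDl// mul1r lerDl.
Unshelve. all: by end_near. Qed.

(** The square smooths the positive part into a function of class C^1. *)
Definition bump (a b t : R) := Num.max 0 ((t - a) * (b - t)) ^+ 2.

Lemma C1_bump a b j : C1 (fun x : E => bump a b (x ord0 j)).
Proof.
apply: (@C1_coord _ (fun t => 2 * Num.max 0 ((t - a) * (b - t)) * (a + b - 2 * t))).
  move=> t.
  apply: (@is_derive1_comp _ (fun y => Num.max 0 y ^+ 2) (fun t => (t - a) * (b - t))).
    apply: (@is_derive_quadratic _ _ _ 1) => y.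
    rewrite mul1r ler_norml; set y0 := (t - a) * (b - t).
    have sq := sqr_ge0 (y - y0).
    case: (leP 0 y) => hy; case: (leP 0 y0) => hy0; rewrite ?expr0n/= ?mulr0 ?mul0r.
    - by apply/andP; split; nra.
    - have : 0 <= y * - y0 by rewrite mulr_ge0// oppr_ge0 ltW.
      by have := sqr_ge0 y; have := sqr_ge0 y0 => *; apply/andP; split; nra.
    - have : 0 <= - y * y0 by rewrite mulr_ge0// oppr_ge0 ltW.
      by have := sqr_ge0 y; have := sqr_ge0 y0 => *; apply/andP; split; nra.
    - by apply/andP; split; lra.
  apply: (@is_derive_quadratic _ _ _ 1) => y.
  rewrite (_ : _ - _ = - (y - t) ^+ 2); last by ring.
  by rewrite normrN ger0_norm ?sqr_ge0// mul1r.
have cq : continuous (fun t : R => (t - a) * (b - t)).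
  move=> t; apply: cvgM; apply: cvgB; by [exact: cvg_id|exact: cvg_cst].
move=> t; apply: cvgM.
  apply: cvgM; first exact: cvg_cst.
  under eq_fun do rewrite maxr_absE add0r sub0r normrN.
  rewrite maxr_absE add0r sub0r normrN.
  apply: cvgM; last exact: cvg_cst.
  by apply: cvgD; [exact: cq|apply: cvg_norm; exact: cq].
by apply: cvgB; [exact: cvg_cst|apply: cvgM; [exact: cvg_cst|exact: cvg_id]].
Qed.

Lemma bump_ge0 a b t : 0 <= bump a b t.
Proof. exact: sqr_ge0. Qed.

Lemma bump_gt0 a b t : a < b -> (0 < bump a b t) = (a < t < b).
Proof.
move=> ab; rewrite /bump exprn_even_gt0//=; apply/idP/idP => [|/andP[h1 h2]].
  case: (leP 0 ((t - a) * (b - t))) => h; last by rewrite eqxx.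
  rewrite mulf_eq0 negb_or => /andP[h1 h2].
  have h3 : t != a by rewrite -subr_eq0.
  have h4 : b != t by rewrite -subr_eq0.
  have : ~ t < a by move=> h5; nra.
  have : ~ b < t by move=> h5; nra.
  by move=> /negP h5 /negP h6; rewrite !lt_neqAle (eq_sym a) h3 (eq_sym t) h4 !leNgt h5 h6.
by rewrite gt_eqF// lt_max mulr_gt0 ?orbT// subr_gt0.
Qed.

(** With [g] the product of the bumps, this is g / (g + 1 / (k + 1)), which tends to the indicator
    function of the box while staying of class C^1 and between 0 and 1. *)
Definition box_approx (a b : E) (k : nat) (x : E) : R :=
  (\prod_i bump (a ord0 i) (b ord0 i) (x ord0 i)) *
  (\prod_i bump (a ord0 i) (b ord0 i) (x ord0 i) + k.+1%:R^-1)^-1.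

Section box_approx.
Variables (a b : E).
Hypothesis ab : forall i, a ord0 i < b ord0 i.
Let g (x : E) : R := \prod_i bump (a ord0 i) (b ord0 i) (x ord0 i).


Let g_ge0 x : 0 <= g x. Proof. by apply: prodr_ge0 => i _; exact: bump_ge0. Qed.

Let g_gt0 x : box a b x -> 0 < g x.
Proof. by move=> abx; apply: prodr_gt0 => i _; rewrite bump_gt0. Qed.

Let g_eq0 x : ~ box a b x -> g x = 0.
Proof.
move=> /existsNP[i /negP nx]; rewrite /g (bigD1 i)//=.
have := bump_ge0 (a ord0 i) (b ord0 i) (x ord0 i).
rewrite le_eqVlt bump_gt0// (negbTE nx) orbF => /eqP <-.
by rewrite mul0r.
Qed.

Let gk_gt0 k x : 0 < g x + k.+1%:R^-1.
Proof. by rewrite ltr_wpDl// invr_gt0. Qed.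

Lemma box_approx_ge0 k x : 0 <= box_approx a b k x.
Proof. by rewrite /box_approx -/(g x) divr_ge0// ltW. Qed.

Lemma box_approx_le1 k x : box_approx a b k x <= 1.
Proof. by rewrite /box_approx -/(g x) ler_pdivrMr// mul1r lerDl invr_ge0. Qed.

Lemma box_approx_out k x : ~ box a b x -> box_approx a b k x = 0.
Proof. by move=> /g_eq0; rewrite /box_approx -/(g x) => ->; rewrite mul0r. Qed.

Lemma box_approx_cvg x : box a b x -> box_approx a b k x @[k --> \oo] --> (1 : R).
Proof.
move=> /g_gt0 g0; rewrite /box_approx -/(g x).
rewrite -[X in _ --> X](@mulfV _ (g x)) ?gt_eqF//.
apply: cvgM; first exact: cvg_cst.
apply: cvgV; first by rewrite gt_eqF.
rewrite -[X in _ --> X]addr0; apply: cvgD; first exact: cvg_cst.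
exact: cvg_harmonic.
Qed.

Lemma C1_box_approx k : C1 (box_approx a b k).
Proof.
have Cg : C1 g by apply: C1_prod => i; exact: C1_bump.
apply: C1_mul => //; apply: C1_inv => [x|]; first exact: lt0r_neq0 (gk_gt0 k x).
by apply: C1_add => //; exact: C1_cst.
Qed.

Lemma test_box_approx Omega k : cbox a b `<=` Omega ->
  test_function Omega (box_approx a b k).
Proof.
move=> abO; split; first exact: C1_box_approx.
exists (cbox a b); split => //; last first.
  by move=> x nx; apply: box_approx_out => /sub_box_cbox.
apply: bounded_closed_compact.
  exists (\sum_i (`|a ord0 i| + `|b ord0 i|)); split; first exact: num_real.
  move=> M sM x abx; apply: le_trans (ltW sM).
  rewrite [leLHS]mx_normrE; apply: bigmax_le => [|[i j] _ /=].
    by apply: sumr_ge0 => i _; rewrite addr_ge0.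
  rewrite ord1 (bigD1 j)//=; apply: ler_wpDr.
    by apply: sumr_ge0 => l _; rewrite addr_ge0.
  have /andP[h1 h2] := abx j; rewrite ler_norml.
  have := ler_norm (- a ord0 j); have := ler_norm (b ord0 j); rewrite normrN.
  have := normr_ge0 (a ord0 j); have := normr_ge0 (b ord0 j).
  by move=> *; apply/andP; split; lra.
rewrite (_ : cbox a b = \bigcap_(i in [set: 'I_n.+1])
    (fun x : E => x ord0 i) @^-1` `[a ord0 i, b ord0 i]); last first.
  by apply/seteqP; split => x h i; [move=> _|]; have := h i; rewrite /= in_itv/=; exact.
apply: closed_bigI => i _.
have /continuous_closedP/(_ `[a ord0 i, b ord0 i]%classic) :=
  @coord_continuous R 1 n.+1 ord0 i.
by apply; exact: interval_closed.
Qed.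

End box_approx.
End C1.

(** * The lemma of du Bois-Reymond *)

Section dubois_reymond.
Context {R : realType} (n : nat).
Local Notation E := 'rV[R]_n.+1.
Local Notation leb := (lebesgue_rV n.+1).
Variables (Omega : set E) (f : E -> R).
Hypotheses (oO : open Omega) (fi : leb.-integrable Omega (EFin \o f)).
Hypothesis f0 : forall phi, test_function Omega phi -> L2dot leb Omega f phi = 0.

Let mO : measurable Omega. Proof. exact: open_rV_measurable. Qed.
Let mf : measurable_fun Omega f.
Proof. by apply/measurable_EFinP; exact: measurable_int fi. Qed.

(** Dominated convergence along the test functions [box_approx]. *)
Let box_int0 a b : cbox a b `<=` Omega -> (\int[leb]_(x in box a b) (f x)%:E = 0)%E.
Proof.
move=> abO.
have [ab|nab] := pselect (forall i, a ord0 i < b ord0 i); last first.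
  rewrite (_ : box a b = set0) ?integral_set0// -subset0 => x abx; apply: nab => i.
  by have /andP[+ +] := abx i; exact: lt_trans.
have bO : box a b `<=` Omega by move=> x /sub_box_cbox/abO.
pose p := box_approx a b.
have mp k : measurable_fun Omega (p k).
  have [/= [cp _] _] := test_box_approx ab k abO.
  apply: measurable_funTS; apply: continuous_rV_measurable => //.
  exact: continuous_subspaceT.
pose F k x := (f x * p k x)%:E.
have mF k : measurable_fun Omega (F k).
  by apply/measurable_EFinP; exact: measurable_funM.
have Ff k x : (`|F k x| <= `|(EFin \o f) x|)%E.
  rewrite /F/= lee_fin normrM ler_piMr// ger0_norm ?box_approx_ge0//.
  exact: box_approx_le1.
have Fi k : leb.-integrable Omega (F k).
  by apply: (le_integrable mO _ _ fi) => // x _; exact: Ff.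
have F0 k : (\int[leb]_(x in Omega) F k x = 0)%E.
  have := f0 (test_box_approx ab k abO).
  rewrite /L2dot /Rintegral => h; rewrite -[LHS]fineK ?h//.
  exact: integrable_fin_num.
have mlim : measurable_fun Omega ((EFin \o f) \_ (box a b)).
  apply/(measurable_restrict _ (measurable_box a b) mO).
  apply: measurable_funS (measurable_int _ fi) => //.
have [] := @dominated_convergence _ _ _ leb Omega mO F ((EFin \o f) \_ (box a b))
  (abse \o (EFin \o f)) mF mlim.
- apply: aeW => x Ox; rewrite patchE; case: ifPn => [/set_mem xb|/negP xb].
    apply: cvg_EFin; first by apply: nearW.
    rewrite -[X in _ --> X]mulr1; apply: cvgM; first exact: cvg_cst.
    exact: box_approx_cvg.
  rewrite (_ : (F ^~ x) = cst 0%E); first exact: cvg_cst.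
  apply/funext => k; rewrite /F /p box_approx_out ?mulr0// => xb'; apply: xb.
  exact: mem_set.
- by apply: integrable_abse.
- by apply: aeW => x k _; exact: Ff.
move=> _ _.
rewrite -integral_mkcondr (setIidr bO).
rewrite (_ : [sequence _]_n = cst 0%E); last by apply/funext => k; exact: F0.
by move=> /cvg_lim <-//; rewrite lim_cst.
Qed.

(** Inside one box [D k], a Dynkin class argument extends [box_int0] to all measurable subsets, so
    [f] vanishes almost everywhere there; countably many such boxes cover [Omega]. *)
Lemma dubois_reymond : {ae leb, forall x, Omega x -> f x = 0}.
Proof.
have [B [BO OE]] := open_bigcup_boxes oO.
pose D k := box (B k).1 (B k).2.
have mD k : measurable (D k) by exact: measurable_box.
have DO k : D k `<=` Omega by rewrite OE => x; exists k.
have fiD k : leb.-integrable (D k) (EFin \o f) by apply: integrableS fi.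
have DA0 k A : measurable A -> (\int[leb]_(x in D k `&` A) (f x)%:E = 0)%E.
  rewrite measurable_boxesE -setI_closed_g_dynkin_g_sigma_algebra; last first.
    exact: boxes_setI_closed.
  have fiA C : measurable C -> leb.-integrable (D k `&` C) (EFin \o f).
    by move=> mC; apply: integrableS (fiD k) => //; exact: measurableI.
  have DT : (\int[leb]_(x in D k) (f x)%:E = 0)%E by exact: box_int0.
  suff : <<d @boxes R n.+1 >> `<=` [set A | measurable A /\
      (\int[leb]_(x in D k `&` A) (f x)%:E = 0)%E] by move=> h /h[].
  apply: smallest_sub.
    split=> [|C [mC C0]|F tF mF].
    - by split; [exact: measurableT|rewrite setIT].
    - split; first exact: measurableC.
      have := @integral_setU _ _ _ leb (D k `&` C) (D k `&` ~` C) (EFin \o f)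
        (measurableI _ _ (mD k) mC) (measurableI _ _ (mD k) (measurableC mC)).
      rewrite -setIUr setUv setIT => /(_ (measurable_int _ (fiD k))).
      rewrite DT C0 add0e => ->//.
      by apply/disj_setPS => x [[_ Cx] [_ /(_ Cx)]].
    - split; first by apply: bigcupT_measurable => i; have [] := mF i.
      rewrite setI_bigcupr integral_bigcup.
      + by apply: eseries0 => i _ _; have [] := mF i.
      + exact: trivIset_setIl.
      + by move=> i; apply: measurableI => //; have [] := mF i.
      + rewrite -setI_bigcupr; apply: fiA.
        by apply: bigcupT_measurable => i; have [] := mF i.
  move=> _ [a _ [b _ <-]]; split; first exact: measurable_box.
  rewrite /D boxI; apply: box_int0 => x h; apply: (BO k) => i.
  have := h i; rewrite !mxE ge_max le_min => /andP[/andP[-> _] /andP[-> _]].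
  by [].
have aeD k : {ae leb, forall x, D k x -> f x = 0}.
  have : ae_eq leb (D k) (EFin \o f) (cst 0%E).
    apply: integral_ae_eq => // C CD mC; rewrite integral0.
    by rewrite -(setIidr CD); exact: DA0.
  by apply: filterS => x h Dx; have [] := h Dx.
have := ae_foralln aeD; apply: filterS => x h Ox.
by move: Ox; rewrite OE => -[k _]; exact: h.
Qed.

End dubois_reymond.

(** * Weak derivatives of piecewise affine functions *)

Section translation.
Context {R : realType} (n : nat).
Local Notation leb := (lebesgue_rV n).

Lemma integral_translate (v : 'rV[R]_n) (f : 'rV[R]_n -> \bar R) :
  measurable_fun setT f -> leb.-integrable setT (f \o translate v) ->
  (\int[leb]_x f (translate v x) = \int[leb]_x f x)%E.
Proof.
move=> mf fi.
have := @integral_pushforward _ _ _ _ _ _ (@measurable_translate R n v) leb setT f mf.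
rewrite preimage_setT => /(_ fi measurableT) <-.
apply: eq_measure_integral => [|mt A mA _]; first exact: measurable_translate.
by rewrite /= /pushforward lebesgue_translate.
Qed.

End translation.

Section bounded_integrals.
Context d (T : measurableType d) (R : realType).
Variables (mu : {measure set T -> \bar R}) (D : set T).
Hypotheses (mD : measurable D) (Doo : (mu D < +oo)%E).

Lemma bounded_integrable (f : T -> R) (M : R) : measurable_fun D f ->
  (forall x, D x -> `|f x| <= M) -> mu.-integrable D (EFin \o f).
Proof.
move=> mf fM; apply: measurable_bounded_integrable => //.
exists M; split; first exact: num_real.
by move=> M' MM' x Dx; apply: le_trans (fM _ Dx) (ltW MM').
Qed.

Lemma bounded_Rintegral_cvg (F : nat -> T -> R) (f : T -> R) (M : R) :
  (forall k, measurable_fun D (F k)) -> measurable_fun D f ->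
  (forall k x, D x -> `|F k x| <= M) ->
  {ae mu, forall x, D x -> F k x @[k --> \oo] --> f x} ->
  (\int[mu]_(x in D) F k x)%R @[k --> \oo] --> (\int[mu]_(x in D) f x)%R.
Proof.
move=> mF mf FM Ff.
have Mi : mu.-integrable D (EFin \o (cst `|M| : T -> R)).
  by apply: (@bounded_integrable _ `|M|) => // x _ /=; rewrite normr_id.
have [|||||fi _ h] := @dominated_convergence _ _ _ mu D mD (fun k => EFin \o F k) (EFin \o f)
  (EFin \o (cst `|M| : T -> R)).
- by move=> k; exact/measurable_EFinP.
- exact/measurable_EFinP.
- apply: filterS Ff => x h Dx; apply: cvg_EFin; first exact: nearW.
  exact: h.
- exact: Mi.
- apply: aeW => x k Dx /=; rewrite lee_fin (le_trans (FM k _ Dx))// ler_norm//.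
have ffin : (\int[mu]_(x in D) (EFin \o f) x)%E \is a fin_num.
  by apply: integrable_fin_num => //; exact: fi.
by move: h; rewrite -[X in _ --> X](fineK ffin) => /fine_cvg.
Qed.

End bounded_integrals.

Section test_functions.
Context {R : realType} (n : nat).
Local Notation E := 'rV[R]_n.+1.
Local Notation leb := (lebesgue_rV n.+1).

Lemma continuous_compact_bounded (f : E -> R) (K : set E) :
  continuous f -> compact K -> exists2 M, 0 <= M & forall x, K x -> `|f x| <= M.
Proof.
move=> cf cK.
have /compact_bounded[M [_ h]] : compact (f @` K).
  by apply: continuous_compact => //; exact: continuous_subspaceT.
exists (`|M| + 1) => [|x Kx]; first by rewrite addr_ge0.
by apply: h; [rewrite (le_lt_trans (ler_norm _))// ltrDl|exists x].
Qed.

(** The complement of [K] is open, so there [phi] vanishes near each point and its partial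
    derivative is 0; compactness bounds both on [K]. *)
Lemma test_function_bounds Omega (phi : E -> R) i : test_function Omega phi ->
  exists2 M, 0 <= M & forall x, `|phi x| <= M /\ `|partial i phi x| <= M.
Proof.
move=> [[cphi /(_ i)[dphi cd]] [K [cK KO K0]]].
have [M M0 MP] := continuous_compact_bounded cphi cK.
have [M' M'0 MP'] := continuous_compact_bounded cd cK.
exists (M + M') => [|x]; first exact: addr_ge0.
have [Kx|nKx] := pselect (K x).
  split; first by rewrite (le_trans (MP _ Kx))// lerDl.
  by rewrite (le_trans (MP' _ Kx))// lerDr.
rewrite K0// normr0 addr_ge0//; split => //.
have cKc : closed K by apply: compact_closed => //; exact: norm_hausdorff.
have -> : partial i phi x = 'D_('e_i) (cst 0) x.
  apply: near_eq_derive.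
  have : nbhs x (~` K) by apply: open_nbhs_nbhs; split => //; exact: closed_openC.
  by apply: (@filterS _ (nbhs x)) => y Ky; exact: K0.
by rewrite derive_cst normr0 addr_ge0.
Qed.

Lemma diff_quotient_le phi i (M : R) : C1 phi -> (forall x, `|partial i phi x| <= M) ->
  forall (x : E) t, 0 < t -> `|(phi (x + t *: 'e_i) - phi x) / t| <= M.
Proof.
move=> Cphi pM x t t0.
pose f (s : R) := phi (s *: 'e_i + x).
have fd (s : R) : is_derive s (1 : R) f (partial i phi (s *: 'e_i + x)).
  by apply/is_derive_lineP; exact: C1_is_derive.
have [|s _] := @MVT R f (fun s => partial i phi (s *: 'e_i + x)) 0 t t0 (fun s _ => fd s).
  apply: continuous_subspaceT => s; apply: differentiable_continuous.
  by apply/derivable1_diffP; have [] := fd s.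
rewrite /f scale0r add0r subr0 => e.
by rewrite [x + _]addrC e mulfK ?gt_eqF.
Qed.

Lemma diff_quotient_cvg phi i (t : nat -> R) (x : E) : C1 phi -> (forall k, 0 < t k) ->
  t k @[k --> \oo] --> 0 ->
  ((phi (x + t k *: 'e_i) - phi x) / t k) @[k --> \oo] --> partial i phi x.
Proof.
move=> [_ /(_ i)[/(_ x) dphi _]] t0 tc.
have h : (h^-1 *: ((phi \o shift x) (h *: 'e_i) - phi x)) @[h --> 0^'] --> partial i phi x.
  exact: dphi.
have tc' : t k @[k --> \oo] --> (0 : R)^'.
  move=> A nA; have := tc _ nA.
  by apply: (@filterS _ \oo) => k /=; apply; rewrite gt_eqF.
rewrite (_ : (fun k => _) =
    (fun h => h^-1 *: ((phi \o shift x) (h *: 'e_i) - phi x)) \o t); last first.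
  by apply/funext => k; rewrite [x + _]addrC mulrC.
exact: (cvg_comp _ _ tc' h).
Qed.

(* Compactness of the support leaves room for small translations. *)
Lemma compact_translate (K Omega : set E) (v : E) : compact K -> open Omega -> K `<=` Omega ->
  exists2 r : R, 0 < r & forall x s, K x -> `|s| < r -> Omega (x + s *: v).
Proof.
move=> /compact_near_coveringP cK oO KO.
pose P (s : R) (x : E) := Omega (x + s *: v).
have : \forall s \near (0 : R), K `<=` P s.
  apply: (cK R (nbhs (0 : R)) P (nbhs_filter _)) => x /KO/((open_rVP Omega).1 oO)[e e0 eO].
  pose M : R := \sum_i `|v ord0 i|.
  have M0 : 0 <= M by exact: sumr_ge0.
  have vM i : `|v ord0 i| <= M by rewrite /M (bigD1 i)//= lerDl sumr_ge0.
  pose d := e / 2 / (M + 1).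
  have d0 : 0 < d by rewrite !divr_gt0// ltr_wpDl.
  exists (ball x (e / 2), ball (0 : R) d); first split.
  - by apply: nbhsx_ballx; rewrite divr_gt0.
  - exact: nbhsx_ballx.
  move=> [y s] /= [[_ xy] sd]; apply: eO => i; rewrite !mxE opprD addrA.
  apply: le_lt_trans (ler_normB _ _) _; rewrite normrM.
  have h1 : `|x ord0 i - y ord0 i| < e / 2 by exact: (xy ord0 i).
  have h2 : `|s| < d by move: sd; rewrite /ball/= sub0r normrN.
  have h3 : `|s| * `|v ord0 i| <= e / 2.
    apply: (@le_trans _ _ (d * (M + 1))); last by rewrite divfK// gt_eqF// ltr_wpDl.
    by apply: ler_pM => //; [exact: ltW|apply: le_trans (vM i) _; rewrite lerDl].
  lra.
move=> /nbhs_ballP[r r0 rP]; exists r => // x s Kx sr.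
by apply: rP Kx; rewrite /ball/= sub0r normrN.
Qed.

End test_functions.

Section difference_quotients.
Context {R : realType} (n : nat).
Local Notation E := 'rV[R]_n.+1.
Local Notation leb := (lebesgue_rV n.+1).
Variables (Omega : set E) (i : 'I_n.+1) (u w : E -> R) (Mu Mw L : R).
Hypotheses (oO : open Omega) (Ooo : (leb Omega < +oo)%E).
Hypotheses (mu : measurable_fun Omega u) (uM : forall x, Omega x -> `|u x| <= Mu).
Hypotheses (mw : measurable_fun Omega w) (wM : forall x, Omega x -> `|w x| <= Mw).
Hypothesis lip_u : forall x t,
  (forall s, 0 <= s <= 1 -> Omega (x + s *: (t *: 'e_i))) ->
  `|u (x + t *: 'e_i) - u x| <= L * `|t|.
Hypothesis w_deriv : {ae leb, forall x, Omega x ->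
  exists2 d, 0 < d & forall t, `|t| < d -> u (x + t *: 'e_i) - u x = t * w x}.

Let mO : measurable Omega. Proof. exact: open_rV_measurable. Qed.

(* Discrete integration by parts, by translation invariance of the measure *)
Let shift_integral (phi : E -> R) (t : R) : test_function Omega phi ->
  (\int[leb]_(x in Omega) (u x * phi (x + t *: 'e_i)))%R =
  (\int[leb]_(x in Omega) ((u \_ Omega) (x - t *: 'e_i) * phi x))%R.
Proof.
move=> tphi; have [M M0 MP] := test_function_bounds i tphi.
have [[cphi _] [K [cK KO K0]]] := tphi.
have mphi : measurable_fun setT phi.
  by apply: continuous_rV_measurable => //; exact: continuous_subspaceT.
have mU : measurable_fun setT (u \_ Omega) by apply/(measurable_restrictT u mO).
pose G (y : E) : R := (u \_ Omega) (y - t *: 'e_i) * phi y.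
have mG : measurable_fun setT G.
  apply: measurable_funM => //.
  exact: (measurableT_comp mU (@measurable_translate R n.+1 (- (t *: 'e_i)))).
have GT x : G (translate (t *: 'e_i) x) = (u \_ Omega) x * phi (x + t *: 'e_i).
  by rewrite /G /translate addrK.
rewrite /Rintegral; congr fine.
transitivity (\int[leb]_x (EFin \o G) (translate (t *: 'e_i) x))%E.
  rewrite [LHS]integral_mkcond; apply: eq_integral => x _ /=.
  by rewrite GT !patchE; case: ifP => _ //=; rewrite mul0r.
rewrite integral_translate.
- rewrite [RHS]integral_mkcond; apply: eq_integral => x _ /=.
  rewrite !patchE; case: ifPn => // /negP nx; rewrite /G K0 ?mulr0// => /KO Ox.
  by apply: nx; exact: mem_set.
- exact/measurable_EFinP.
- rewrite (_ : _ \o _ = (EFin \o (fun x => u x * phi (x + t *: 'e_i))) \_ Omega).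
    rewrite -integrable_mkcond//.
    apply: (@bounded_integrable _ _ _ _ _ mO Ooo _ (Mu * M)).
      apply: measurable_funM => //; apply: measurable_funTS.
      exact: (measurableT_comp mphi (@measurable_translate R n.+1 (t *: 'e_i))).
    move=> x Ox; rewrite normrM ler_pM// ?uM//.
    by have [] := MP (x + t *: 'e_i).
  apply/funext => x /=; rewrite GT !patchE; case: ifP => _ //=.
  by rewrite mul0r.
Qed.

(** Both sides of the discrete integration by parts are dominated, one by the mean value theorem for
    [phi], the other by [lip_u]; their limits are the two sides of the weak formulation. *)
Lemma difference_quotient_weak_partial : is_weak_partial Omega i u w.
Proof.
move=> phi tphi; have [M M0 MP] := test_function_bounds i tphi.
have [Cphi [K [cK KO K0]]] := tphi; have [cphi dphi] := Cphi.
have mphi : measurable_fun Omega phi.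
  apply: measurable_funTS.
  by apply: continuous_rV_measurable => //; exact: continuous_subspaceT.
have mdphi : measurable_fun Omega (partial i phi).
  apply: measurable_funTS; apply: continuous_rV_measurable => //.
  by apply: continuous_subspaceT; have [_] := dphi i.
have [r r0 rP] := compact_translate 'e_i cK oO KO.
(* Steps smaller than [r], so that points of [K] remain in [Omega] when moved by them. *)
pose t k := r / 2 * k.+1%:R^-1.
have t0 k : 0 < t k by rewrite mulr_gt0 ?invr_gt0 ?divr_gt0.
have tr k : t k < r.
  apply: (@le_lt_trans _ _ (r / 2)).
    by rewrite ler_piMr ?divr_ge0 ?(ltW r0)// invf_le1// ler1n.
  by rewrite ltr_pdivrMr// ltr_pMr// ltr1n.
have tc : t k @[k --> \oo] --> 0.
  rewrite -[X in _ --> X](mulr0 (r / 2)); apply: cvgM; first exact: cvg_cst.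
  exact: cvg_harmonic.
(* The shifted point may leave [Omega], but only off [K], where [phi] vanishes. *)
pose U := u \_ Omega.
have UE x : Omega x -> U x = u x by move=> Ox; rewrite /U patchE mem_set.
have mU : measurable_fun setT U by apply/(measurable_restrictT u mO).
have mUt k : measurable_fun Omega (fun x => U (x - t k *: 'e_i)).
  apply: measurable_funTS.
  exact: (measurableT_comp mU (@measurable_translate R n.+1 (- (t k *: 'e_i)))).
have mphit k : measurable_fun Omega (fun x => phi (x + t k *: 'e_i)).
  apply: measurable_funTS; have mp : measurable_fun setT phi.
    by apply: continuous_rV_measurable => //; exact: continuous_subspaceT.
  exact: (measurableT_comp mp (@measurable_translate R n.+1 (t k *: 'e_i))).
have Mu0 x : Omega x -> 0 <= Mu by move=> /uM; apply: le_trans.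
have U_le x : `|U x| <= `|Mu|.
  rewrite /U patchE; case: ifPn => [/set_mem/uM h|_]; last by rewrite normr0.
  by apply: le_trans h _; exact: ler_norm.
pose A k x := u x * ((phi (x + t k *: 'e_i) - phi x) / t k).
pose B k x := ((U (x - t k *: 'e_i) - U x) / t k) * phi x.
have iA1 k : leb.-integrable Omega (EFin \o (fun x => u x * phi (x + t k *: 'e_i))).
  apply: (@bounded_integrable _ _ _ _ _ mO Ooo _ (`|Mu| * M)); first exact: measurable_funM.
  by move=> x Ox; rewrite normrM ler_pM// -?(UE _ Ox)//; have [] := MP (x + t k *: 'e_i).
have iA2 : leb.-integrable Omega (EFin \o (fun x => u x * phi x)).
  apply: (@bounded_integrable _ _ _ _ _ mO Ooo _ (`|Mu| * M)); first exact: measurable_funM.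
  by move=> x Ox; rewrite normrM ler_pM// -?(UE _ Ox)//; have [] := MP x.
have iB1 k : leb.-integrable Omega (EFin \o (fun x => U (x - t k *: 'e_i) * phi x)).
  apply: (@bounded_integrable _ _ _ _ _ mO Ooo _ (`|Mu| * M)); first exact: measurable_funM.
  by move=> x Ox; rewrite normrM ler_pM//; have [] := MP x.
have AB k : (\int[leb]_(x in Omega) A k x)%R = (\int[leb]_(x in Omega) B k x)%R.
  transitivity (((\int[leb]_(x in Omega) (u x * phi (x + t k *: 'e_i)))%R -
    (\int[leb]_(x in Omega) (u x * phi x))%R) / t k).
    rewrite -RintegralB// -RintegralZr//; last first.
      by have := integrableB mO (iA1 k) iA2; congr (leb.-integrable _ _).
    by apply: eq_Rintegral => x _; rewrite /A; ring.
  rewrite shift_integral// -/U -RintegralB// -RintegralZr//; last first.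
    by have := integrableB mO (iB1 k) iA2; congr (leb.-integrable _ _).
   by apply: eq_Rintegral => x /set_mem Ox; rewrite /B (UE _ Ox); ring.
have cA : (\int[leb]_(x in Omega) A k x)%R @[k --> \oo] -->
    (\int[leb]_(x in Omega) (u x * partial i phi x))%R.
  apply: (@bounded_Rintegral_cvg _ _ _ _ _ mO Ooo _ _ (`|Mu| * M)).
  - move=> k; apply: measurable_funM => //; apply: measurable_funM => //.
    exact: measurable_funB.
  - exact: measurable_funM.
  - move=> k x Ox; rewrite normrM ler_pM// -?(UE _ Ox)//.
    by apply: diff_quotient_le => // y; have [] := MP y.
  - apply: aeW => x Ox; apply: cvgM; first exact: cvg_cst.
    exact: diff_quotient_cvg.
have cB : (\int[leb]_(x in Omega) B k x)%R @[k --> \oo] -->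
    (\int[leb]_(x in Omega) (- (w x * phi x)))%R.
  apply: (@bounded_Rintegral_cvg _ _ _ _ _ mO Ooo _ _ (`|L| * M)).
  - move=> k; apply: measurable_funM => //; apply: measurable_funM => //.
    by apply: measurable_funB => //; exact: measurable_funTS.
  - by apply: measurableT_comp => //; exact: measurable_funM.
  - move=> k x Ox; rewrite normrM.
    have [Kx|nKx] := pselect (K x); last by rewrite K0// normr0 mulr0 mulr_ge0.
    rewrite ler_pM//; last by have [] := MP x.
    have seg s : 0 <= s <= 1 -> Omega (x + s *: ((- t k) *: 'e_i)).
      move=> /andP[s0 s1]; rewrite scalerA; apply: rP => //.
      rewrite mulrN normrN (ger0_norm (mulr_ge0 s0 (ltW (t0 k)))).
      by apply: le_lt_trans (tr k); rewrite ler_piMl// (ltW (t0 k)).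
    have := lip_u seg; rewrite scaleNr normrN (gtr0_norm (t0 k)).
    have := seg 1; rewrite scale1r scaleNr lexx ler01 => /(_ isT) Oxt.
    rewrite (UE _ Ox) (UE _ Oxt) normrM normfV (gtr0_norm (t0 k)) ler_pdivrMr// => h.
    by apply: le_trans h _; rewrite ler_pM2r// ler_norm.
  (* At almost every [x], the sequence [B k x] is eventually constant. *)
  - apply: filterS w_deriv => x + Ox => /(_ Ox)[d d0 dP].
    have [e e0 eO] := (open_rVP Omega).1 oO _ Ox.
    apply: cvg_near_cst.
    have de0 : 0 < Num.min d e by rewrite lt_min d0.
    have : \forall k \near \oo, `|0 - t k| < Num.min d e by move/cvgrPdist_lt: tc; apply.
    apply: filterS => k; rewrite sub0r normrN (gtr0_norm (t0 k)) lt_min => /andP[td te].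
    have Oxt : Omega (x - t k *: 'e_i).
      apply: eO => j; rewrite !mxE opprD opprK addrA subrr add0r normrM (gtr0_norm (t0 k)).
      apply: le_lt_trans te; rewrite ler_piMr ?(ltW (t0 k))//.
      by rewrite eqxx/=; case: (j == i); rewrite ?normr1 ?normr0.
    rewrite /B (UE _ Ox) (UE _ Oxt) -scaleNr dP ?normrN ?(gtr0_norm (t0 k))//.
    by rewrite mulNr mulNr [t k * _]mulrC mulfK ?gt_eqF// mulNr.
have -> : L2dot leb Omega u (partial i phi) = (\int[leb]_(x in Omega) (- (w x * phi x)))%R.
  rewrite /L2dot -(cvg_lim _ cA)// -(cvg_lim _ cB)//; congr (lim (_ @ \oo)).
  by apply/funext => k; exact: AB.
rewrite /L2dot -[RHS]mulN1r -RintegralZl//.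
  by apply: eq_Rintegral => x _; rewrite mulN1r.
apply: (@bounded_integrable _ _ _ _ _ mO Ooo _ (`|Mw| * M)); first exact: measurable_funM.
move=> x Ox; rewrite normrM ler_pM//; last by have [] := MP x.
exact: le_trans (wM Ox) (ler_norm _).
Qed.

End difference_quotients.

(** * Weak derivatives modulo null sets and the energy form on H^1 *)

Section weak_partial_theory.
Context {R : realType} (n : nat).
Local Notation E := 'rV[R]_n.+1.
Local Notation leb := (lebesgue_rV n.+1).
Variables (Omega : set E).
Hypotheses (oO : open Omega) (Ooo : (leb Omega < +oo)%E).
Local Notation LL := (L2 leb Omega).
Local Notation dot := (L2dot leb Omega).

Let mO : measurable Omega. Proof. exact: open_rV_measurable. Qed.
Let SL := L2_subspace leb Omega.
Let FL := @L2dot_psd _ _ _ leb Omega mO.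

Lemma continuous_bounded_L2 (f : E -> R) (M : R) : continuous f ->
  (forall x, `|f x| <= M) -> LL f.
Proof.
move=> cf fM; apply: (bounded_L2 mO Ooo _ (M := M)) => [|x _]; last exact: fM.
apply: measurable_funTS; apply: continuous_rV_measurable => //.
exact: continuous_subspaceT.
Qed.

Lemma test_function_L2 phi i : test_function Omega phi -> LL phi /\ LL (partial i phi).
Proof.
move=> tphi; have [M M0 MP] := test_function_bounds i tphi.
have [[cphi /(_ i)[_ cd]] _] := tphi.
by split; apply: (@continuous_bounded_L2 _ M) => // x; have [] := MP x.
Qed.

(** The difference is orthogonal to all test functions, and integrable because [Omega] has finite
    measure; [dubois_reymond] applies. *)
Lemma weak_partial_unique i u w w' : LL w -> LL w' ->
  is_weak_partial Omega i u w -> is_weak_partial Omega i u w' ->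
  {ae leb, forall x, Omega x -> w x = w' x}.
Proof.
move=> Lw Lw' uw uw'.
have Ld : LL (w - w') by exact: subspaceB.
have di : leb.-integrable Omega (EFin \o (w - w')).
  have L1 : LL (cst 1) by apply: (@continuous_bounded_L2 _ 1) => [|x]; [exact: cst_continuous|rewrite normr1].
  have := L2_mul_integrable mO Ld L1; congr (leb.-integrable _ (EFin \o _)).
  by apply/funext => x; rewrite mulr1.
have := @dubois_reymond R n Omega (w - w') oO di => /(_ _)H.
apply: filterS (H _) => [x h Ox|phi tphi].
  by apply/eqP; rewrite -subr_eq0; apply/eqP; exact: h.
have [Lphi _] := test_function_L2 i tphi.
by rewrite (formBl FL Lw Lw' Lphi) -[X in X - _]opprK -uw// uw'// opprK subrr.
Qed.

Lemma weak_partial_spec i u : H1 Omega u ->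
  LL (weak_partial Omega i u) /\ is_weak_partial Omega i u (weak_partial Omega i u).
Proof.
move=> [_ /(_ i)[w Lw uw]].
by have := @getPex _ [set w | LL w /\ is_weak_partial Omega i u w] (ex_intro _ w (conj Lw uw)).
Qed.

Lemma is_weak_partial_lin i k u v w w' : LL u -> LL v -> LL w -> LL w' ->
  is_weak_partial Omega i u w -> is_weak_partial Omega i v w' ->
  is_weak_partial Omega i (k *: u + v) (k *: w + w').
Proof.
move=> Lu Lv Lw Lw' uw vw phi tphi; have [Lphi Ldphi] := test_function_L2 i tphi.
rewrite (form_lin FL)// (form_lin FL)// uw// vw//; ring.
Qed.

Lemma weak_partial_ae i u w : H1 Omega u -> LL w -> is_weak_partial Omega i u w ->
  {ae leb, forall x, Omega x -> weak_partial Omega i u x = w x}.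
Proof.
move=> Hu Lw uw; have [L1 w1] := weak_partial_spec i Hu.
exact: weak_partial_unique uw.
Qed.

Lemma H1_subspace : linear_subspace (H1 Omega).
Proof.
have L0 : LL 0 by exact: SL.1.
split.
  split => // i; exists 0 => // phi tphi; have [Lphi Ldphi] := test_function_L2 i tphi.
  by rewrite !(form0l SL FL)// oppr0.
move=> k u v [Lu Hu] [Lv Hv]; split; first exact: SL.2.
move=> i; have [w Lw uw] := Hu i; have [w' Lw' vw'] := Hv i.
exists (k *: w + w'); [exact: SL.2|exact: is_weak_partial_lin].
Qed.

(** [weak_partial] picks a representative for each function separately; linearity comes from
    uniqueness, thus almost everywhere. *)
Lemma weak_partial_lin i k u v : H1 Omega u -> H1 Omega v ->
  {ae leb, forall x, Omega x -> weak_partial Omega i (k *: u + v) x =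
    (k *: weak_partial Omega i u + weak_partial Omega i v) x}.
Proof.
move=> Hu Hv; have [L1 w1] := weak_partial_spec i Hu.
have [L2 w2] := weak_partial_spec i Hv.
apply: weak_partial_ae; [exact: H1_subspace.2|exact: SL.2|].
by apply: is_weak_partial_lin => //; [case: Hu|case: Hv].
Qed.

Lemma form_aE u v : H1 Omega u -> H1 Omega v -> form_a Omega u v =
  \sum_i dot (weak_partial Omega i u) (weak_partial Omega i v).
Proof.
move=> Hu Hv; rewrite /form_a.
(* Integrability is carried along the induction, because additivity of the integral requires it. *)
suff [] : leb.-integrable Omega (EFin \o (fun x =>
    \sum_i weak_partial Omega i u x * weak_partial Omega i v x)) /\
    (\int[leb]_(x in Omega) (\sum_i weak_partial Omega i u x * weak_partial Omega i v x))%R =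
    \sum_i dot (weak_partial Omega i u) (weak_partial Omega i v) by [].
have int i : leb.-integrable Omega
    (EFin \o (fun x => weak_partial Omega i u x * weak_partial Omega i v x)).
  have [L1 _] := weak_partial_spec i Hu; have [L2 _] := weak_partial_spec i Hv.
  exact: L2_mul_integrable.
elim: (index_enum _) => [|i s [IH1 IH2]].
  split; first by under eq_fun do rewrite big_nil; exact: integrable0.
  under eq_Rintegral do rewrite big_nil.
  by rewrite big_nil Rintegral_cst// mul0r.
split.
  have := integrableD mO (int i) IH1; congr (leb.-integrable _ _).
  by apply/funext => x /=; rewrite big_cons.
rewrite big_cons -IH2 -RintegralD//; apply: eq_Rintegral => x _.
by rewrite big_cons.
Qed.

Lemma form_a_psd : psd_form (H1 Omega) (form_a Omega).
Proof.
have S u i : H1 Omega u -> LL (weak_partial Omega i u).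
  by move=> Hu; have [] := weak_partial_spec i Hu.
split=> [u v Hu Hv|k u v w Hu Hv Hw|u Hu].
- rewrite (form_aE Hu Hv) (form_aE Hv Hu); apply: eq_bigr => i _.
  exact: (formC FL (S _ i Hu) (S _ i Hv)).
- have Huv := H1_subspace.2 k _ _ Hu Hv.
  rewrite (form_aE Huv Hw) (form_aE Hu Hw) (form_aE Hv Hw).
  rewrite mulr_sumr -big_split/=; apply: eq_bigr => i _.
  rewrite -(form_lin FL k (S _ i Hu) (S _ i Hv) (S _ i Hw)).
  apply: (eq_ae_L2dot mO (S _ _ Huv) _ (S _ _ Hw) (S _ _ Hw)).
  + by apply: SL.2; exact: S.
  + exact: weak_partial_lin.
  + exact: aeW.
- by rewrite (form_aE Hu Hu) sumr_ge0// => i _; apply: (form_ge0 FL); exact: S.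
Qed.

Lemma H1normE u : H1 Omega u ->
  H1norm Omega u = seminorm (fun u v => dot u v + form_a Omega u v) u.
Proof.
move=> Hu; rewrite /H1norm /seminorm (form_aE Hu Hu) sqr_L2norm//; last by case: Hu.
congr (Num.sqrt (_ + _)); apply: eq_bigr => i _; rewrite sqr_L2norm//.
by have [] := weak_partial_spec i Hu.
Qed.

Lemma form_a_ker u : H1 Omega u -> form_a Omega u u = 0 <->
  forall i, {ae leb, forall x, Omega x -> weak_partial Omega i u x = 0}.
Proof.
move=> Hu; rewrite (form_aE Hu Hu).
have S i : LL (weak_partial Omega i u) by have [] := weak_partial_spec i Hu.
split=> [/eqP|h].
  rewrite psumr_eq0 => [/allP h i|i _]; last by apply: (form_ge0 FL); exact: S.
  by apply/(L2dot_eq0P mO (S i))/eqP; apply: h; rewrite mem_index_enum.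
by apply: big1 => i _; apply/(L2dot_eq0P mO (S i)).
Qed.

End weak_partial_theory.

(** * V_h as a subspace of H^1 and of the boundary spaces *)

Section Vh_theory.
Context {R : realType} (n : nat).
Local Notation E := 'rV[R]_n.+1.
Local Notation leb := (lebesgue_rV n.+1).
Variables (Omega : set E) (tau : seq 'M[R]_(n.+2, n.+1)).
Hypotheses (HOmega : bounded_polygonal_domain Omega) (Htau : triangulation Omega tau).
Local Notation V := (Vh Omega tau).

Let oO : open Omega. Proof. by case: HOmega. Qed.
Let mO : measurable Omega. Proof. exact: open_rV_measurable. Qed.
Let Ooo : (leb Omega < +oo)%E. Proof. exact: lebesgue_domain_lty. Qed.
Let mcO : measurable (closure Omega).
Proof. by apply: closed_rV_measurable; exact: closed_closure. Qed.

Lemma Vh_measurable v : V v -> measurable_fun (closure Omega) v.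
Proof. by move=> [cv _]; exact: continuous_rV_measurable. Qed.

Lemma Vh_H v : V v -> H Omega v.
Proof.
move=> Vv; have [M MP] := Vh_bounded Htau Vv.
apply: (bounded_L2 mO Ooo _ (M := M)) => [|x Ox]; last exact/MP/subset_closure.
by apply: measurable_funS (Vh_measurable Vv) => //; exact: subset_closure.
Qed.

(** Continuity makes [v] Borel on the closure, hence measurable for the surface measure, and [v] is
    bounded on a set of finite surface measure. *)
Lemma Vh_Q (G : set E) v : (@surface_outer R n).-cara.-measurable G ->
  G `<=` closure Omega `\` Omega -> V v -> Q G v.
Proof.
move=> mG GO Vv; have [M MP] := Vh_bounded Htau Vv.
apply: (bounded_L2 mG _ _ (M := M)) => [||x /GO[cx _]]; last exact: MP.
  exact: domain_boundary_surface HOmega Htau _ GO.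
by apply: borel_surface_measurable_fun (Vh_measurable Vv) _ => // x /GO[].
Qed.

Section gradient.
Variables (v : E -> R) (a : 'M[R]_(n.+2, n.+1) -> E) (c : 'M[R]_(n.+2, n.+1) -> R).
Hypothesis (Vv : V v).
Hypothesis vE : forall T, T \in tau -> forall x, hull T x -> v x = aff (a T) (c T) x.
Variable i : 'I_n.+1.

(** The slope on the first simplex whose interior contains [x], and 0 off all interiors; nested
    indicators turn measurability into an induction. *)
Definition pw_gradient (s : seq 'M[R]_(n.+2, n.+1)) (x : E) : R :=
  foldr (fun T r => \1_((hull T)°) x * a T ord0 i + (1 - \1_((hull T)°) x) * r) 0 s.

Lemma measurable_pw_gradient s : measurable_fun setT (pw_gradient s).
Proof.
elim: s => [|T s IH]; first exact: measurable_cst.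
have mT : measurable (hull T)° by apply: open_rV_measurable; exact: open_interior.
have m1 : measurable_fun setT (\1_((hull T)°) : E -> R) by exact: measurable_indic.
apply: measurable_funD; first by apply: measurable_funM => //; exact: measurable_cst.
by apply: measurable_funM => //; apply: measurable_funB => //; exact: measurable_cst.
Qed.

Lemma pw_gradient_le s x : `|pw_gradient s x| <= \sum_(T <- s) `|a T ord0 i|.
Proof.
elim: s => [|T s IH]; first by rewrite big_nil normr0.
rewrite big_cons /= indicE; case: (x \in _) => /=.
  by rewrite subrr mul0r addr0 mul1r lerDl sumr_ge0.
by rewrite mul0r add0r subr0 mul1r (le_trans IH)// lerDr.
Qed.

Lemma pw_gradientP s x T : T \in s -> (hull T)° x ->
  exists2 T', T' \in s & (hull T')° x /\ pw_gradient s x = a T' ord0 i.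
Proof.
elim: s => // S s IH; rewrite inE => TS Tx.
have [Sx|Sx] := pselect ((hull S)° x).
  exists S; first by rewrite inE eqxx.
  by split => //=; rewrite indicE mem_set//= subrr mul0r addr0 mul1r.
case/predU1P : TS => [TS|Ts]; first by rewrite -TS in Sx.
have [T' T's [T'x e]] := IH Ts Tx; exists T'; first by rewrite inE T's orbT.
by split => //=; rewrite indicE memNset//= mul0r add0r subr0 mul1r.
Qed.

Lemma slope_derivative x T : T \in tau -> (hull T)° x ->
  exists2 d, 0 < d & forall t, `|t| < d -> v (x + t *: 'e_i) - v x = t * a T ord0 i.
Proof.
move=> Ttau Tx.
have oT : open (hull T)° by exact: open_interior.
have [e e0 eT] := (open_rVP _).1 oT _ Tx.
exists e => // t te.
have Tt : hull T (x + t *: 'e_i).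
  apply: interior_subset; apply: eT => j; rewrite !mxE opprD addrA subrr sub0r normrN normrM.
  apply: le_lt_trans te; rewrite ler_piMr//.
  by rewrite eqxx/=; case: (j == i); rewrite ?normr1 ?normr0.
rewrite (vE Ttau Tt) (vE Ttau (interior_subset Tx)) aff_line addrAC subrr add0r.
rewrite /aff add0r (bigD1 i)//= mxE !eqxx mulr1 big1 ?addr0// => j ji.
by rewrite mxE (negbTE ji) andbF mulr0.
Qed.

(** Both slopes are difference quotients of the same [v] for a common small step, so the order of
    the simplices in [pw_gradient] is immaterial. *)
Lemma slope_unique x T T' : T \in tau -> T' \in tau -> (hull T)° x -> (hull T')° x ->
  a T ord0 i = a T' ord0 i.
Proof.
move=> Tt T't Tx T'x; have [d d0 dP] := slope_derivative Tt Tx.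
have [d' d'0 d'P] := slope_derivative T't T'x.
pose t := Num.min d d' / 2.
have m0 : 0 < Num.min d d' by rewrite lt_min d0.
have t0 : 0 < t by rewrite divr_gt0.
have tm : t < Num.min d d' by rewrite ltr_pdivrMr// ltr_pMr// ltr1n.
have := tm; rewrite lt_min => /andP[td td'].
apply: (@mulfI _ t); first by rewrite gt_eqF.
by rewrite -dP ?gtr0_norm// -d'P// gtr0_norm.
Qed.

Lemma pw_gradient_interior x T : T \in tau -> (hull T)° x ->
  pw_gradient tau x = a T ord0 i.
Proof.
move=> Tt Tx; have [T' T't [T'x ->]] := pw_gradientP Tt Tx.
exact: slope_unique T'x Tx.
Qed.

Lemma pw_gradient_L2 : L2 leb Omega (pw_gradient tau).
Proof.
apply: (bounded_L2 mO Ooo _ (M := \sum_(T <- tau) `|a T ord0 i|)).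
  exact: measurable_funTS (measurable_pw_gradient tau).
by move=> x _; exact: pw_gradient_le.
Qed.

Lemma pw_gradient_weak_partial : is_weak_partial Omega i v (pw_gradient tau).
Proof.
have [M MP] := Vh_bounded Htau Vv.
pose L := \sum_(T <- tau) \sum_j `|a T ord0 j|.
have L0 : 0 <= L by apply: sumr_ge0 => T _; exact: sumr_ge0.
have aL T j : T \in tau -> `|a T ord0 j| <= L.
  move=> Tt; rewrite /L (big_rem T)//= (bigD1 j)//= -addrA lerDl addr_ge0//.
    exact: sumr_ge0.
  by apply: sumr_ge0 => S _; exact: sumr_ge0.
apply: (@difference_quotient_weak_partial _ _ _ _ _ _ M (\sum_(T <- tau) `|a T ord0 i|) L) => //.
- by apply: measurable_funS (Vh_measurable Vv) => //; exact: subset_closure.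
- by move=> x Ox; exact/MP/subset_closure.
- exact: measurable_funTS (measurable_pw_gradient tau).
- by move=> x _; exact: pw_gradient_le.
- move=> x t seg.
  have <- : \sum_j `|(t *: 'e_i : E) ord0 j| = `|t|.
    rewrite (bigD1 i)//= !mxE !eqxx mulr1 big1 ?addr0// => j ji.
    by rewrite !mxE (negbTE ji) andbF mulr0 normr0.
  by apply: (Vh_lip Htau Vv vE L0 aL) => s /seg; exact: subset_closure.
- have [N [mN N0 sN]] := domain_interiors_ae Htau.
  exists N; split => // x nx; apply: sN; split.
    by apply: contrapT => nOx; apply: nx => Ox.
  move=> [T Tt Tx]; apply: nx => Ox.
  have [d d0 dP] := slope_derivative Tt Tx; exists d => // t td.
  by rewrite dP// (pw_gradient_interior Tt Tx).
Qed.

End gradient.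

Lemma Vh_H1 v : V v -> H1 Omega v.
Proof.
move=> Vv; split; first exact: Vh_H.
have [a [c vE]] := Vh_slopes Vv; move=> i; exists (pw_gradient a i tau).
  exact: pw_gradient_L2.
exact: pw_gradient_weak_partial vE i.
Qed.

(** The piecewise gradient vanishes almost everywhere, while the interior of each simplex meets
    [Omega] in a set of positive measure; so every slope is 0 and [Vh_const] concludes. *)
Lemma Vh_form_a_ker v : V v -> form_a Omega v v = 0 ->
  forall x y, closure Omega x -> closure Omega y -> v x = v y.
Proof.
move=> Vv /(form_a_ker oO (Vh_H1 Vv)) wp0.
have [a [c vE]] := Vh_slopes Vv; apply: (Vh_const HOmega Htau Vv vE) => T i Tt.
apply: contrapT => aT0.
have g0 : {ae leb, forall x, Omega x -> pw_gradient a i tau x = 0}.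
  have := weak_partial_ae oO Ooo (Vh_H1 Vv) (pw_gradient_L2 a i)
    (pw_gradient_weak_partial Vv vE i).
  by apply: filterS2 (wp0 i) => x h h' Ox; rewrite -h'// h.
have [N [mN N0 sN]] := g0.
have : (0 < leb ((hull T)° `&` Omega))%E.
  apply: lebesgue_open_gt0; first by apply: openI; [exact: open_interior|exact: oO].
  exact: (interior_hull_domain Htau Tt).
rewrite lt_neqAle => /andP[/eqP + _]; apply; symmetry.
apply/eqP; rewrite eq_le measure_ge0 andbT -N0; apply: le_measure; rewrite ?inE//.
  apply: open_rV_measurable; apply: openI => //; exact: open_interior.
move=> x [Tx Ox]; apply: sN => h; apply: aT0.
by rewrite -(pw_gradient_interior vE i Tt Tx) h.
Qed.

End Vh_theory.

(** * From the rate to the limits, and the discrete problems as an instance of penalization *)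

Lemma quartic_root_cvg {R : realType} (X : R -> R) (C : R) :
  (forall al, 1 <= al -> 0 <= X al <= C / Num.sqrt (Num.sqrt al)) ->
  X al @[al --> +oo] --> 0.
Proof.
move=> XC; apply/cvgrPdist_le => /= e e0; near=> al.
have al1 : 1 <= al by near: al; apply: nbhs_pinfty_ge; exact: num_real.
have /andP[X0 XCal] := XC _ al1.
rewrite sub0r normrN ger0_norm//; apply: le_trans XCal _.
have al0 : 0 < al by apply: lt_le_trans al1.
rewrite ler_pdivrMr ?sqrtr_gt0// -ler_pdivrMl//.
(* The fourth power of [C / e] is where the bound falls to [e]. *)
have : (e^-1 * C) ^+ 2 ^+ 2 <= al by near: al; apply: nbhs_pinfty_ge; exact: num_real.
move/ler_wsqrtr; rewrite sqrtr_sqr ger0_norm ?sqr_ge0// => /ler_wsqrtr.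
rewrite sqrtr_sqr; exact: le_trans (ler_norm _).
Unshelve. all: by end_near. Qed.

Theorem theorem8 (R : realType) (n : nat)
  (Omega Gamma1 Gamma2 : set 'rV[R]_n.+1)
  (HOmega : bounded_polygonal_domain Omega)
  (HGamma : closure Omega `\` Omega° = Gamma1 `|` Gamma2)
  (HGamma12 : Gamma1 `&` Gamma2 = set0)
  (mGamma1 : (@surface_outer R n).-cara.-measurable Gamma1)
  (mGamma2 : (@surface_outer R n).-cara.-measurable Gamma2)
  (Gamma1_gt0 : (0 < surface n Gamma1)%E)
  (Gamma2_gt0 : (0 < surface n Gamma2)%E)
  (b M1 M2 : R) (b_gt0 : 0 < b) (M1_gt0 : 0 < M1) (M2_gt0 : 0 < M2)
  (zd : 'rV[R]_n.+1 -> R) (Hzd : H Omega zd)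
  (mesh : set R) (tau : R -> seq 'M[R]_(n.+2, n.+1))
  (Htau : regular_family Omega mesh tau)
  (h : R) (Hh : mesh h)
  (uh ph : ('rV[R]_n.+1 -> R) -> ('rV[R]_n.+1 -> R) -> 'rV[R]_n.+1 -> R)
  (uha pha :
    R -> ('rV[R]_n.+1 -> R) -> ('rV[R]_n.+1 -> R) -> 'rV[R]_n.+1 -> R)
  (Huh : forall g q, H Omega g -> Q Gamma2 q ->
    state_h Omega Gamma1 Gamma2 (tau h) b g q (uh g q))
  (Hph : forall g q, H Omega g -> Q Gamma2 q ->
    adjoint_h Omega Gamma1 (tau h) zd (uh g q) (ph g q))
  (Huha : forall (alpha : R) g q, 0 < alpha -> H Omega g -> Q Gamma2 q ->
    state_ha Omega Gamma1 Gamma2 (tau h) b alpha g q (uha alpha g q))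
  (Hpha : forall (alpha : R) g q, 0 < alpha -> H Omega g -> Q Gamma2 q ->
    adjoint_ha Omega Gamma1 (tau h) zd alpha (uha alpha g q) (pha alpha g q))
  (gh qh : 'rV[R]_n.+1 -> R)
  (Hopt : optimal_control Omega Gamma2 (cost Omega Gamma2 zd M1 M2 uh) gh qh)
  (gha qha : R -> 'rV[R]_n.+1 -> R)
  (Hopta : forall alpha : R, 0 < alpha ->
    optimal_control Omega Gamma2 (cost Omega Gamma2 zd M1 M2 (uha alpha))
      (gha alpha) (qha alpha)) :
  [/\ normHQ Omega Gamma2 (gha alpha \- gh) (qha alpha \- qh)
        @[alpha --> +oo] --> 0,
      H1norm Omega (uha alpha (gha alpha) (qha alpha) \- uh gh qh)
        @[alpha --> +oo] --> 0
    & H1norm Omega (pha alpha (gha alpha) (qha alpha) \- ph gh qh)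
        @[alpha --> +oo] --> 0].
Proof.
have [/(_ _ Hh)[_ Ttau _] _ _] := Htau.
have oO : open Omega by case: HOmega.
have mO : measurable Omega by exact: open_rV_measurable.
have Ooo := lebesgue_domain_lty HOmega.
have [G1O G2O] := domain_boundary_closure HOmega HGamma.
pose W := Vh Omega (tau h).
pose form := ('rV[R]_n.+1 -> R) -> ('rV[R]_n.+1 -> R) -> R.
pose dH : form := L2dot (lebesgue_rV n.+1) Omega.
pose dQ : form := L2dot (surface n) Gamma2.
pose s : form := L2dot (surface n) Gamma1.
have SH : linear_subspace (H Omega) := L2_subspace (lebesgue_rV n.+1) Omega.
have SQ : linear_subspace (Q Gamma2) := L2_subspace (surface n) Gamma2.
have SG : linear_subspace (Q Gamma1) := L2_subspace (surface n) Gamma1.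
have SW : linear_subspace W := Vh_subspace Omega (tau h).
have FH : psd_form (H Omega) dH := @L2dot_psd _ _ _ _ Omega mO.
have FQ : psd_form (Q Gamma2) dQ := @L2dot_psd _ _ _ (surface n) Gamma2 mGamma2.
have FG : psd_form (Q Gamma1) s := @L2dot_psd _ _ _ (surface n) Gamma1 mGamma1.
have WH : W `<=` H Omega by move=> v; exact: Vh_H.
have WQ : W `<=` Q Gamma2 by move=> v; exact: Vh_Q.
have WG : W `<=` Q Gamma1 by move=> v; exact: Vh_Q.
have WH1 : W `<=` H1 Omega by move=> v; exact: Vh_H1.
have Fs : psd_form W s := sub_psd_form WG FG.
have Fa : psd_form W (form_a Omega) := sub_psd_form WH1 (form_a_psd oO Ooo).
(* A function that vanishes on the closure is null for the four forms; for [form_a], because 0 is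
   then one of its weak derivatives. *)
have zero (v : 'rV[R]_n.+1 -> R) : W v -> (forall x, closure Omega x -> v x = 0) ->
    [/\ dH v v = 0, dQ v v = 0, form_a Omega v v = 0 & s v v = 0].
  move=> Wv v0.
  have dot0 (f : 'rV[R]_n.+1 -> R) : L2dot (lebesgue_rV n.+1) Omega v f = 0.
    rewrite (@eq_L2dot _ _ _ (lebesgue_rV n.+1) Omega v 0 f f)// => [|x]; last first.
      by rewrite inE => Ox; apply: v0; exact: subset_closure.
    rewrite /L2dot (_ : (fun _ => _) = cst 0) ?Rintegral_cst ?mul0r//.
    by apply/funext => x; rewrite /= mul0r.
  have vG (D : set 'rV[R]_n.+1) : D `<=` closure Omega `\` Omega ->
      L2dot (surface n) D v v = L2dot (surface n) D 0 0.
    by move=> DO; apply: eq_L2dot => x; rewrite inE => /DO[/v0].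
  split; first exact: dot0.
  - by rewrite /dQ vG//; apply: (form0l SQ FQ); case: SQ.
  - apply/(form_a_ker oO (WH1 _ Wv)) => i.
    apply: (weak_partial_ae oO Ooo (WH1 _ Wv)); first by case: SH.
    move=> phi _; rewrite dot0.
    rewrite (@eq_L2dot _ _ _ (lebesgue_rV n.+1) Omega 0 v phi phi)// ?dot0 ?oppr0// => x.
    by rewrite inE => Ox; rewrite v0//; exact: subset_closure.
  - by rewrite /s vG//; apply: (form0l SG FG); case: SG.
pose l (i : 'I_(size (nodes (tau h)))) (v : 'rV[R]_n.+1 -> R) := v (nodes (tau h))`_i.
have l_lin i c u v : W u -> W v -> l i (c *: u + v) = c * l i u + l i v by [].
have l_ker v : W v -> (forall i, l i v = 0) ->
    [/\ dH v v = 0, dQ v v = 0, form_a Omega v v = 0 & s v v = 0].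
  by move=> Wv lv; apply: zero => // x; exact: (Vh_eq0 Ttau Wv lv).
have s0P v : W v -> s v v = 0 <-> {ae surface n, forall x, Gamma1 x -> v x = 0}.
  by move=> /WG; exact: L2dot_eq0P.
(* [Gamma1] has positive surface measure, so a function that is 0 almost everywhere on it is 0 at
   one of its points; zero energy makes it constant on the closure. *)
have as_ker v : W v -> form_a Omega v v = 0 -> s v v = 0 -> dH v v = 0 /\ dQ v v = 0.
  move=> Wv av sv; suff : forall x, closure Omega x -> v x = 0 by case/(zero _ Wv).
  have [x0 G1x vx0] : exists2 x, Gamma1 x & v x = 0.
    apply: contrapT => nex; have [N [mN N0 sN]] := (s0P _ Wv).1 sv.
    move: Gamma1_gt0; rewrite lt_neqAle => /andP[/eqP + _]; apply; symmetry.
    apply/eqP; rewrite eq_le measure_ge0 andbT -N0; apply: le_measure; rewrite ?inE//.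
    by move=> x Gx; apply: sN => /(_ Gx) vx; apply: nex; exists x.
  move=> x cx; rewrite -vx0; apply: (Vh_form_a_ker HOmega Ttau Wv av) => //.
  by have [] := G1O _ G1x.
(* V_0h is the kernel of [s] in V_h, as in the abstract setting. *)
have V0P v : V0h Omega Gamma1 (tau h) v <-> W v /\ s v v = 0.
  by split=> -[Wv]; [move=> /(s0P _ Wv)|move=> /(s0P _ Wv)]; split.
have Wb : W (cst b) := cst_Vh Omega (tau h) b.
have cE (S : ('rV[R]_n.+1 -> R) -> ('rV[R]_n.+1 -> R) -> 'rV[R]_n.+1 -> R) g q :
    H Omega g -> Q Gamma2 q -> W (S g q) ->
    cost Omega Gamma2 zd M1 M2 S g q = control_cost dH dQ zd M1 M2 S g q.
  move=> Hg Qq /WH WS; rewrite /cost /control_cost !sqr_L2norm//.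
  exact: (subspaceB SH WS Hzd).
have optE (S : ('rV[R]_n.+1 -> R) -> ('rV[R]_n.+1 -> R) -> 'rV[R]_n.+1 -> R) g q :
    (forall g q, H Omega g -> Q Gamma2 q -> W (S g q)) ->
    optimal_control Omega Gamma2 (cost Omega Gamma2 zd M1 M2 S) g q ->
    control_optimal (H Omega) (Q Gamma2) dH dQ zd M1 M2 S g q.
  move=> WS [Hg Qq min]; split=> // g' q' Hg' Qq'.
  by rewrite -!cE//; [exact: min|exact: WS|exact: WS].
have Su g q : H Omega g -> Q Gamma2 q ->
    constrained_state W s (form_a Omega) (cst b) (control_load dH dQ g q) (uh g q).
  move=> Hg Qq; have [/V0P[Wub sub] uP] := Huh _ _ Hg Qq; split=> //.
    have -> : uh g q = (uh g q \- cst b) + cst b by apply/funext => x /=; rewrite subrK.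
    exact: subspaceD.
  by move=> v Wv sv; rewrite uP//; exact/V0P.
have Sua al g q : 0 < al -> H Omega g -> Q Gamma2 q ->
    penalized_state W s (form_a Omega) (cst b) al (control_load dH dQ g q) (uha al g q).
  by move=> al0 Hg Qq; have [] := Huha _ _ _ al0 Hg Qq.
have Wu g q : H Omega g -> Q Gamma2 q -> W (uh g q) by move=> Hg /(Su _ _ Hg)[].
have Wua al g q : 0 < al -> H Omega g -> Q Gamma2 q -> W (uha al g q).
  by move=> al0 Hg /(Sua _ _ _ al0 Hg)[].
have Sp g q : H Omega g -> Q Gamma2 q ->
    constrained_state W s (form_a Omega) 0 (dH (uh g q - zd)) (ph g q).
  move=> Hg Qq; have [/V0P[Wp sp] pP] := Hph _ _ Hg Qq; split=> //; first by rewrite subr0.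
  by move=> v Wv sv; rewrite pP//; exact/V0P.
have Spa al g q : 0 < al -> H Omega g -> Q Gamma2 q ->
    penalized_state W s (form_a Omega) 0 al (dH (uha al g q - zd)) (pha al g q).
  move=> al0 Hg Qq; have [Wp pP] := Hpha _ _ _ al0 Hg Qq; split=> // v Wv.
  (* The adjoint problem is a penalized problem with boundary datum 0. *)
  by rewrite (form0l SW Fs Wv) mulr0 addr0 -[RHS]pP.
have [C CP] := penalized_control_cvg SH SQ SW FH FQ Fs Fa WH WQ l_lin l_ker as_ker Wb Hzd
  M1_gt0 M2_gt0 Su Sp Sua Spa (optE _ _ _ Wu Hopt)
  (fun al al0 => optE _ _ _ (fun g q => Wua al g q al0) (Hopta _ al0)).
have [Hg Qq _] := Hopt.
have Hga al : 1 <= al -> [/\ 0 < al, H Omega (gha al) & Q Gamma2 (qha al)].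
  by move=> al1; have al0 := lt_le_trans ltr01 al1; have [] := Hopta _ al0.
split; apply: (@quartic_root_cvg _ _ C) => al al1; rewrite sqrtr_ge0;
  have [al0 Ha Qa] := Hga al al1; have [C1 C2 C3] := CP al al1.
- by rewrite /normHQ L2normE ?L2normE//; [exact: (subspaceB SQ)|exact: (subspaceB SH)].
- have d1 : H1 Omega (uha al (gha al) (qha al) \- uh gh qh).
    by apply: WH1; apply: (subspaceB SW); [exact: Wua|exact: Wu].
  rewrite (H1normE oO d1); exact: C2.
- have d1 : H1 Omega (pha al (gha al) (qha al) \- ph gh qh).
    apply: WH1; apply: (subspaceB SW); first by have [] := Spa _ _ _ al0 Ha Qa.
    by have [] := Sp _ _ Hg Qq.
  rewrite (H1normE oO d1); exact: C3.
Qed.
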